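(* Let $G$ be a second countable locally compact group, let $(\mathcal{A},A)$ be an object of $C^*A_G$ and let $(\mathfrak{I},I)$ be a $C^*$-stable $G$-ideal. A class $[\mathcal{E}]\in \mathcal{E}xt_G(\mathcal{A},\mathfrak{I})$ is invertible in the abelian monoid $\mathcal{E}xt_G(\mathcal{A},\mathfrak{I})$ if and only if $[\mathcal{E}]$ can be represented by a $G$-equivariant Toeplitz extension of $\mathcal{A}$ by $\mathfrak{I}$.
   Context: Categories. $G$ is a second countable locally compact group; a $G$-action $\alpha$ on a $C^*$-algebra $A$ is continuous if $g\mapsto\alpha_g(a)$ is norm continuous for every $a\in A$. $C^*A_G$ is the category whose objects are pairs $(\mathcal{A},A)$ (often written just $\mathcal{A}$) with $A$ a separable $C^*$-algebra with continuous $G$-action and $\mathcal{A}\subseteq A$ a $G$-invariant dense $*$-subalgebra; morphisms $(\mathcal{A},A)\to(\mathcal{A}',A')$ are $G$-equivariant $*$-homomorphisms $\mathcal{A}\to\mathcal{A}'$ bounded in $C^*$-norm. A linear map on $\mathcal{A}$ (not necessarily equivariant) is called $C^*$-bounded if it is induced by a bounded linear map on $A$. $\mathcal{M}(I)$ is the multiplier algebra of $I$ with the induced $G$-action. A $C^*$-stable $G$-ideal is an object $(\mathfrak{I},I)$ of $C^*A_G$ such that $I\otimes\mathcal{K}\cong I$ equivariantly ($\mathcal{K}$ = compact operators on a separable infinite-dimensional Hilbert space, with trivial $G$-action) and $\mathfrak{I}$ is an ideal in $\mathcal{M}(I)$. Put $\mathcal{C}_{\mathfrak{I}}:=\mathcal{M}(I)/\mathfrak{I}$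 (a $*$-algebra with $G$-action) and let $q_{\mathfrak{I}}:\mathcal{M}(I)\to\mathcal{C}_{\mathfrak{I}}$ be the quotient map. Extensions and Busby mappings. A $G$-equivariant extension of $\mathcal{A}$ by $\mathfrak{I}$ is a short exact sequence $0\to\mathfrak{I}\to\mathcal{E}\xrightarrow{\phi}\mathcal{A}\to0$ in $C^*A_G$, whose extension to ambient $C^*$-algebras $0\to I\to E\xrightarrow{\bar\phi}A\to0$ is also exact. Its Busby mapping is the equivariant $*$-homomorphism $\beta=q_{\mathfrak{I}}\tau:\mathcal{A}\to\mathcal{C}_{\mathfrak{I}}$, where $\tau:\mathcal{A}\to\mathcal{E}$ is any linear splitting of $\phi$ and elements of $\mathcal{E}$ are regarded as elements of $\mathcal{M}(I)$ via multiplication on the ideal. An equivariant $*$-homomorphism $\beta:\mathcal{A}\to\mathcal{C}_{\mathfrak{I}}$ is bounded if its composition with $\mathcal{C}_{\mathfrak{I}}\to\mathcal{M}(I)/I$ is $C^*$-bounded; it is trivial if $\beta=q_{\mathfrak{I}}\pi$ for a $C^*$-bounded $G$-equivariant $*$-homomorphism $\pi:\mathcal{A}\to\mathcal{M}(I)$. $B_G(\mathcal{A},\mathfrak{I})$ is the set of bounded $G$-equivariant Busby mappings. The monoid. $U^a(\mathfrak{I})$ is the set of unitaries $u\in\mathcal{M}(I)$ such that $q_{\mathfrak{I}}(u)$ is $G$-invariant. Strong equivalence on $B_G(\mathcal{A},\mathfrak{I})$ is equivalence under the adjoint action of $U^a(\mathfrak{I})$ on $\mathcal{C}_{\mathfrak{I}}$;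 $E_G(\mathcal{A},\mathfrak{I})$ is the set of strong equivalence classes and $D_G(\mathcal{A},\mathfrak{I})$ the set of strong equivalence classes of trivial Busby mappings. There are $G$-invariant isometries $V_1,V_2\in\mathcal{M}(I)$ with $V_1V_1^*+V_2V_2^*=1$; the sum of $\beta_1,\beta_2$ is $\beta_1+\beta_2:=\lambda\circ(\beta_1\oplus\beta_2)$, where $\lambda:M_2\otimes\mathcal{C}_{\mathfrak{I}}\to\mathcal{C}_{\mathfrak{I}}$ is the isomorphism induced by conjugation with $V=V_1\oplus V_2:I\oplus I\to I$. This makes $E_G(\mathcal{A},\mathfrak{I})$ an abelian semigroup (independent of $V$) with subsemigroup $D_G(\mathcal{A},\mathfrak{I})$. Two classes are stably equivalent if they become equal in $E_G$ after adding trivial Busby mappings to each; $\mathcal{E}xt_G(\mathcal{A},\mathfrak{I}):=E_G(\mathcal{A},\mathfrak{I})/D_G(\mathcal{A},\mathfrak{I})$ is the abelian monoid of stable equivalence classes, whose zero is the class of trivial Busby mappings. $[\mathcal{E}]=[\beta]$ denotes the class of the Busby mapping $\beta$ of $\mathcal{E}$. Toeplitz extensions. A $G$-equivariant algebraic $\mathcal{A}-\mathfrak{I}$-Kasparov module is a pair $(\pi,F)$ of a $C^*$-bounded $G$-equivariant representation ($*$-homomorphism) $\pi:\mathcal{A}\to\mathcal{M}(I)$ and a symmetry $F=F^*\in\mathcal{M}(I)$, $F^2=1$, with $g.F-F\in\mathfrak{I}$ for all $g\in G$ and $[F,\pi(a)]\in\mathfrak{I}$ for all $a\in\mathcal{A}$.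 A $G$-equivariant Toeplitz extension is a $G$-equivariant extension admitting a splitting of the form $a\mapsto P\pi(a)P$ for such a $(\pi,F)$ with $P=(F+1)/2$ (so its Busby mapping is $a\mapsto q_{\mathfrak{I}}(P\pi(a)P)$). *)

(* Defs.v *)
From HB Require Import structures.
From mathcomp Require Import all_boot all_order all_algebra.
From mathcomp Require Import boolp classical_sets functions cardinality reals.
From mathcomp Require Import topology normedtype.
From mathcomp Require Import complex.

Set Implicit Arguments.
Unset Strict Implicit.
Unset Printing Implicit Defensive.

Import Order.TTheory GRing.Theory Num.Theory.
Import numFieldNormedType.Exports.

Local Open Scope classical_set_scope.
Local Open Scope complex_scope.
Local Open Scope ring_scope.

HB.mixin Record isTopologicalGroup G of Group G & Topological G := {
  mulg_continuous : continuous (fun p : G * G => (p.1 * p.2)%g) ;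
  invg_continuous : continuous (fun g : G => (g^-1)%g)
}.

#[short(type="topGroupType")]
HB.structure Definition TopologicalGroup :=
  {G of isTopologicalGroup G & Group G & Topological G}.

(* Complex *-algebras, not necessarily unital. *)
HB.mixin Record Lmodule_isStarAlgebra (R : realType) A of GRing.Lmodule R[i] A := {
  amul : A -> A -> A ;
  star : A -> A ;
  amulA : associative amul ;
  amulDl : left_distributive amul +%R ;
  amulDr : right_distributive amul +%R ;
  amulZl : forall (k : R[i]) x y, amul (k *: x) y = k *: amul x y ;
  amulZr : forall (k : R[i]) x y, amul x (k *: y) = k *: amul x y ;
  starK : involutive star ;
  starD : {morph star : x y / x + y} ;
  starZ : forall (k : R[i]) x, star (k *: x) = k^* *: star x ;
  starM : forall x y, star (amul x y) = amul (star y) (star x)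
}.

#[short(type="starAlgType")]
HB.structure Definition StarAlgebra (R : realType) :=
  {A of Lmodule_isStarAlgebra R A & GRing.Lmodule R[i] A}.

Notation "x ** y" := (amul x y) (at level 40, left associativity) : ring_scope.

HB.mixin Record StarAlgebra_hasAction (R : realType) (G : topGroupType) A
    of StarAlgebra R A := {
  act : G -> A -> A ;
  act1 : forall x, act 1%g x = x ;
  actM : forall g h x, act (g * h)%g x = act g (act h x) ;
  actD : forall g, {morph act g : x y / x + y} ;
  actZ : forall g (k : R[i]) x, act g (k *: x) = k *: act g x ;
  act_amul : forall g, {morph act g : x y / x ** y} ;
  act_star : forall g, {morph act g : x / star x}
}.

#[short(type="gstarAlgType")]
HB.structure Definition GStarAlgebra (R : realType) (G : topGroupType) :=
  {A of StarAlgebra_hasAction R G A & StarAlgebra R A}.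

HB.mixin Record StarAlgebra_isCStarAlgebra (R : realType) A
    of StarAlgebra R A & CompleteNormedModule R[i] A := {
  norm_amul : forall x y : A, `|x ** y| <= `|x| * `|y| ;
  cstar_norm : forall x : A, `|star x ** x| = `|x| ^+ 2
}.

#[short(type="cstarAlgType")]
HB.structure Definition CStarAlgebra (R : realType) :=
  {A of StarAlgebra_isCStarAlgebra R A & StarAlgebra R A
      & CompleteNormedModule R[i] A}.

(* *-automorphisms of a C*-algebra are automatically isometric, so norm_act is
   no restriction on the action. *)
HB.mixin Record GStarAlgebra_isContinuous (R : realType) (G : topGroupType) A
    of GStarAlgebra R G A & CStarAlgebra R A := {
  norm_act : forall (g : G) (x : A), `|act g x| = `|x| ;
  act_continuous : forall x : A, continuous (fun g : G => act g x)
}.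

#[short(type="gcstarAlgType")]
HB.structure Definition GCStarAlgebra (R : realType) (G : topGroupType) :=
  {A of GStarAlgebra_isContinuous R G A & GStarAlgebra R G A
      & CStarAlgebra R A}.


Section Elementary.
Context (R : realType).
Implicit Types (A : starAlgType R) (B : cstarAlgType R).

Lemma amul0l A (x : A) : 0 ** x = 0.
Proof. by have := amulZl 0 0 x; rewrite !scale0r. Qed.

Lemma amul0r A (x : A) : x ** 0 = 0.
Proof. by have := amulZr 0 x 0; rewrite !scale0r. Qed.

Lemma amulNl A (x y : A) : - x ** y = - (x ** y).
Proof. by rewrite -scaleN1r amulZl scaleN1r. Qed.

Lemma amulNr A (x y : A) : x ** - y = - (x ** y).
Proof. by rewrite -[- y]scaleN1r amulZr scaleN1r. Qed.

Lemma amulBl A (x y z : A) : (x - y) ** z = x ** z - y ** z.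
Proof. by rewrite amulDl amulNl. Qed.

Lemma amulBr A (x y z : A) : x ** (y - z) = x ** y - x ** z.
Proof. by rewrite amulDr amulNr. Qed.

Lemma star0 A : star 0 = 0 :> A.
Proof. by have := starZ 0 (0 : A); rewrite rmorph0 !scale0r. Qed.

Lemma starN A (x : A) : star (- x) = - star x.
Proof. by rewrite -scaleN1r starZ rmorphN rmorph1 scaleN1r. Qed.

Lemma starB A (x y : A) : star (x - y) = star x - star y.
Proof. by rewrite starD starN. Qed.

Lemma norm_star B (x : B) : `|star x| = `|x|.
Proof.
suff le (y : B) : `|y| <= `|star y|.
  by apply/le_anti; rewrite le andbT; have := le (star x); rewrite starK.
have [->|y0] := eqVneq y 0; first by rewrite normr0.
have ny : 0 < `|y| by rewrite normr_gt0.
by rewrite -(ler_pM2r ny) -expr2 -cstar_norm norm_amul.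
Qed.

Lemma amul_eq0 B (x : B) : (forall a, a ** x = 0) -> x = 0.
Proof.
move=> h; apply/eqP; rewrite -normr_eq0 -sqrf_eq0; apply/eqP.
by rewrite -cstar_norm h normr0.
Qed.

Lemma amul_inj B (x y : B) : (forall a, a ** x = a ** y) -> x = y.
Proof.
move=> h; apply/eqP; rewrite -subr_eq0; apply/eqP; apply: amul_eq0 => a.
by rewrite amulBr h subrr.
Qed.

Lemma amulr_inj B (x y : B) : (forall a, x ** a = y ** a) -> x = y.
Proof.
move=> h; apply: (can_inj (@starK R B)); apply: amul_inj => a.
by rewrite -[a]starK -!starM h.
Qed.

End Elementary.

Section ActionElementary.
Context (R : realType) (G : topGroupType).
Implicit Types (A : gstarAlgType R G).

Lemma act0 A (g : G) : act g 0 = 0 :> A.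
Proof. by have := actZ g 0 (0 : A); rewrite !scale0r. Qed.

Lemma actN A (g : G) (x : A) : act g (- x) = - act g x.
Proof. by rewrite -scaleN1r actZ scaleN1r. Qed.

Lemma actB A (g : G) (x y : A) : act g (x - y) = act g x - act g y.
Proof. by rewrite actD actN. Qed.

Lemma actKV A (g : G) (x : A) : act g (act g^-1%g x) = x.
Proof. by rewrite -actM mulgV act1. Qed.

Lemma actVK A (g : G) (x : A) : act g^-1%g (act g x) = x.
Proof. by rewrite -actM mulVg act1. Qed.

End ActionElementary.

(* Real-valued norms.  The norm of a normed R[i]-module takes values in R[i];
   it is always a nonnegative real number, of which nrm is the value in R. *)
Section RealNorm.
Context (R : realType).
Implicit Types V W : normedModType R[i].

Definition nrm V (x : V) : R := complex.Re `|x|.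

Definition opnorm V W (f : V -> W) : R :=
  sup [set nrm (f x) | x in [set x | nrm x <= 1]].

Lemma nrmE V (x : V) : `|x| = (nrm x)%:C.
Proof. by rewrite /nrm RRe_real// normr_real. Qed.

End RealNorm.

Section NrmTheory.
Context (R : realType).
Implicit Types V W X : normedModType R[i].

Lemma nrm_ge0 V (x : V) : 0 <= nrm x.
Proof. by have := normr_ge0 x; rewrite nrmE lecR. Qed.

Lemma nrmD V (x y : V) : nrm (x + y) <= nrm x + nrm y.
Proof. by have := ler_normD x y; rewrite !nrmE -rmorphD lecR. Qed.

Lemma nrm0 V : nrm (0 : V) = 0.
Proof. by rewrite /nrm normr0. Qed.

Lemma nrm_eq0 V (x : V) : nrm x = 0 -> x = 0.
Proof. by move=> x0; apply/eqP; rewrite -normr_eq0 nrmE x0. Qed.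

Lemma nrmN V (x : V) : nrm (- x) = nrm x.
Proof. by rewrite /nrm normrN. Qed.

Lemma nrmZ V (k : R[i]) (x : V) : nrm (k *: x) = complex.Re `|k| * nrm x.
Proof.
have := normrZ k x; rewrite !nrmE -[`|k|]RRe_real ?normr_real//.
by rewrite -rmorphM => -[].
Qed.

Lemma Re_norm_ge0 (k : R[i]) : 0 <= complex.Re `|k|.
Proof. by have := normr_ge0 k; rewrite -{1}[`|k|]RRe_real ?normr_real// lecR. Qed.

Lemma nrm_amul (A : cstarAlgType R) (x y : A) : nrm (x ** y) <= nrm x * nrm y.
Proof. by have := norm_amul x y; rewrite !nrmE -rmorphM lecR. Qed.

Lemma nrm_star (A : cstarAlgType R) (x : A) : nrm (star x) = nrm x.
Proof. by rewrite /nrm norm_star. Qed.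

Lemma nrm_act (G : topGroupType) (A : gcstarAlgType R G) (g : G) (x : A) :
  nrm (act g x) = nrm x.
Proof. by rewrite /nrm norm_act. Qed.

Definition bounded_map V W (f : V -> W) :=
  exists c : R, forall x, nrm (f x) <= c * nrm x.

Lemma bounded_map_ge0 V W (f : V -> W) : bounded_map f ->
  exists2 c : R, 0 <= c & forall x, nrm (f x) <= c * nrm x.
Proof.
move=> [c hc]; exists `|c|; first exact: normr_ge0.
move=> x; apply: le_trans (hc x) _.
by rewrite ler_wpM2r ?nrm_ge0// ler_norm.
Qed.

Lemma bounded_comp V W X (f : W -> X) (h : V -> W) :
  bounded_map f -> bounded_map h -> bounded_map (f \o h).
Proof.
move=> /bounded_map_ge0[c c0 hc] [d hd]; exists (c * d) => x /=.
by apply: le_trans (hc _) _; rewrite -mulrA ler_wpM2l.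
Qed.

Lemma boundedD V W (f h : V -> W) :
  bounded_map f -> bounded_map h -> bounded_map (fun x => f x + h x).
Proof.
move=> [c hc] [d hd]; exists (c + d) => x /=.
by apply: le_trans (nrmD _ _) _; rewrite mulrDl lerD.
Qed.

Lemma boundedZ V W (k : R[i]) (f : V -> W) :
  bounded_map f -> bounded_map (fun x => k *: f x).
Proof.
move=> [c hc]; exists (complex.Re `|k| * c) => x /=.
by rewrite nrmZ -mulrA ler_wpM2l// Re_norm_ge0.
Qed.

Lemma bounded0 V W : bounded_map (fun _ : V => 0 : W).
Proof. by exists 0 => x; rewrite nrm0 mul0r. Qed.

Lemma bounded_id V : bounded_map (@id V).
Proof. by exists 1 => x; rewrite mul1r. Qed.

Lemma bounded_isom V W (f : V -> W) : (forall x, nrm (f x) = nrm x) -> bounded_map f.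
Proof. by move=> h; exists 1 => x; rewrite mul1r h. Qed.

End NrmTheory.

(* The multiplier algebra M(A) as the algebra of double centralizers (L, R),
   a L(b) = R(a) b.  Linearity and the module identities L(ab) = L(a)b,
   R(ab) = aR(b) follow from this compatibility: see mulL_linear, mulL_amul. *)
Record multiplier (R : realType) (A : cstarAlgType R) := Multiplier {
  mulL : A -> A ;
  mulR : A -> A ;
  mulLR : forall a b, a ** mulL b = mulR a ** b ;
  mulL_bounded : bounded_map mulL ;
  mulR_bounded : bounded_map mulR }.

Section MultiplierAlgebra.
Context (R : realType) (A : cstarAlgType R).
Implicit Types (m n p : multiplier A) (a b x y : A) (k : R[i]).

Lemma multP m n : (forall x, mulL m x = mulL n x) -> m = n.
Proof.
move=> h; have hL : mulL m = mulL n by apply/funext.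
have hR : mulR m = mulR n.
  by apply/funext => a; apply: amulr_inj => b; rewrite -!mulLR hL.
case: m n hL hR {h} => [L S h1 h2 h3] [L' S' h1' h2' h3'] /= eL eS.
by subst L' S'; congr Multiplier; exact: Prop_irrelevance.
Qed.

Lemma mulL_linear m k x y : mulL m (k *: x + y) = k *: mulL m x + mulL m y.
Proof. by apply: amul_inj => a; rewrite amulDr amulZr !mulLR amulDr amulZr. Qed.

Lemma mulR_linear m k x y : mulR m (k *: x + y) = k *: mulR m x + mulR m y.
Proof. by apply: amulr_inj => a; rewrite amulDl amulZl -!mulLR amulDl amulZl. Qed.

Lemma mulL_amul m x y : mulL m (x ** y) = mulL m x ** y.
Proof. by apply: amul_inj => a; rewrite amulA !mulLR amulA. Qed.

Lemma mulR_amul m x y : mulR m (x ** y) = x ** mulR m y.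
Proof. by apply: amulr_inj => a; rewrite -amulA -!mulLR amulA. Qed.

Lemma mulLD m x y : mulL m (x + y) = mulL m x + mulL m y.
Proof. by have := mulL_linear m 1 x y; rewrite !scale1r. Qed.

Lemma mulRD m x y : mulR m (x + y) = mulR m x + mulR m y.
Proof. by have := mulR_linear m 1 x y; rewrite !scale1r. Qed.

Lemma mulL0 m : mulL m 0 = 0.
Proof. by apply: (addrI (mulL m 0)); rewrite -mulLD !addr0. Qed.

Lemma mulR0 m : mulR m 0 = 0.
Proof. by apply: (addrI (mulR m 0)); rewrite -mulRD !addr0. Qed.

Lemma mulLZ m k x : mulL m (k *: x) = k *: mulL m x.
Proof. by have := mulL_linear m k x 0; rewrite mulL0 !addr0. Qed.

Lemma mulRZ m k x : mulR m (k *: x) = k *: mulR m x.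
Proof. by have := mulR_linear m k x 0; rewrite mulR0 !addr0. Qed.

Lemma mone_subproof a b : a ** id b = id a ** b. Proof. by []. Qed.
Definition mone : multiplier A :=
  Multiplier mone_subproof (@bounded_id R A) (@bounded_id R A).

Lemma mzero_subproof a b : a ** (fun=> 0) b = (fun=> 0) a ** b.
Proof. by rewrite amul0l amul0r. Qed.
Definition mzero : multiplier A :=
  Multiplier mzero_subproof (bounded0 A A) (bounded0 A A).

Lemma madd_subproof m n a b :
  a ** (fun x => mulL m x + mulL n x) b = (fun x => mulR m x + mulR n x) a ** b.
Proof. by rewrite amulDl amulDr !mulLR. Qed.
Definition madd m n : multiplier A :=
  Multiplier (madd_subproof m n)
    (boundedD (mulL_bounded m) (mulL_bounded n))
    (boundedD (mulR_bounded m) (mulR_bounded n)).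

Lemma mscale_subproof k m a b :
  a ** (fun x => k *: mulL m x) b = (fun x => k *: mulR m x) a ** b.
Proof. by rewrite amulZl amulZr mulLR. Qed.
Definition mscale k m : multiplier A :=
  Multiplier (mscale_subproof k m)
    (boundedZ k (mulL_bounded m)) (boundedZ k (mulR_bounded m)).

Lemma mmul_subproof m n a b :
  a ** (mulL m \o mulL n) b = (mulR n \o mulR m) a ** b.
Proof. by rewrite /= !mulLR. Qed.
Definition mmul m n : multiplier A :=
  Multiplier (mmul_subproof m n)
    (bounded_comp (mulL_bounded m) (mulL_bounded n))
    (bounded_comp (mulR_bounded n) (mulR_bounded m)).

Lemma mstar_subproof m a b :
  a ** (star \o (mulR m \o star)) b = (star \o (mulL m \o star)) a ** b.
Proof.
by apply: (can_inj (@starK R A)); rewrite /= !starM !starK mulLR.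
Qed.

Let bounded_star : bounded_map (@star R A).
Proof. exact: bounded_isom (@nrm_star R A). Qed.

Definition mstar m : multiplier A :=
  Multiplier (mstar_subproof m)
    (bounded_comp bounded_star (bounded_comp (mulR_bounded m) bounded_star))
    (bounded_comp bounded_star (bounded_comp (mulL_bounded m) bounded_star)).

HB.instance Definition _ := gen_eqMixin (multiplier A).
HB.instance Definition _ := gen_choiceMixin (multiplier A).

Let maddA : associative madd.
Proof. by move=> m n p; apply: multP => x /=; rewrite addrA. Qed.
Let maddC : commutative madd.
Proof. by move=> m n; apply: multP => x /=; rewrite addrC. Qed.
Let madd0 : left_id mzero madd.
Proof. by move=> m; apply: multP => x /=; rewrite add0r. Qed.
Let maddN : left_inverse mzero (mscale (-1)) madd.
Proof. by move=> m; apply: multP => x /=; rewrite scaleN1r addNr. Qed.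

HB.instance Definition _ :=
  GRing.isZmodule.Build (multiplier A) maddA maddC madd0 maddN.

Let mscaleA j k m : mscale j (mscale k m) = mscale (j * k) m.
Proof. by apply: multP => x /=; rewrite scalerA. Qed.
Let mscale1 : left_id 1 mscale.
Proof. by move=> m; apply: multP => x /=; rewrite scale1r. Qed.
Let mscaleDr : right_distributive mscale +%R.
Proof. by move=> k m n; apply: multP => x /=; rewrite scalerDr. Qed.
Let mscaleDl m : {morph mscale^~ m : j k / j + k}.
Proof. by move=> j k; apply: multP => x /=; rewrite scalerDl. Qed.

HB.instance Definition _ := GRing.Zmodule_isLmodule.Build R[i] (multiplier A)
  mscaleA mscale1 mscaleDr mscaleDl.

Let mmulA : associative mmul.
Proof. by move=> m n p; apply: multP. Qed.
Let mmulDl : left_distributive mmul +%R.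
Proof. by move=> m n p; apply: multP. Qed.
Let mmulDr : right_distributive mmul +%R.
Proof. by move=> m n p; apply: multP => x /=; rewrite mulLD. Qed.
Let mmulZl k m n : mmul (k *: m) n = k *: mmul m n.
Proof. exact: multP. Qed.
Let mmulZr k m n : mmul m (k *: n) = k *: mmul m n.
Proof. by apply: multP => x /=; rewrite mulLZ. Qed.
Let mstarK : involutive mstar.
Proof. by move=> m; apply: multP => x /=; rewrite !starK. Qed.
Let mstarD : {morph mstar : m n / m + n}.
Proof. by move=> m n; apply: multP => x /=; rewrite starD. Qed.
Let mstarZ k m : mstar (k *: m) = k^* *: mstar m.
Proof. by apply: multP => x /=; rewrite starZ. Qed.
Let mstarM m n : mstar (mmul m n) = mmul (mstar n) (mstar m).
Proof. by apply: multP => x /=; rewrite starK. Qed.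

HB.instance Definition _ := Lmodule_isStarAlgebra.Build R (multiplier A)
  mmulA mmulDl mmulDr mmulZl mmulZr mstarK mstarD mstarZ mstarM.

Definition mnorm m : R := opnorm (mulL m).

(* The canonical map A -> M(A), sending a to left and right multiplication
   by a. *)
Lemma inner_subproof a x y : x ** (amul a) y = (amul^~ a) x ** y.
Proof. by rewrite amulA. Qed.

Let bounded_amull a : bounded_map (amul a).
Proof. by exists (nrm a) => x; rewrite nrm_amul. Qed.

Let bounded_amulr a : bounded_map (amul^~ a).
Proof. by exists (nrm a) => x; rewrite mulrC nrm_amul. Qed.

Definition inner a : multiplier A :=
  Multiplier (inner_subproof a) (bounded_amull a) (bounded_amulr a).

End MultiplierAlgebra.

Arguments mone {R A}.

Section MultiplierAction.
Context (R : realType) (G : topGroupType) (A : gcstarAlgType R G).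
Implicit Types (m n : multiplier A) (g h : G).

Lemma mact_subproof g m (a b : A) :
  a ** (act g \o (mulL m \o act g^-1%g)) b =
  (act g \o (mulR m \o act g^-1%g)) a ** b.
Proof.
by rewrite /= -{1}[a](actKV g) -{2}[b](actKV g) -!act_amul mulLR.
Qed.

Let bounded_act g : bounded_map (act g : A -> A).
Proof. exact: bounded_isom (nrm_act g). Qed.

Definition mact g m : multiplier A :=
  Multiplier (mact_subproof g m)
    (bounded_comp (bounded_act g)
      (bounded_comp (mulL_bounded m) (bounded_act g^-1%g)))
    (bounded_comp (bounded_act g)
      (bounded_comp (mulR_bounded m) (bounded_act g^-1%g))).

Let mact1 m : mact 1%g m = m.
Proof. by apply: multP => x /=; rewrite invg1 !act1. Qed.
Let mactM g h m : mact (g * h)%g m = mact g (mact h m).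
Proof. by apply: multP => x /=; rewrite invgM !actM. Qed.
Let mactD g : {morph mact g : m n / m + n}.
Proof. by move=> m n; apply: multP => x /=; rewrite actD. Qed.
Let mactZ g (k : R[i]) m : mact g (k *: m) = k *: mact g m.
Proof. by apply: multP => x /=; rewrite actZ. Qed.
Let mact_mul g : {morph mact g : m n / m ** n}.
Proof. by move=> m n; apply: multP => x /=; rewrite actVK. Qed.
Let mact_star g : {morph mact g : m / star m}.
Proof. by move=> m; apply: multP => x /=; rewrite !act_star. Qed.

HB.instance Definition _ := StarAlgebra_hasAction.Build R G (multiplier A)
  mact1 mactM mactD mactZ mact_mul mact_star.

End MultiplierAction.

(* The type of the classes {y | r x y}.  This is the quotient of T by r when r is
   an equivalence relation, as are all the relations it is used for. *)
Section Quotient.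
Context (T : Type) (r : T -> T -> Prop).

Definition cquot := {c : set T | exists x, c = [set y | r x y]}.

Definition cpi (x : T) : cquot :=
  exist _ [set y | r x y] (ex_intro _ x erefl).

Definition crepr (c : cquot) : T := sval (cid (svalP c)).

Lemma creprK c : cpi (crepr c) = c.
Proof.
rewrite /crepr; case: cid => x /=; case: c => c hc /= cE; subst c.
by congr exist; exact: Prop_irrelevance.
Qed.

End Quotient.

Section StarIdeals.
Context (R : realType) (G : topGroupType).

(* Equivariant *-homomorphisms. *)
Definition star_hom (X Y : gstarAlgType R G) (f : X -> Y) := [/\ linear f,
  {morph f : x y / x ** y}, {morph f : x / star x} &
  forall g : G, {morph f : x / act g x}].

(* G-invariant two-sided *-ideals. *)
Record gideal (X : gstarAlgType R G) := GIdeal {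
  ideal_set :> X -> Prop ;
  idealP : forall k x y, ideal_set x -> ideal_set y -> ideal_set (k *: x + y) ;
  ideal_amull : forall x y, ideal_set y -> ideal_set (x ** y) ;
  ideal_amulr : forall x y, ideal_set x -> ideal_set (x ** y) ;
  ideal_star : forall x, ideal_set x -> ideal_set (star x) ;
  ideal_act : forall (g : G) x, ideal_set x -> ideal_set (act g x) ;
  ideal0 : ideal_set 0 }.

(* The operations of the quotient algebra are locked: unlocked, they would unify
   with qpi _ when rewriting. *)
Fact quot_key : unit. Proof. by []. Qed.

Definition quot (X : gstarAlgType R G) (J : gideal X) :=
  cquot (fun x y : X => J (y - x)).

Section QuotientAlgebra.
Context (X : gstarAlgType R G) (J : gideal X).
Implicit Types (x y : X) (c d e : quot J) (k : R[i]).

Definition qpi x : quot J := cpi _ x.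

Lemma idealD x y : J x -> J y -> J (x + y).
Proof. by move=> Jx; have := idealP 1 Jx; rewrite scale1r; apply. Qed.

Lemma idealZ k x : J x -> J (k *: x).
Proof. by move=> Jx; have := idealP k Jx (ideal0 J); rewrite addr0. Qed.

Lemma idealN x : J x -> J (- x).
Proof. by rewrite -scaleN1r; exact: idealZ. Qed.

Lemma idealB x y : J x -> J y -> J (x - y).
Proof. by move=> Jx /idealN; exact: idealD. Qed.

Lemma qpiP x y : qpi x = qpi y <-> J (x - y).
Proof.
split=> [/(congr1 sval)/seteqP[h _]|Jxy].
  by have /= := h x; rewrite subrr; apply; exact: ideal0.
suff E : [set z | J (z - x)] = [set z | J (z - y)].
  rewrite /qpi /cpi; move: (ex_intro _ _ _) (ex_intro _ _ _).
  by rewrite E => p q; congr exist; exact: Prop_irrelevance.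
apply/seteqP; split=> z /= Jz.
  by rewrite -[z - y](subrKA x) ; exact: idealD.
by rewrite -[z - x](subrKA y); apply: idealD => //; rewrite -opprB; exact: idealN.
Qed.

Lemma qpi_surj c : exists x, c = qpi x.
Proof. by exists (crepr c); rewrite -[LHS]creprK. Qed.

Lemma qrepr x : J (crepr (qpi x) - x).
Proof. by apply/qpiP; exact: creprK. Qed.

Definition qadd c d : quot J := locked_with quot_key (qpi (crepr c + crepr d)).
Definition qscale k c : quot J := locked_with quot_key (qpi (k *: crepr c)).
Definition qmul c d : quot J := locked_with quot_key (qpi (crepr c ** crepr d)).
Definition qstar c : quot J := locked_with quot_key (qpi (star (crepr c))).
Definition qact (g : G) c : quot J := locked_with quot_key (qpi (act g (crepr c))).

Let qaddE x y : qadd (qpi x) (qpi y) = qpi (x + y).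
Proof. by rewrite /qadd unlock; apply/qpiP; rewrite opprD addrACA; apply: idealD; exact: qrepr. Qed.

Let qscaleE k x : qscale k (qpi x) = qpi (k *: x).
Proof. by rewrite /qscale unlock; apply/qpiP; rewrite -scalerBr; apply: idealZ; exact: qrepr. Qed.

Let qmulE x y : qmul (qpi x) (qpi y) = qpi (x ** y).
Proof.
rewrite /qmul unlock; apply/qpiP; rewrite -[_ - _](subrKA (x ** crepr (qpi y))).
rewrite -amulBl -amulBr; apply: idealD.
  by apply: ideal_amulr; exact: qrepr.
by apply: ideal_amull; exact: qrepr.
Qed.

Let qstarE x : qstar (qpi x) = qpi (star x).
Proof. by rewrite /qstar unlock; apply/qpiP; rewrite -starB; apply: ideal_star; exact: qrepr. Qed.

Let qactE (g : G) x : qact g (qpi x) = qpi (act g x).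
Proof. by rewrite /qact unlock; apply/qpiP; rewrite -actB; apply: ideal_act; exact: qrepr. Qed.

HB.instance Definition _ := gen_eqMixin (quot J).
HB.instance Definition _ := gen_choiceMixin (quot J).

Local Ltac lift := repeat (let c := fresh "c" in move=> c; try
  (let x := fresh "x" in case: (qpi_surj c) => x ->));
  rewrite ?(qaddE, qscaleE, qmulE, qstarE, qactE).

Let qaddA : associative qadd.
Proof. by lift; rewrite addrA. Qed.
Let qaddC : commutative qadd.
Proof. by lift; rewrite addrC. Qed.
Let qadd0 : left_id (qpi 0) qadd.
Proof. by lift; rewrite add0r. Qed.
Let qaddN : left_inverse (qpi 0) (qscale (-1)) qadd.
Proof. by lift; rewrite scaleN1r addNr. Qed.

HB.instance Definition _ :=
  GRing.isZmodule.Build (quot J) qaddA qaddC qadd0 qaddN.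

Lemma qpiD x y : qpi (x + y) = qpi x + qpi y.
Proof. by rewrite -qaddE. Qed.

Let qscaleA j k c : qscale j (qscale k c) = qscale (j * k) c.
Proof. by move: j k c; lift; rewrite scalerA. Qed.
Let qscale1 : left_id 1 qscale.
Proof. by lift; rewrite scale1r. Qed.
Let qscaleDr : right_distributive qscale +%R.
Proof. by lift; rewrite -?qpiD ?qscaleE -?qpiD scalerDr. Qed.
Let qscaleDl c : {morph qscale^~ c : j k / j + k}.
Proof. by move: c; lift; rewrite -?qpiD scalerDl. Qed.

HB.instance Definition _ := GRing.Zmodule_isLmodule.Build R[i] (quot J)
  qscaleA qscale1 qscaleDr qscaleDl.

Lemma qpiZ k x : qpi (k *: x) = k *: qpi x.
Proof. by rewrite -qscaleE. Qed.

Let qmulA : associative qmul.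
Proof. by lift; rewrite amulA. Qed.
Let qmulDl : left_distributive qmul +%R.
Proof. by lift; rewrite -?qpiD ?qmulE -?qpiD amulDl. Qed.
Let qmulDr : right_distributive qmul +%R.
Proof. by lift; rewrite -?qpiD ?qmulE -?qpiD amulDr. Qed.
Let qmulZl k c d : qmul (k *: c) d = k *: qmul c d.
Proof. by move: k c d; lift; rewrite -?qpiZ ?qmulE -?qpiZ amulZl. Qed.
Let qmulZr k c d : qmul c (k *: d) = k *: qmul c d.
Proof. by move: k c d; lift; rewrite -?qpiZ ?qmulE -?qpiZ amulZr. Qed.
Let qstarK : involutive qstar.
Proof. by lift; rewrite starK. Qed.
Let qstarD : {morph qstar : c d / c + d}.
Proof. by lift; rewrite -?qpiD ?qstarE -?qpiD starD. Qed.
Let qstarZ k c : qstar (k *: c) = k^* *: qstar c.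
Proof. by move: k c; lift; rewrite -?qpiZ ?qstarE -?qpiZ starZ. Qed.
Let qstarM c d : qstar (qmul c d) = qmul (qstar d) (qstar c).
Proof. by move: c d; lift; rewrite starM. Qed.

HB.instance Definition _ := Lmodule_isStarAlgebra.Build R (quot J)
  qmulA qmulDl qmulDr qmulZl qmulZr qstarK qstarD qstarZ qstarM.

Lemma qpiM x y : qpi (x ** y) = qpi x ** qpi y.
Proof. by rewrite -qmulE. Qed.

Lemma qpi_star x : qpi (star x) = star (qpi x).
Proof. by rewrite -qstarE. Qed.

Let qact1 c : qact 1%g c = c.
Proof. by move: c; lift; rewrite act1. Qed.
Let qactM (g h : G) c : qact (g * h)%g c = qact g (qact h c).
Proof. by have [x ->] := qpi_surj c; rewrite !qactE actM. Qed.
Let qactD (g : G) : {morph qact g : c d / c + d}.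
Proof. by lift; rewrite -?qpiD ?qactE -?qpiD actD. Qed.
Let qactZ (g : G) k c : qact g (k *: c) = k *: qact g c.
Proof. by have [x ->] := qpi_surj c; rewrite -?qpiZ ?qactE -?qpiZ actZ. Qed.
Let qact_mul (g : G) : {morph qact g : c d / c ** d}.
Proof. by lift; rewrite -?qpiM ?qactE -?qpiM act_amul. Qed.
Let qact_star (g : G) : {morph qact g : c / star c}.
Proof. by lift; rewrite -?qpi_star ?qactE -?qpi_star act_star. Qed.

HB.instance Definition _ := StarAlgebra_hasAction.Build R G (quot J)
  qact1 qactM qactD qactZ qact_mul qact_star.

Lemma qpi_act (g : G) x : qpi (act g x) = act g (qpi x).
Proof. by rewrite -qactE. Qed.

Lemma qpi_hom : star_hom qpi.
Proof.
split; [by move=> k x y; rewrite qpiD qpiZ | exact: qpiM | exact: qpi_star |].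
by move=> g x; exact: qpi_act.
Qed.

End QuotientAlgebra.

End StarIdeals.

Section MultiplierNorm.
Context (R : realType) (A : cstarAlgType R).
Implicit Types (m n : multiplier A) (x : A).

Let ball_image m := [set nrm (mulL m x) | x in [set x | nrm x <= 1]].

Let ball_image_sup m : has_sup (ball_image m).
Proof.
split; first by exists (nrm (mulL m 0)), 0 => //=; rewrite nrm0.
have [c c0 hc] := bounded_map_ge0 (mulL_bounded m).
by exists c => _ [x /= x1 <-]; apply: le_trans (hc x) _; rewrite ler_piMr.
Qed.

Lemma mnorm_ge0 m : 0 <= mnorm m.
Proof.
apply: le_trans (nrm_ge0 (mulL m 0)) _; apply: ub_le_sup.
  by case: (ball_image_sup m).
by exists 0 => //=; rewrite nrm0.
Qed.

Lemma mnorm_ub m x : nrm (mulL m x) <= mnorm m * nrm x.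
Proof.
have [/nrm_eq0 ->|x0] := eqVneq (nrm x) 0.
  by rewrite mulL0 nrm0 mulr_ge0// ?mnorm_ge0 ?nrm_ge0.
have xp : 0 < nrm x by rewrite lt_def x0 nrm_ge0.
pose k : R[i] := ((nrm x)^-1)%:C.
have nk : complex.Re `|k| = (nrm x)^-1.
  by rewrite ger0_norm// lecR invr_ge0 nrm_ge0.
rewrite -ler_pdivrMr// mulrC.
apply: ub_le_sup; first by case: (ball_image_sup m).
by exists (k *: x); rewrite /= ?mulLZ nrmZ nk// mulVf.
Qed.

Lemma mnorm_le m (c : R) : 0 <= c ->
  (forall x, nrm (mulL m x) <= c * nrm x) -> mnorm m <= c.
Proof.
move=> c0 h; apply: ge_sup; first by case: (ball_image_sup m).
by move=> _ [x /= x1 <-]; apply: le_trans (h x) _; rewrite ler_piMr.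
Qed.

Lemma mnormD m n : mnorm (m + n) <= mnorm m + mnorm n.
Proof.
apply: mnorm_le => [|x]; first by rewrite addr_ge0 ?mnorm_ge0.
by rewrite mulrDl; apply: le_trans (nrmD _ _) _; rewrite lerD ?mnorm_ub.
Qed.

Lemma mnormM m n : mnorm (m ** n) <= mnorm m * mnorm n.
Proof.
apply: mnorm_le => [|x]; first by rewrite mulr_ge0 ?mnorm_ge0.
apply: le_trans (mnorm_ub m (mulL n x)) _.
by rewrite -mulrA ler_wpM2l ?mnorm_ge0 ?mnorm_ub.
Qed.

End MultiplierNorm.

Section QuotientNorm.
Context (R : realType) (G : topGroupType) (A : gcstarAlgType R G).
Context (J : gideal (multiplier A)).
Implicit Types (c d : quot J) (m n : multiplier A).

(* The quotient seminorm on M(A) / J. *)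
Definition qnorm c : R := inf [set mnorm m | m in [set m | qpi J m = c]].

Let reps_neq0 c : [set mnorm m | m in [set m | qpi J m = c]] !=set0.
Proof. by have [m ->] := qpi_surj c; exists (mnorm m), m. Qed.

Lemma qnorm_le m : qnorm (qpi J m) <= mnorm m.
Proof.
apply: ge_inf; last by exists m.
by exists 0 => _ [n _ <-]; exact: mnorm_ge0.
Qed.

Lemma le_qnorm c (x : R) : (forall m, c = qpi J m -> x <= mnorm m) -> x <= qnorm c.
Proof.
move=> h; apply: lb_le_inf; first exact: reps_neq0.
by move=> _ [m /= mc <-]; exact: h.
Qed.

Lemma qnorm_ge0 c : 0 <= qnorm c.
Proof. by apply: le_qnorm => m _; exact: mnorm_ge0. Qed.

Lemma qnormD c d : qnorm (c + d) <= qnorm c + qnorm d.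
Proof.
rewrite -lerBlDr; apply: le_qnorm => m ->.
rewrite lerBlDl -lerBlDr; apply: le_qnorm => n ->.
by rewrite lerBlDl -qpiD; exact: le_trans (qnorm_le _) (mnormD _ _).
Qed.

Lemma qnorm_conj m n c :
  qnorm (qpi J m ** c ** qpi J n) <= (mnorm m * mnorm n + 1) * qnorm c.
Proof.
have k0 : 0 < mnorm m * mnorm n + 1 by rewrite ltr_wpDl// mulr_ge0 ?mnorm_ge0.
rewrite -ler_pdivrMl//; apply: le_qnorm => p ->; rewrite ler_pdivrMl// -!qpiM.
apply: le_trans (qnorm_le _) _; apply: le_trans (mnormM _ _) _.
apply: le_trans (ler_wpM2r (mnorm_ge0 _) (mnormM _ _)) _.
by rewrite mulrAC ler_wpM2r ?mnorm_ge0// lerDl.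
Qed.

End QuotientNorm.

Section Homomorphisms.
Context (R : realType) (G : topGroupType).
Implicit Types X Y Z : gstarAlgType R G.

(* An isomorphism of C*-algebras; the isometry clause is automatic. *)
Definition cstar_iso (A B : gcstarAlgType R G) (f : A -> B) :=
  [/\ star_hom f, bijective f & forall x, nrm (f x) = nrm x].

Lemma star_homD X Y (f : X -> Y) x y : star_hom f -> f (x + y) = f x + f y.
Proof. by case=> h _ _ _; have := h 1 x y; rewrite !scale1r. Qed.

Lemma star_hom0 X Y (f : X -> Y) : star_hom f -> f 0 = 0.
Proof. by move=> h; apply: (addrI (f 0)); rewrite -star_homD// !addr0. Qed.

Lemma star_hom_comp X Y Z (f : Y -> Z) (h : X -> Y) :
  star_hom f -> star_hom h -> star_hom (f \o h).
Proof.
case=> f1 f2 f3 f4 [h1 h2 h3 h4]; split=> /=.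
- by move=> k x y /=; rewrite h1 f1.
- by move=> x y /=; rewrite h2 f2.
- by move=> x /=; rewrite h3 f3.
- by move=> g x /=; rewrite h4 f4.
Qed.

Lemma conj_linear (S : starAlgType R) (X : lmodType R[i]) (f : X -> S) (v w : S) :
  linear f -> linear (fun x => v ** f x ** w).
Proof. by move=> h k x y; rewrite h amulDr amulDl amulZr amulZl. Qed.

Lemma linear_add (X V : lmodType R[i]) (f h : X -> V) :
  linear f -> linear h -> linear (fun x => f x + h x).
Proof. by move=> hf hh k x y; rewrite hf hh scalerDr addrACA. Qed.

Lemma conj_sum_hom X Y (f h : X -> Y) (v w e : Y) :
  star_hom f -> star_hom h ->
  (forall y, y ** e = y) -> star v ** v = e -> star w ** w = e ->
  star v ** w = 0 -> (forall g : G, act g v = v) -> (forall g : G, act g w = w) ->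
  star_hom (fun x => v ** f x ** star v + w ** h x ** star w).
Proof.
move=> [f1 f2 f3 f4] [h1 h2 h3 h4] ye vv ww vw gv gw.
have wv : star w ** v = 0 by rewrite -[LHS]starK starM starK vw star0.
have conjM (a b p q : Y) (x y : Y) : a ** x ** star b ** (p ** y ** star q) =
    a ** x ** (star b ** p) ** y ** star q by rewrite !amulA.
split=> [||x|g x].
- by apply: linear_add; exact: conj_linear.
- move=> x y; rewrite f2 h2 amulDl !amulDr !conjM vv ww vw wv !ye.
  by rewrite !amul0r !amul0l addr0 add0r !amulA.
- by rewrite f3 h3 starD !starM !starK !amulA.
- by rewrite f4 h4 actD !act_amul !act_star gv gw.
Qed.

Lemma inner_hom (A : gcstarAlgType R G) : star_hom (@inner R A).
Proof.
split=> [k x y|x y|x|g x]; apply: multP => z /=.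
- by rewrite amulDl amulZl.
- by rewrite amulA.
- by rewrite starM starK.
- by rewrite act_amul actKV.
Qed.

Lemma mul_inner (A : cstarAlgType R) (m : multiplier A) (a : A) :
  m ** inner a = inner (mulL m a).
Proof. by apply: multP => x /=; rewrite mulL_amul. Qed.

Lemma inner_mul (A : cstarAlgType R) (m : multiplier A) (a : A) :
  inner a ** m = inner (mulR m a).
Proof. by apply: multP => x /=; rewrite mulLR. Qed.

(* The image of a *-homomorphism, when it is a two-sided ideal. *)
Section RangeIdeal.
Context X Y (f : X -> Y) (f_hom : star_hom f).
Hypothesis f_ideal : forall y z, range f z -> range f (y ** z) /\ range f (z ** y).

Let rangeP k y z : range f y -> range f z -> range f (k *: y + z).
Proof.
by move=> [x _ <-] [x' _ <-]; exists (k *: x + x') => //; case: f_hom => ->.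
Qed.
Let range_star y : range f y -> range f (star y).
Proof. by move=> [x _ <-]; exists (star x) => //; case: f_hom. Qed.
Let range_act (g : G) y : range f y -> range f (act g y).
Proof. by move=> [x _ <-]; exists (act g x) => //; case: f_hom => _ _ _ ->. Qed.
Let range0 : range f 0.
Proof. by exists 0 => //; exact: star_hom0. Qed.

Definition range_ideal : gideal Y := @GIdeal R G Y (range f) rangeP
  (fun y z hz => (f_ideal y hz).1) (fun z y hz => (f_ideal y hz).2)
  range_star range_act range0.

End RangeIdeal.

(* The natural map X / J -> X / J'; used only for J contained in J'. *)
Definition quot_map X (J J' : gideal X) (c : quot J) : quot J' :=
  qpi J' (crepr c).

Lemma quot_mapE X (J J' : gideal X) x :
  (forall y, J y -> J' y) -> quot_map J' (qpi J x) = qpi J' x.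
Proof. by move=> JJ'; apply/qpiP; apply: JJ'; exact: qrepr. Qed.

Lemma quot_map_hom X (J J' : gideal X) :
  (forall y, J y -> J' y) -> star_hom (@quot_map X J J').
Proof.
move=> JJ'; split=> [k c d|c d|c|g c].
- have [x ->] := qpi_surj c; have [y ->] := qpi_surj d.
  by rewrite -qpiZ -qpiD !quot_mapE// qpiD qpiZ.
- have [x ->] := qpi_surj c; have [y ->] := qpi_surj d.
  by rewrite -qpiM !quot_mapE// qpiM.
- by have [x ->] := qpi_surj c; rewrite -qpi_star !quot_mapE// qpi_star.
- by have [x ->] := qpi_surj c; rewrite -qpi_act !quot_mapE// qpi_act.
Qed.

End Homomorphisms.

Record hilbertSpace (R : realType) := HilbertSpace {
  hspace :> completeNormedModType R[i] ;
  hinner : hspace -> hspace -> R[i] ;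
  hinner_linear : forall z, scalar (hinner^~ z) ;
  hinner_conj : forall x y, hinner y x = (hinner x y)^* ;
  hinner_norm : forall x, hinner x x = `|x| ^+ 2 }.

Section Stability.
Context (R : realType).

Definition separable_space (T : topologicalType) :=
  exists2 D : set T, countable D & dense D.

Definition lin_indep (V : lmodType R[i]) (n : nat) (v : 'I_n -> V) :=
  forall c : 'I_n -> R[i], \sum_(i < n) c i *: v i = 0 -> forall i, c i = 0.

Definition infinite_dimensional (V : lmodType R[i]) :=
  forall n, exists v : 'I_n -> V, lin_indep v.

Definition compact_operator (H : hilbertSpace R) (T : H -> H) :=
  linear T /\ precompact (T @` [set x | `|x| <= 1]).

(* rho identifies the C*-algebra K with the compact operators on H. *)
Definition is_compact_operators (H : hilbertSpace R) (K : cstarAlgType R)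
    (rho : K -> H -> H) :=
  [/\ (forall (c : R[i]) k l x, rho (c *: k + l) x = c *: rho k x + rho l x),
      (forall k l x, rho (k ** l) x = rho k (rho l x)),
      (forall k x y, hinner (rho k x) y = hinner x (rho (star k) y)),
      (forall k, nrm k = opnorm (rho k)) &
      range rho = [set T | @compact_operator H T]].

(* t : A x B -> T exhibits T as a C*-tensor product of A and B: it induces an
   injective *-homomorphism with dense range from the algebraic tensor product.
   It is used for B the compact operators, which are nuclear, so that the
   C*-norm on the algebraic tensor product is unique. *)
Definition is_cstar_tensor (A B T : cstarAlgType R) (t : A -> B -> T) :=
  [/\ (forall b, linear (t^~ b)) /\ (forall a, linear (t a)),
      (forall a a' b b', t a b ** t a' b' = t (a ** a') (b ** b')),
      (forall a b, star (t a b) = t (star a) (star b)),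
      (forall n (a : 'I_n -> A) (b : 'I_n -> B), lin_indep b ->
         \sum_(i < n) t (a i) (b i) = 0 -> forall i, a i = 0) &
      dense [set z | exists n (a : 'I_n -> A) (b : 'I_n -> B),
                      z = \sum_(i < n) t (a i) (b i)]].

Definition cstar_stable (G : topGroupType) (I : gcstarAlgType R G) :=
  exists (H : hilbertSpace R) (K : cstarAlgType R) (rho : K -> H -> H)
         (T : gcstarAlgType R G) (t : I -> K -> T) (f : T -> I),
    [/\ separable_space H /\ infinite_dimensional H,
        is_compact_operators rho,
        is_cstar_tensor t,
        (forall (g : G) a k, act g (t a k) = t (act g a) k) &
        cstar_iso f].

End Stability.

(* Objects of the category C*A_G: the inclusion of the dense *-subalgebra alg
   into amb is represented by the injection emb. *)
Record cobj (R : realType) (G : topGroupType) := CObj {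
  alg : gstarAlgType R G ;
  amb : gcstarAlgType R G ;
  emb : alg -> amb ;
  emb_hom : star_hom emb ;
  emb_inj : injective emb ;
  emb_dense : dense (range emb) ;
  amb_separable : separable_space amb }.

Section Morphisms.
Context (R : realType) (G : topGroupType).

Definition cmorphism (X Y : cobj R G) (f : alg X -> alg Y) :=
  star_hom f /\ exists c : R, forall x, nrm (emb (f x)) <= c * nrm (emb x).

(* F is the extension of f by continuity to the ambient C*-algebras. *)
Definition ambient_extension (X Y : cobj R G) (f : alg X -> alg Y)
    (F : amb X -> amb Y) :=
  continuous F /\ forall x, F (emb x) = emb (f x).

Definition short_exact (X Y Z : gstarAlgType R G) (i : X -> Y) (p : Y -> Z) :=
  [/\ injective i, range i = [set y | p y = 0] & range p = setT].

(* N is the norm of X. *)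
Definition bounded_linear (A : gcstarAlgType R G) (X : lmodType R[i])
    (N : X -> R) (h : A -> X) :=
  linear h /\ exists c : R, forall a, N (h a) <= c * nrm a.

Definition cstar_bounded (A : cobj R G) (X : lmodType R[i]) (N : X -> R)
    (f : alg A -> X) :=
  exists h : amb A -> X, bounded_linear N h /\ forall a, h (emb a) = f a.

End Morphisms.

(* C*-stable G-ideals: ideal_ideal says that alg, seen in the multiplier algebra
   of amb, is a two-sided ideal. *)
Record cstableIdeal (R : realType) (G : topGroupType) := CStableIdeal {
  ideal_obj :> cobj R G ;
  ideal_stable : cstar_stable (amb ideal_obj) ;
  ideal_ideal : forall (m : multiplier (amb ideal_obj)) z,
    range (fun x : alg ideal_obj => inner (emb x)) z ->
    range (fun x : alg ideal_obj => inner (emb x)) (m ** z) /\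
    range (fun x : alg ideal_obj => inner (emb x)) (z ** m) }.

Section Corona.
Context (R : realType) (G : topGroupType) (I : cstableIdeal R G).

Definition malg : gstarAlgType R G := multiplier (amb I).

Let inner_emb_hom : star_hom (fun x : alg I => inner (emb x) : malg).
Proof. exact: star_hom_comp (@inner_hom _ _ _) (@emb_hom _ _ _). Qed.

(* The algebra alg I, respectively amb I, as an ideal of M(amb I). *)
Definition sub_ideal : gideal malg :=
  range_ideal inner_emb_hom (@ideal_ideal _ _ I).

Let inner_ideal (m z : malg) : range (@inner R (amb I)) z ->
  range (@inner R (amb I)) (m ** z) /\ range (@inner R (amb I)) (z ** m).
Proof.
move=> [a _ <-]; split; first by exists (mulL m a); rewrite ?mul_inner.
by exists (mulR m a); rewrite ?inner_mul.
Qed.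

Definition full_ideal : gideal malg :=
  range_ideal (@inner_hom _ _ (amb I)) inner_ideal.

Lemma sub_full x : sub_ideal x -> full_ideal x.
Proof. by move=> [a _ <-]; exists (emb a). Qed.

Definition corona : gstarAlgType R G := quot sub_ideal.
Definition full_corona : gstarAlgType R G := quot full_ideal.
Definition qI : malg -> corona := qpi sub_ideal.
Definition corona_map : corona -> full_corona := quot_map full_ideal.

Definition unitary (u : malg) := star u ** u = mone /\ u ** star u = mone.

Definition almost_invariant_unitary (u : malg) :=
  unitary u /\ forall g : G, act g (qI u) = qI u.

End Corona.

Section Ext.
Context (R : realType) (G : topGroupType).
Context (A : cobj R G) (I : cstableIdeal R G).

Definition representation (p : alg A -> malg I) :=
  star_hom p /\ cstar_bounded (@mnorm R (amb I)) p.

Record busby := Busby {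
  busby_map :> alg A -> corona I ;
  busby_hom : star_hom busby_map ;
  busby_bounded : cstar_bounded (@qnorm R G (amb I) (full_ideal I))
    (fun a => corona_map (busby_map a)) }.

Definition trivial_busby (b : busby) :=
  exists2 p, representation p & forall a, b a = qI (p a).

Definition strong_equiv (b b' : busby) := exists2 u : malg I,
  almost_invariant_unitary u &
  forall a, b' a = qI u ** b a ** star (qI u).

Record isometry_pair := IsometryPair {
  iso1 : malg I ;
  iso2 : malg I ;
  iso1_isometry : star iso1 ** iso1 = mone ;
  iso2_isometry : star iso2 ** iso2 = mone ;
  iso_sum : iso1 ** star iso1 + iso2 ** star iso2 = mone ;
  iso1_act : forall g : G, act g iso1 = iso1 ;
  iso2_act : forall g : G, act g iso2 = iso2 }.

Lemma iso_orthogonal (V : isometry_pair) : star (iso1 V) ** iso2 V = 0.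
Proof.
have mulm1 (m : malg I) : m ** mone = m by exact: multP.
have mul1m (m : malg I) : mone ** m = m by exact: multP.
have := congr1 (fun m => star (iso1 V) ** m ** iso2 V) (iso_sum V).
rewrite mulm1 amulDr amulDl !amulA iso1_isometry mul1m.
rewrite -[X in _ + X]amulA iso2_isometry mulm1.
by move=> /(canRL (addrK _)); rewrite subrr.
Qed.

(* Conjugation by the row (iso1, iso2) maps diag(x, y) to
   iso1 x iso1^* + iso2 y iso2^*. *)
Definition busby_sum_map (V : isometry_pair) (b b' : busby) (a : alg A) :
    corona I :=
  qI (iso1 V) ** b a ** star (qI (iso1 V)) +
  qI (iso2 V) ** b' a ** star (qI (iso2 V)).

Lemma busby_sum_hom V b b' : star_hom (busby_sum_map V b b').
Proof.
have q_act (m : malg I) : (forall g : G, act g m = m) ->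
    forall g : G, act g (qI m) = qI m.
  by move=> h g; rewrite /qI -qpi_act h.
apply: (conj_sum_hom (busby_hom b) (busby_hom b') (e := qI mone)).
- move=> c; have [m ->] := qpi_surj c.
  by rewrite -qpiM; congr qpi; exact: multP.
- by rewrite -qpi_star -qpiM iso1_isometry.
- by rewrite -qpi_star -qpiM iso2_isometry.
- by rewrite -qpi_star -qpiM iso_orthogonal; exact: star_hom0 (qpi_hom _).
- exact/q_act/iso1_act.
- exact/q_act/iso2_act.
Qed.

Lemma busby_sum_bounded V b b' :
  cstar_bounded (@qnorm R G (amb I) (full_ideal I))
    (fun a => corona_map (busby_sum_map V b b' a)).
Proof.
have [h [[h1 [c hc]] hE]] := busby_bounded b.
have [k [[k1 [d hd]] kE]] := busby_bounded b'.
pose q := qpi (full_ideal I).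
pose cj (v : malg I) (x : full_corona I) := q v ** x ** q (star v).
exists (fun a => cj (iso1 V) (h a) + cj (iso2 V) (k a)); split; last first.
  move=> a; rewrite hE kE /cj /busby_sum_map.
  have [f1 f2 f3 _] := quot_map_hom (@sub_full R G I).
  rewrite /corona_map (star_homD _ _ (quot_map_hom (@sub_full R G I))).
  rewrite !f2 !f3 /qI !quot_mapE; try exact: sub_full.
  by rewrite /q !qpi_star.
split; first by apply: linear_add; exact: conj_linear.
have cjc v : exists2 e : R, 0 <= e & forall x, qnorm (cj v x) <= e * qnorm x.
  exists (mnorm v * mnorm (star v) + 1); last by move=> x; exact: qnorm_conj.
  by rewrite addr_ge0// mulr_ge0 ?mnorm_ge0.
have [e e0 he] := cjc (iso1 V); have [f f0 hf] := cjc (iso2 V).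
exists (e * c + f * d) => a; apply: le_trans (qnormD _ _) _.
rewrite mulrDl -!mulrA; apply: lerD.
  by apply: le_trans (he _) _; rewrite ler_wpM2l.
by apply: le_trans (hf _) _; rewrite ler_wpM2l.
Qed.

Definition busby_sum (V : isometry_pair) (b b' : busby) : busby :=
  Busby (busby_sum_hom V b b') (busby_sum_bounded V b b').

(* Stability of I guarantees that an isometry pair exists, so that the second
   branch is a junk value that never occurs. *)
Definition busby_add (b b' : busby) : busby :=
  if pselect (exists V : isometry_pair, True) is left ex
  then busby_sum (sval (cid ex)) b b' else b.

Lemma busby0_hom : star_hom (fun _ : alg A => 0 : corona I).
Proof.
split=> [k x y|x y|x|g x].
- by rewrite scaler0 addr0.
- by rewrite amul0l.
- by rewrite star0.
- by rewrite act0.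
Qed.

Lemma busby0_bounded : cstar_bounded (@qnorm R G (amb I) (full_ideal I))
  (fun _ : alg A => corona_map (0 : corona I)).
Proof.
have E : corona_map (0 : corona I) = 0.
  exact: star_hom0 (quot_map_hom (@sub_full R G I)).
exists (fun=> 0); split=> //; split=> [k x y|]; first by rewrite scaler0 addr0.
exists 0 => a; rewrite mul0r -[X in qnorm X](star_hom0 (qpi_hom (full_ideal I))).
apply: le_trans (qnorm_le _ _) _; apply: mnorm_le => // x.
by rewrite /= nrm0 mul0r.
Qed.

Definition busby0 : busby := Busby busby0_hom busby0_bounded.

Lemma trivial_busby0 : trivial_busby busby0.
Proof.
exists (fun=> 0) => //; split.
  split=> [k x y|x y|x|g x].
  - by rewrite scaler0 addr0.
  - by rewrite amul0l.
  - by rewrite star0.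
  - by rewrite act0.
exists (fun=> 0); split=> //; split=> [k x y|]; first by rewrite scaler0 addr0.
by exists 0 => a; rewrite mul0r; apply: mnorm_le => // x; rewrite /= nrm0 mul0r.
Qed.

(* E_G(A, I); trivial_class below is its subset D_G(A, I). *)
Definition strong_class := cquot strong_equiv.

Definition strong_add (e f : strong_class) : strong_class :=
  cpi _ (busby_add (crepr e) (crepr f)).

Definition trivial_class (e : strong_class) :=
  exists2 b : busby, trivial_busby b & e = cpi _ b.

Definition stable_equiv (e f : strong_class) :=
  exists d d' : strong_class, [/\ trivial_class d, trivial_class d' &
    strong_add e d = strong_add f d'].

Definition Ext := cquot stable_equiv.

Definition ext_class (b : busby) : Ext := cpi _ (cpi _ b).

Definition ext_add (x y : Ext) : Ext :=
  cpi _ (strong_add (crepr x) (crepr y)).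

Definition ext_zero : Ext := ext_class busby0.

Definition ext_invertible (x : Ext) := exists y, ext_add x y = ext_zero.

Record extension := Extension {
  ext_obj : cobj R G ;
  ext_inc : alg I -> alg ext_obj ;
  ext_proj : alg ext_obj -> alg A ;
  ext_inc_amb : amb I -> amb ext_obj ;
  ext_proj_amb : amb ext_obj -> amb A ;
  ext_inc_mor : cmorphism ext_inc ;
  ext_proj_mor : cmorphism ext_proj ;
  ext_inc_ext : ambient_extension ext_inc ext_inc_amb ;
  ext_proj_ext : ambient_extension ext_proj ext_proj_amb ;
  ext_exact : short_exact ext_inc ext_proj ;
  ext_exact_amb : short_exact ext_inc_amb ext_proj_amb }.

(* m is the multiplier of I given by multiplication by e on the ideal I. *)
Definition acts_as (X : extension) (e : alg (ext_obj X)) (m : malg I) :=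
  forall x : amb I,
    ext_inc_amb X (mulL m x) = emb e ** ext_inc_amb X x /\
    ext_inc_amb X (mulR m x) = ext_inc_amb X x ** emb e.

Definition linear_splitting (X : extension) (s : alg A -> alg (ext_obj X)) :=
  linear s /\ forall a, ext_proj (s a) = a.

Definition busby_of (X : extension) (b : busby) :=
  exists2 s : alg A -> alg (ext_obj X), linear_splitting s &
  forall a, exists2 m : malg I, acts_as (s a) m & b a = qI m.

(* x is the class [X] of the extension X. *)
Definition class_of (X : extension) (x : Ext) :=
  exists2 b : busby, busby_of X b & x = ext_class b.

Record kasparov_module := KasparovModule {
  kas_rep : alg A -> malg I ;
  kas_sym : malg I ;
  kas_repP : representation kas_rep ;
  kas_sa : star kas_sym = kas_sym ;
  kas_sq : kas_sym ** kas_sym = mone ;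
  kas_act : forall g : G, sub_ideal I (act g kas_sym - kas_sym) ;
  kas_comm : forall a : alg A,
    sub_ideal I (kas_sym ** kas_rep a - kas_rep a ** kas_sym) }.

Definition kas_proj (k : kasparov_module) : malg I :=
  (2^-1 : R[i]) *: (kas_sym k + mone).

Definition toeplitz (X : extension) :=
  exists (k : kasparov_module) (s : alg A -> alg (ext_obj X)),
    linear_splitting s /\
    forall a, acts_as (s a) (kas_proj k ** kas_rep k a ** kas_proj k).

End Ext.

(* Main.v *)
From HB Require Import structures.
Require Import Defs.
From mathcomp Require Import all_boot all_order all_algebra.
From mathcomp Require Import boolp classical_sets functions cardinality reals.
From mathcomp Require Import topology normedtype.
From mathcomp Require Import complex ring.

(** Both directions rest on one remark: if w is an isometry in M(I) whose class modulo
    the ideal is invariant, then a Busby map b and its conjugate w b w^* define the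
    same class, because after adding the zero map they are conjugate by the unitary
    dilation of w, the block matrix with rows [w, 1 - w w^*] and [0, w^*]
    (ext_class_isometry).

    Let b = q(P pi P) be the Busby map of a Toeplitz extension and Q = 1 - P. As q(P)
    is invariant and commutes with q(pi), the map b' = q(Q pi Q) is a Busby map too,
    and the isometry V1 P + V2 Q conjugates q(pi) to b + b'. Thus the classes of b and
    b' add up to that of the trivial map q(pi), which is zero (compression_split,
    toeplitz_invertible).

    Conversely, if b has an inverse, then b + c is conjugate, by a unitary u, to some
    q(pi) with pi a representation (invertible_dilation). The isometry w = u V1
    satisfies q(pi) q(w) = q(w) b, so that its range projection P = w w^* commutes with
    pi modulo the ideal, and q(P pi P) = w b w^* has the class of b. It remains to
    realize q(P pi P) by an extension. The pullback of this Busby map is one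
    (toeplitz_extension): as a vector space it is A x I, with (a, i) standing for the
    pair of a and P pi(a) P + i. Its norm is the maximum of the norms of the two
    components, in A and in M(I).

    The analytic point is that the group acts norm continuously on the pullback. The
    action on M(I) is only strictly continuous, but g P - P is a cocycle with values in
    the separable algebra I, strictly continuous, and so norm continuous by a Baire
    category argument on the locally compact group (cocycle_continuous,
    almost_invariant_continuous).

    Finally, the addition of extensions needs two invariant isometries V1, V2 with
    V1 V1^* + V2 V2^* = 1. They come from stability (isometry_pair_exists): an
    orthonormal basis of the Hilbert space gives isometries onto the spans of the even
    and of the odd basis vectors, which act on the second factor of I (x) K. Identities
    in the monoid of extensions are then computations with 2 x 2 block matrices over
    M(I). *)

Set Implicit Arguments.
Unset Strict Implicit.
Unset Printing Implicit Defensive.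

Import Order.TTheory GRing.Theory Num.Theory.
Import numFieldNormedType.Exports.

Local Open Scope classical_set_scope.
Local Open Scope complex_scope.
Local Open Scope ring_scope.

(** * Norms, density and completeness *)

Section NrmTopology.
Context (R : realType).
Implicit Types V W : normedModType R[i].

Lemma nrmB V (x y : V) : nrm (x - y) = nrm (y - x).
Proof. by rewrite -nrmN opprB. Qed.

Lemma nrm_tri V (x y z : V) : nrm (x - z) <= nrm (x - y) + nrm (y - z).
Proof. by rewrite -[x - z](subrKA y); exact: nrmD. Qed.

Lemma nrm_ltE V (x : V) (e : R) : (`|x| < e%:C) = (nrm x < e).
Proof. by rewrite nrmE ltcR. Qed.

Lemma gt0_complex (e : R[i]) : 0 < e -> e = (complex.Re e)%:C /\ 0 < complex.Re e.
Proof.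
move=> e0; have E : e = (complex.Re e)%:C by rewrite RRe_real// gtr0_real.
by split=> //; rewrite -ltcR -E.
Qed.

Lemma nbhs_nrmP V (x : V) (P : set V) :
  nbhs x P <-> exists2 e : R, 0 < e & forall y, nrm (y - x) < e -> P y.
Proof.
split=> [/nbhs_ballP[e /= /gt0_complex[-> e0] h]|[e e0 h]].
  exists (complex.Re e) => // y yx; apply: h.
  by rewrite -ball_normE /= nrm_ltE nrmB.
apply/nbhs_ballP; exists e%:C => /=; first by rewrite ltcR.
by move=> y; rewrite -ball_normE /= nrm_ltE nrmB; exact: h.
Qed.

Lemma continuous_nrmP (T : topologicalType) V (f : T -> V) :
  continuous f <->
  forall x (e : R), 0 < e -> nbhs x (fun y => nrm (f y - f x) < e).
Proof.
split=> [fc x e e0|h x P /nbhs_nrmP[e e0 eP]].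
  by apply: (fc x [set z | nrm (z - f x) < e]); apply/nbhs_nrmP; exists e.
by rewrite /nbhs /=; apply: filterS (h x e e0) => y /eP.
Qed.

Lemma lipschitz_continuous V W (f : V -> W) (c : R) :
  (forall x y, nrm (f x - f y) <= c * nrm (x - y)) -> continuous f.
Proof.
move=> h; apply/continuous_nrmP => x e e0; apply/nbhs_nrmP.
have c1 : 0 < `|c| + 1 by rewrite ltr_wpDl.
exists (e / (`|c| + 1)); first by rewrite divr_gt0.
move=> y; rewrite ltr_pdivlMr// mulrC; apply: le_lt_trans.
apply: le_trans (h _ _) _; rewrite ler_wpM2r ?nrm_ge0//.
by rewrite (le_trans (ler_norm _))// lerDl.
Qed.

Lemma nrm_continuous V : continuous (@nrm R V : V -> R).
Proof.
move=> x; apply/cvgrPdist_lt => e e0; apply/nbhs_nrmP; exists e => // y yx.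
apply: le_lt_trans yx; rewrite ler_norml; apply/andP; split.
  rewrite lerNl opprB lerBlDr; apply: le_trans (nrmD _ _); by rewrite subrK.
by rewrite lerBlDr nrmB; apply: le_trans (nrmD _ _); rewrite subrK.
Qed.

Lemma denseP V (D : set V) :
  dense D <-> forall x (e : R), 0 < e -> exists2 d, D d & nrm (d - x) < e.
Proof.
split=> [Dd x e e0|h O [x Ox] oO].
  have oO : open [set y : V | nrm (y - x) < e].
    rewrite openE => y /= yx; apply/nbhs_nrmP; exists (e - nrm (y - x)).
      by rewrite subr_gt0.
    by move=> z zy /=; apply: le_lt_trans (nrm_tri _ y _) _; rewrite -ltrBrDr.
  have [|d [/= dx Dd']] := Dd _ _ oO; last by exists d.
  by exists x; rewrite /= subrr nrm0.
have /nbhs_nrmP[e e0 he] : nbhs x O by exact: open_nbhs_nbhs.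
by have [d Dd dx] := h x e e0; exists d; split=> //; exact: he.
Qed.

Lemma nrm_small V (x : V) : (forall e : R, 0 < e -> nrm x <= e) -> x = 0.
Proof.
move=> h; apply: nrm_eq0; apply/eqP; rewrite eq_le nrm_ge0 andbT.
by apply/ler_addgt0Pl => e e0; rewrite addr0; exact: h.
Qed.

Lemma dense_eq (T U : topologicalType) (f h : T -> U) (D : set T) :
  hausdorff_space U -> dense D -> continuous f -> continuous h ->
  (forall d, D d -> f d = h d) -> forall x, f x = h x.
Proof.
move=> hU Dd fc hc E x; apply: hU => P Q Px Qx.
have [O [[oO Ox] OPQ]] : exists O, open_nbhs x O /\ O `<=` (f @^-1` P) `&` (h @^-1` Q).
  have : nbhs x ((f @^-1` P) `&` (h @^-1` Q)).
    by apply: filterI; [exact: fc | exact: hc].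
  by rewrite nbhsE => -[O hO sub]; exists O.
have [|d [Od /E fh]] := Dd O _ oO; first by exists x.
by have [Pd Qd] := OPQ _ Od; exists (f d); split=> //; rewrite fh.
Qed.

Lemma dense_nrm_eq V W (f h : V -> W) (D : set V) :
  dense D -> continuous f -> continuous h ->
  (forall d, D d -> f d = h d) -> forall x, f x = h x.
Proof. exact/dense_eq/norm_hausdorff. Qed.

End NrmTopology.

Section NrmComplete.
Context (R : realType).
Implicit Types V : completeNormedModType R[i].

Lemma harmonic_lt (e : R) : 0 < e -> exists n : nat, n.+1%:R^-1 < e.
Proof.
move=> e0; have [n hn] : exists n : nat, e^-1 < n.+1%:R.
  exists (Num.truncn e^-1); exact: truncnS_gt.
by exists n; rewrite -[e]invrK ltf_pV2 ?posrE ?invr_gt0.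
Qed.

Lemma harmonic_gt0 (n : nat) : 0 < n.+1%:R^-1 :> R.
Proof. by rewrite invr_gt0 ltr0n. Qed.

Lemma harmonic_le (n m : nat) : (n <= m)%N -> m.+1%:R^-1 <= n.+1%:R^-1 :> R.
Proof. by move=> nm; rewrite lef_pV2 ?posrE ?ltr0n// ler_nat ltnS. Qed.

Lemma cauchy_limit V (u : nat -> V) (c : R) :
  (forall n m, (n <= m)%N -> nrm (u n - u m) <= c / n.+1%:R) ->
  exists l, forall n, nrm (u n - l) <= c / n.+1%:R.
Proof.
move=> hu; have : cauchy (u @ \oo).
  apply/cauchy_exP => e /gt0_complex[-> e0].
  have c1 : 0 < `|c| + 1 by rewrite ltr_wpDl.
  have [n hn] : exists n : nat, n.+1%:R^-1 < complex.Re e / (`|c| + 1).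
    by apply: harmonic_lt; rewrite divr_gt0.
  exists (u n); exists n => // m /= nm.
  rewrite -ball_normE /= nrm_ltE; apply: le_lt_trans (hu _ _ nm) _.
  rewrite ltr_pdivlMr// in hn; apply: le_lt_trans hn.
  rewrite mulrC; apply: ler_wpM2l; first exact/ltW/harmonic_gt0.
  by apply: le_trans (ler_norm _) _; rewrite lerDl.
move=> /cauchy_cvg /cvg_ex[l ul]; exists l => n.
apply/ler_addgt0Pr => e e0.
have /ul[N _ hN] : nbhs l [set y | nrm (y - l) < e] by apply/nbhs_nrmP; exists e.
have /= hN' := hN (maxn n N) (leq_maxr _ _).
apply: le_trans (nrm_tri _ (u (maxn n N)) _) _.
by rewrite lerD ?hu ?leq_maxl// ltW.
Qed.

(** The points of D are only names, such as formal sums, for the points e d of a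
    dense set: that v is well defined on those points is part of the conclusion,
    and follows from the Lipschitz bound, as does the existence of the limits. *)
Lemma lipschitz_extension (D : Type) (V : normedModType R[i])
    (W : completeNormedModType R[i]) (e : D -> V) (v : D -> W) (c : R) :
  0 <= c -> (forall x (r : R), 0 < r -> exists d, nrm (e d - x) < r) ->
  (forall d d', nrm (v d - v d') <= c * nrm (e d - e d')) ->
  exists f : V -> W, (forall d, f (e d) = v d) /\
    forall x y, nrm (f x - f y) <= c * nrm (x - y).
Proof.
move=> c0 De hv.
have /choice[dd ddP] (x : V) :
    exists d : nat -> D, forall n, nrm (e (d n) - x) < n.+1%:R^-1.
  have /choice[d dP] (n : nat) : exists d, nrm (e d - x) < n.+1%:R^-1.
    exact: De (harmonic_gt0 n).
  by exists d.
have /choice[f fP] (x : V) :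
    exists l : W, forall n, nrm (v (dd x n) - l) <= c * 2 / n.+1%:R.
  apply: cauchy_limit => n m nm.
  apply: le_trans (hv _ _) _; rewrite -mulrA ler_wpM2l//.
  apply: le_trans (nrm_tri _ x _) _.
  rewrite mulrDl mul1r; apply: lerD; first exact/ltW/ddP.
  by rewrite nrmB; apply: le_trans (ltW (ddP _ _)) (harmonic_le _).
(* The limits f x and f y cost c * 2 / n.+1 each, the values e (dd x n) and
   e (dd y n) together another c * 2 / n.+1. *)
exists f; have key x y (n : nat) : nrm (f x - f y) <= c * nrm (x - y) + c * 6 / n.+1%:R.
  have -> : c * 6 = c * 2 + (c * 2 + c * 2) by rewrite -!mulrDr -!natrD.
  rewrite !mulrDl addrCA.
  apply: le_trans (nrm_tri _ (v (dd x n)) _) _; rewrite nrmB lerD ?fP//.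
  apply: le_trans (nrm_tri _ (v (dd y n)) _) _; rewrite addrA lerD ?fP//.
  apply: le_trans (hv _ _) _; rewrite -mulrA -mulrDr ler_wpM2l//.
  apply: le_trans (nrm_tri _ x _) _; rewrite mulrDl mul1r addrCA.
  rewrite lerD ?(ltW (ddP _ _))//; apply: le_trans (nrm_tri _ y _) _.
  by rewrite lerD2l nrmB; exact/ltW/ddP.
have lip x y : nrm (f x - f y) <= c * nrm (x - y).
  apply/ler_addgt0Pr => r r0.
  have c1 : 0 < c * 6 + 1 by rewrite ltr_wpDl// mulr_ge0.
  have [n hn] := harmonic_lt (divr_gt0 r0 c1).
  apply: le_trans (key x y n) _; rewrite lerD2l.
  rewrite ltr_pdivlMr// in hn; apply: le_trans (ltW hn).
  by rewrite mulrC ler_wpM2l ?lerDl// ltW// harmonic_gt0.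
split=> // d; apply/eqP; rewrite -subr_eq0; apply/eqP/nrm_small => r r0.
have c1 : 0 < c * 3 + 1 by rewrite ltr_wpDl// mulr_ge0.
have [n hn] := harmonic_lt (divr_gt0 r0 c1).
apply: le_trans (nrm_tri _ (v (dd (e d) n)) _) _.
rewrite ltr_pdivlMr// in hn; apply: le_trans (ltW hn).
rewrite nrmB; apply: le_trans (lerD (fP _ _) (hv _ _)) _.
apply: le_trans (lerD (lexx _) (ler_wpM2l c0 (ltW (ddP _ _)))) _.
rewrite -mulrDl -[X in _ + X]mulr1 -mulrDr natr1 mulrC.
by apply: ler_wpM2l; [exact/ltW/harmonic_gt0 | rewrite lerDl].
Qed.

End NrmComplete.

(** * Baire category and automatic continuity of cocycles *)

Section Baire.
Context (T : topologicalType).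
Hypotheses (T_hausdorff : hausdorff_space T) (T_lc : locally_compact [set: T]).

Lemma locally_compact_nbhs (x : T) : exists2 K, compact K & nbhs x K.
Proof.
have [U] := T_lc (x := x) I; rewrite withinET => Ux [cU _].
by exists U.
Qed.

Lemma locally_compact_shrink (x : T) (O : set T) : nbhs x O ->
  exists O', [/\ open O', O' x & closure O' `<=` O].
Proof.
have [K cK Kx] := locally_compact_nbhs x.
move=> /(compact_regular T_hausdorff cK Kx)[B Bx BO].
exists B°; split=> //; first exact: open_interior.
by apply: subset_trans BO; apply: closureS; exact: interior_subset.
Qed.

(** Baire's argument: if no F n had an inner point, there would be a decreasing
    sequence of open sets with closures in a compact set, the one after the n-th
    missing F n, and a cluster point of them would lie in no F n. *)
Lemma locally_compact_baire (F : nat -> set T) (x0 : T) :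
  (forall n, closed (F n)) -> (forall x, exists n, F n x) ->
  exists n (x : T), nbhs x (F n).
Proof.
move=> Fc Fcov; apply: contrapT => /forallNP noF.
have [K cK Kx0] := locally_compact_nbhs x0.
pose ok (O : set T) := open O /\ O !=set0.
have step (nO : nat * set T) : exists O', ok nO.2 ->
    ok O' /\ closure O' `<=` nO.2 `\` F nO.1.
  have [[oO [x Ox]]|] := pselect (ok nO.2); last by exists set0.
  have [y [Oy Fy]] : exists y, nO.2 y /\ ~ F nO.1 y.
    apply: contrapT => /forallNP h; apply: (noF nO.1); exists x.
    apply: filterS (open_nbhs_nbhs (conj oO Ox)) => z Oz.
    by apply: contrapT => Fz; apply: (h z).
  have : nbhs y (nO.2 `\` F nO.1).
    by apply: open_nbhs_nbhs; split=> //; apply: openI => //; exact/closed_openC/Fc.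
  move=> /locally_compact_shrink[O' [oO' O'y sub]].
  by exists O' => _; split=> //; split=> //; exists y.
have [nx nxP] := choice step.
pose O := fix O n := if n is n'.+1 then nx (n', O n') else K°.
have okO n : ok (O n).
  elim: n => [|n IH] /=; last by have [] := nxP (n, O n) IH.
  by split; [exact: open_interior | exists x0].
have sub n : closure (O n.+1) `<=` O n `\` F n by have [] := nxP (n, O n) (okO n).
have mono n m : (n <= m)%N -> O m `<=` O n.
  elim: m => [|m IH]; first by rewrite leqn0 => /eqP->.
  rewrite leq_eqVlt => /predU1P[-> //|/IH nm].
  by move=> y /subset_closure /sub[/nm].
have [u uO] := choice (fun n => (okO n).2).
have [p [_ pu]] : K `&` cluster (u @ \oo) !=set0.
  apply: cK; exists 0%N => // n _.
  by have := mono 0%N n (leq0n n) _ (uO n); exact: interior_subset.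
have [n Fnp] := Fcov p.
suff : closure (O n.+1) p by move=> /sub[].
move=> B Bp; have [|y [Oy By]] := pu (O n.+1) B _ Bp; last by exists y.
by exists n.+1 => // m /= nm; apply: (mono _ _ nm); exact: uO.
Qed.

End Baire.

Lemma countable_enum (T : Type) (D : set T) (x0 : T) : countable D ->
  exists u : nat -> T, forall d, D d -> exists n, u n = d.
Proof.
move=> /countable_injP[f finj].
have /choice[u uP] (n : nat) : exists x, forall d, D d -> f d = n -> x = d.
  have [[d [Dd fd]]|h] := pselect (exists d, D d /\ f d = n); last first.
    by exists x0 => d Dd fd; case: h; exists d.
  by exists d => d' Dd' fd'; apply: finj; rewrite ?inE// fd fd'.
by exists u => d Dd; exists (f d); exact: uP.
Qed.

Section TopGroup.
Context (G : topGroupType).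

Lemma mulgl_continuous (h : G) : continuous (fun k : G => (h * k)%g).
Proof.
move=> k; apply: (@continuous_comp _ _ _ (fun k : G => (h, k)) (fun p => (p.1 * p.2)%g)).
  by apply: cvg_pair; [exact: cvg_cst | exact: cvg_id].
exact: mulg_continuous.
Qed.

Lemma nbhs_mulgl (h k : G) (P : set G) :
  nbhs (h * k)%g P -> nbhs k (fun x => P (h * x)%g).
Proof. by move=> /(mulgl_continuous (h:=h)). Qed.

End TopGroup.

Section Cocycle.
Context (R : realType) (G : topGroupType) (I : gcstarAlgType R G).
Hypotheses (G_hausdorff : hausdorff_space G).
Hypotheses (G_lc : locally_compact [set: G]).
Hypothesis I_separable : separable_space I.

(** Pettis' argument: the sets where a cocycle is near a given point of a
    countable dense set are closed for the strict topology, so that one of them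
    has an inner point; the cocycle identity moves that point to 1. *)
Lemma cocycle_continuous (f : G -> I) :
  (forall g h, f (g * h)%g = act g (f h) + f g) ->
  (forall b, continuous (fun g => f g ** b)) -> continuous f.
Proof.
move=> fM fc.
have small1 (e : R) : 0 < e -> nbhs (1%g : G) [set k | nrm (f k) <= e].
  move=> e0; have [D Dc /denseP Dd] := I_separable.
  have [u uD] := countable_enum 0 Dc.
  pose F n := [set g : G | forall b, nrm ((f g - u n) ** b) <= e / 2 * nrm b].
  have F_near n g : F n g -> nrm (f g - u n) <= e / 2.
    move=> /(_ (star (f g - u n))).
    set y := f g - u n; rewrite nrm_star.
    have -> : nrm (y ** star y) = nrm y * nrm y.
      have := cstar_norm (star y); rewrite starK norm_star !nrmE -rmorphXn expr2.
      by case.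
    have [->|y0] := eqVneq (nrm y) 0; first by rewrite divr_ge0// ltW.
    by rewrite ler_pM2r// lt_def y0 nrm_ge0.
  have Fc n : closed (F n).
    rewrite (_ : F n = \bigcap_(b in [set: I])
      [set g | nrm ((f g - u n) ** b) <= e / 2 * nrm b]); last first.
      by apply/seteqP; split=> g /= h b; [move=> _; exact: h | exact: (h b)].
    apply: closed_bigI => b _.
    have cb : continuous (fun g => (f g - u n) ** b).
      have -> : (fun g => (f g - u n) ** b) = (fun g => f g ** b - u n ** b).
        by apply/funext => g; rewrite amulBl.
      by move=> g; apply: cvgB; [exact: fc | exact: cvg_cst].
    have cc : continuous (fun g => nrm ((f g - u n) ** b)).
      move=> g; apply: (@continuous_comp _ _ _ (fun g => (f g - u n) ** b)
        (@nrm R I) g (cb g)).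
      exact: nrm_continuous.
    exact: (closed_comp (fun g _ => cc g) (@closed_le R (e / 2 * nrm b))).
  have [n [h Fh]] : exists n (x : G), nbhs x (F n).
    apply: (locally_compact_baire G_hausdorff G_lc 1%g Fc) => g.
    have [d Dd' dg] := Dd (f g) _ (divr_gt0 e0 (ltr0Sn R 1)).
    have [n un] := uD d Dd'; exists n => b; rewrite un nrmB in dg *.
    apply: le_trans (nrm_amul _ _) _; apply: ler_wpM2r; first exact: nrm_ge0.
    by rewrite ltW// nrmB.
  have Fhh := nbhs_singleton Fh.
  rewrite -[h]mulg1 in Fh; apply: filterS (nbhs_mulgl Fh) => k /F_near Fk.
  have E : act h (f k) = f (h * k)%g - f h by rewrite fM addrK.
  rewrite /= -(nrm_act h) E [e]splitr; apply: le_trans (nrm_tri _ (u n) _) _.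
  by rewrite lerD// nrmB F_near.
apply/continuous_nrmP => g e e0.
have := small1 (e / 2) (divr_gt0 e0 (ltr0Sn R 1)); rewrite -[1%g](mulVg g) => /nbhs_mulgl.
apply: filterS => h /= hs.
have -> : f h - f g = act g (f (g^-1 * h)%g).
  by rewrite -{1}[h]mul1g -(mulgV g) -mulgA fM addrK.
by rewrite nrm_act; apply: le_lt_trans hs _; rewrite ltr_pdivrMr// ltr_pMr// ltr1n.
Qed.

End Cocycle.

(** * Orthonormal bases and Cuntz isometries of a Hilbert space *)

Section InnerProduct.
Context (R : realType) (H : hilbertSpace R).
Implicit Types (x y z : H) (k : R[i]).

Local Notation "<< x , y >>" := (hinner x y) (at level 0).

Lemma hinner_addl x y z : <<x + y, z>> = <<x, z>> + <<y, z>>.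
Proof. by have := hinner_linear z 1 x y; rewrite scale1r mul1r. Qed.

Lemma hinner0l z : <<0, z>> = 0.
Proof. by apply: (addrI <<0, z>>); rewrite -hinner_addl !addr0. Qed.

Lemma hinner_scalel k x z : <<k *: x, z>> = k * <<x, z>>.
Proof. by have := hinner_linear z k x 0; rewrite hinner0l !addr0. Qed.

Lemma hinner_addr x y z : <<z, x + y>> = <<z, x>> + <<z, y>>.
Proof. by rewrite hinner_conj hinner_addl rmorphD /= -!hinner_conj. Qed.

Lemma hinner_scaler k x z : <<z, k *: x>> = k^* * <<z, x>>.
Proof. by rewrite hinner_conj hinner_scalel rmorphM /= -hinner_conj. Qed.

Lemma hinner0r z : <<z, 0>> = 0.
Proof. by rewrite hinner_conj hinner0l rmorph0. Qed.

Lemma hinner_oppl x z : <<- x, z>> = - <<x, z>>.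
Proof. by rewrite -scaleN1r hinner_scalel mulN1r. Qed.

Lemma hinner_oppr x z : <<z, - x>> = - <<z, x>>.
Proof. by rewrite hinner_conj hinner_oppl rmorphN /= -hinner_conj. Qed.

Lemma hinner_suml (J : Type) (s : seq J) (P : pred J) (f : J -> H) z :
  <<\sum_(i <- s | P i) f i, z>> = \sum_(i <- s | P i) <<f i, z>>.
Proof.
by apply: (big_morph (fun x => <<x, z>>)) => [x y|]; rewrite ?hinner_addl ?hinner0l.
Qed.

Lemma hinner_sumr (J : Type) (s : seq J) (P : pred J) (f : J -> H) z :
  <<z, \sum_(i <- s | P i) f i>> = \sum_(i <- s | P i) <<z, f i>>.
Proof.
by apply: (big_morph (fun x => <<z, x>>)) => [x y|]; rewrite ?hinner_addr ?hinner0r.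
Qed.

Definition normalize x := ((nrm x)^-1)%:C *: x.

Lemma hinner_normalize x : <<x, normalize x>> = (nrm x)%:C.
Proof.
have cr : (((nrm x)^-1)%:C)^* = ((nrm x)^-1)%:C.
  by apply: conj_Creal; rewrite ger0_real// ler0c invr_ge0 nrm_ge0.
rewrite /normalize hinner_scaler hinner_norm nrmE cr -rmorphXn -rmorphM.
have [->|x0] := eqVneq (nrm x) 0; first by rewrite expr0n mulr0.
by rewrite expr2 mulKf.
Qed.

Lemma normalize_unit x : x != 0 -> <<normalize x, normalize x>> = 1.
Proof.
move=> x0; rewrite {1}/normalize hinner_scalel hinner_normalize -rmorphM mulVf//.
by apply: contra x0 => /eqP/nrm_eq0/eqP.
Qed.

Lemma nrm_normalize x : (nrm x)%:C *: normalize x = x.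
Proof.
have [/nrm_eq0 ->|x0] := eqVneq (nrm x) 0; first by rewrite /normalize !scaler0.
by rewrite /normalize scalerA -rmorphM mulfV// scale1r.
Qed.

Lemma hinner_eq0 x : <<x, x>> = 0 -> x = 0.
Proof. by rewrite hinner_norm => /eqP; rewrite expf_eq0 /= normr_eq0 => /eqP. Qed.

Lemma hinner_inj x y : (forall z, <<x, z>> = <<y, z>>) -> x = y.
Proof.
move=> h; apply/eqP; rewrite -subr_eq0; apply/eqP/hinner_eq0.
by rewrite hinner_addl hinner_oppl h subrr.
Qed.

(** The norm of <y, y> x - <x, y> y is nonnegative. *)
Lemma cauchy_schwarz x y : `|<<x, y>>| <= `|x| * `|y|.
Proof.
have [->|y0] := eqVneq y 0; first by rewrite hinner0r !normr0 mulr0.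
set a := <<x, y>>; set t := <<y, y>>.
have t0 : 0 < t by rewrite /t hinner_norm exprn_gt0// normr_gt0.
have tR : t^* = t by rewrite -hinner_conj.
have E : <<t *: x - a *: y, t *: x - a *: y>> = t * (t * <<x, x>> - a * a^*).
  rewrite !(hinner_addl, hinner_addr, hinner_oppl, hinner_oppr).
  rewrite !(hinner_scalel, hinner_scaler) tR -/a -/t (hinner_conj x y) -/a.
  ring.
have : 0 <= t * (t * <<x, x>> - a * a^*).
  by rewrite -E hinner_norm exprn_ge0.
rewrite pmulr_rge0// subr_ge0 -normCK /t !hinner_norm -exprMn mulrC.
by rewrite ler_pXn2r ?nnegrE ?mulr_ge0.
Qed.

Lemma cauchy_schwarz_nrm x y : nrm (<<x, y>> : R[i]^o) <= nrm x * nrm y.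
Proof. by have := cauchy_schwarz x y; rewrite !nrmE -rmorphM lecR. Qed.

Lemma hinnerl_continuous z : continuous (fun x => <<x, z>> : R[i]^o).
Proof.
apply: (@lipschitz_continuous _ _ _ _ (nrm z)) => x y.
by rewrite -hinner_oppl -hinner_addl mulrC cauchy_schwarz_nrm.
Qed.

Lemma hinnerr_continuous z : continuous (fun x => <<z, x>> : R[i]^o).
Proof.
apply: (@lipschitz_continuous _ _ _ _ (nrm z)) => x y.
by rewrite -hinner_oppr -hinner_addr cauchy_schwarz_nrm.
Qed.

Lemma adjoint_linear (S S' : H -> H) :
  (forall x y, <<S x, y>> = <<x, S' y>>) -> linear S.
Proof.
move=> h k x y; apply: hinner_inj => z.
by rewrite !(hinner_addl, hinner_scalel, h).
Qed.

Lemma adjoint_sym (S S' : H -> H) :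
  (forall x y, <<S x, y>> = <<x, S' y>>) -> forall x y, <<S' x, y>> = <<x, S y>>.
Proof. by move=> h x y; rewrite hinner_conj -h -hinner_conj. Qed.

End InnerProduct.

Section GramSchmidt.
Context (R : realType) (H : hilbertSpace R).
Hypotheses (H_separable : separable_space H) (H_infinite : infinite_dimensional H).
Local Notation "<< x , y >>" := (hinner x y) (at level 0).

Definition residual (s : seq H) (x : H) : H := x - \sum_(e <- s) <<x, e>> *: e.

Lemma residual_rcons s e x : residual (rcons s e) x = residual s x - <<x, e>> *: e.
Proof. by rewrite /residual -cats1 big_cat big_seq1 /= opprD addrA. Qed.

Lemma residual_continuous s : continuous (residual s).
Proof.
elim/last_ind: s => [|s e IH].
  have -> : residual [::] = id by apply/funext => x; rewrite /residual big_nil subr0.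
  by move=> ?; exact: cvg_id.
have -> : residual (rcons s e) = (fun x => residual s x - <<x, e>> *: e).
  by apply/funext => x; exact: residual_rcons.
move=> x; apply: cvgB; first exact: IH.
by apply: cvgZl; exact: hinnerl_continuous.
Qed.

(** If all residuals vanished, then by continuity s would span the whole space,
    and n + 1 independent vectors would have an (n + 1) x n matrix of coordinates,
    n = size s, which kills a nonzero row vector. *)
Lemma residual_neq0 (s : seq H) (d : nat -> H) : dense (range d) ->
  exists k, residual s (d k) != 0.
Proof.
move=> dd; apply: contrapT => /forallNP h.
have res0 x : residual s x = 0.
  apply: (dense_nrm_eq (f := residual s) (h := fun=> 0) dd).
  - exact: residual_continuous.
  - by move=> ?; exact: cvg_cst.
  - by move=> _ [k _ <-]; apply/eqP/negPn/negP; exact: h.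
set n := size s.
have spanE x : x = \sum_(j < n) <<x, s`_j>> *: s`_j.
  have /eqP := res0 x; rewrite subr_eq0 => /eqP {1}->.
  by rewrite (big_nth 0) big_mkord.
have [v vP] := H_infinite n.+1.
pose M := \matrix_(i < n.+1, j < n) <<v i, s`_j>>.
have /rowV0Pn[c cM c0] : kermx M != 0.
  rewrite -mxrank_eq0 mxrank_ker subn_eq0 -ltnNge ltnS; exact: rank_leq_col.
move: cM => /sub_kermxP cM.
case/negP: c0; apply/eqP/rowP => i; rewrite mxE.
apply: (vP (fun i => c 0 i)) => //.
under eq_bigr do rewrite [v _]spanE scaler_sumr.
rewrite exchange_big /= big1// => j _.
under eq_bigr do rewrite scalerA.
rewrite -scaler_suml.
have := congr1 (fun m : 'rV_n => m 0 j) cM; rewrite !mxE.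
by under eq_bigr do rewrite mxE; move=> ->; rewrite scale0r.
Qed.

(** Gram-Schmidt: e n is the normalized residual of the first vector of a dense
    sequence which is not in the span of e 0, ..., e (n - 1). *)
Lemma orthonormal_dense : exists e : nat -> H,
  (forall i j, <<e i, e j>> = (i == j)%:R) /\
  forall x (r : R), 0 < r -> exists (n : nat) (c : nat -> R[i]),
    nrm (\sum_(i < n) c i *: e i - x) < r.
Proof.
have [D Dc Dd] := H_separable.
have [d dD] := countable_enum 0 Dc.
have dd : dense (range d).
  move=> O O0 oO; have [x [Ox Dx]] := Dd O O0 oO.
  by have [n nx] := dD x Dx; exists x; split=> //; exists n.
have step (s : seq H) : exists e, exists k, [/\ residual s (d k) != 0,
    (forall j, (j < k)%N -> residual s (d j) = 0) &
    e = normalize (residual s (d k))].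
  have ex := residual_neq0 s dd.
  exists (normalize (residual s (d (ex_minn ex)))).
  exists (ex_minn ex); case: ex_minnP => k k0 kmin; split=> // j jk.
  by apply/eqP; apply: contraLR jk => j0; rewrite -leqNgt kmin.
have [nx nxP] := choice step.
pose es := fix es n := if n is n'.+1 then rcons (es n') (nx (es n')) else [::].
pose e n := nx (es n).
have resE n x : residual (es n) x = x - \sum_(i < n) <<x, e i>> *: e i.
  elim: n => [|n IH]; first by rewrite /residual /= big_nil big_ord0.
  by rewrite /= residual_rcons IH big_ord_recr /= opprD addrA.
have ortho n : forall i j, (i < n)%N -> (j < n)%N -> <<e i, e j>> = (i == j)%:R.
  elim: n => // n IH.
  have res_e x j : (j < n)%N -> <<residual (es n) x, e j>> = 0.
    move=> jn; rewrite resE hinner_addl hinner_oppl hinner_suml.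
    rewrite (bigD1 (Ordinal jn)) //= hinner_scalel IH// eqxx mulr1.
    rewrite big1 ?addr0 ?subrr// => i ij.
    by rewrite hinner_scalel IH// (_ : (i == j :> nat) = false) ?mulr0//; apply/negbTE.
  have en_e j : (j < n)%N -> <<e n, e j>> = 0.
    move=> jn; have [k [_ _ E]] := nxP (es n).
    by rewrite /e E /normalize hinner_scalel res_e// mulr0.
  move=> i j; rewrite ltnS leq_eqVlt => /predU1P[->|il];
    rewrite ltnS leq_eqVlt => /predU1P[->|jl].
  - rewrite eqxx; have [k [k0 _ E]] := nxP (es n).
    by rewrite /e E normalize_unit.
  - by rewrite en_e// gtn_eqF.
  - by rewrite hinner_conj en_e// ltn_eqF// rmorph0.
  - exact: IH.
have oe i j : <<e i, e j>> = (i == j)%:R.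
  by apply: (ortho (maxn i j).+1); rewrite ltnS ?leq_maxl ?leq_maxr.
have resn n x : residual (es n.+1) x =
    residual (es n) x - <<residual (es n) x, e n>> *: e n.
  rewrite [LHS]residual_rcons -/(e n); congr (_ - _ *: _).
  rewrite resE hinner_addl hinner_oppl hinner_suml big1 ?subr0// => i _.
  by rewrite hinner_scalel oe ltn_eqF// mulr0.
have res0 n k : (k < n)%N -> residual (es n) (d k) = 0.
  elim: n k => // n IH k; rewrite ltnS => kn.
  rewrite resn; have [->|rk] := eqVneq (residual (es n) (d k)) 0.
    by rewrite hinner0l scale0r subrr.
  have [l [l0 lmin E]] := nxP (es n).
  have nk : (n <= k)%N by rewrite leqNgt; apply/negP => /IH /eqP; rewrite (negbTE rk).
  have kl : k = l.
    have {}kn : k = n by apply/eqP; rewrite eqn_leq kn.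
    apply/eqP; rewrite eqn_leq; apply/andP; split.
      by rewrite kn leqNgt; apply/negP => /IH /eqP; rewrite (negbTE l0).
    by rewrite leqNgt; apply/negP => /lmin /eqP; rewrite (negbTE rk).
  by rewrite kl /e E hinner_normalize nrm_normalize subrr.
exists e; split=> // x r r0.
have /denseP/(_ x r r0)[_ [k _ <-] kx] := dd.
exists k.+1, (fun i => <<d k, e i>>).
have /eqP := res0 k.+1 k (ltnSn _); rewrite resE subr_eq0 => /eqP <-.
exact: kx.
Qed.

End GramSchmidt.

Section CuntzIsometries.
Context (R : realType) (H : hilbertSpace R).
Local Notation "<< x , y >>" := (hinner x y) (at level 0).
Context (e : nat -> H).
Hypothesis e_orth : forall i j, <<e i, e j>> = (i == j)%:R.
Hypothesis e_dense : forall x (r : R), 0 < r ->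
  exists (n : nat) (c : nat -> R[i]), nrm (\sum_(i < n) c i *: e i - x) < r.

Let lincomb (u : nat -> H) (p : nat * (nat -> R[i])) : H :=
  \sum_(i < p.1) p.2 i *: u i.

Let orthogonal (u : nat -> H) :=
  forall i j, i != j -> <<u i, u j>> = 0.

Let lincomb_norm (u : nat -> H) p : orthogonal u ->
  `|lincomb u p| ^+ 2 = \sum_(i < p.1) `|p.2 i| ^+ 2 * `|u i| ^+ 2.
Proof.
move=> uo; rewrite -hinner_norm hinner_suml; apply: eq_bigr => i _.
rewrite hinner_sumr (bigD1 i)//= big1 ?addr0 => [|j ji].
  by rewrite hinner_scalel hinner_scaler hinner_norm mulrA normCK.
by rewrite hinner_scalel hinner_scaler uo ?mulr0// eq_sym.
Qed.

Let e_ortho : orthogonal e.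
Proof. by move=> i j ij; rewrite e_orth (negbTE ij). Qed.

Let e_norm i : `|e i| ^+ 2 = 1.
Proof. by rewrite -hinner_norm e_orth eqxx. Qed.

Let lincomb_sub (p q : nat * (nat -> R[i])) : exists r, forall u,
  lincomb u r = lincomb u p - lincomb u q.
Proof.
pose trunc (p : nat * (nat -> R[i])) i := if (i < p.1)%N then p.2 i else 0.
have ext u (s : nat * (nat -> R[i])) m : (s.1 <= m)%N ->
    lincomb u s = \sum_(i < m) trunc s i *: u i.
  move=> sm; rewrite /lincomb (big_ord_widen _ (fun i => s.2 i *: u i) sm) big_mkcond /=.
  by apply: eq_bigr => i _; rewrite /trunc; case: ifP; rewrite ?scale0r.
exists (maxn p.1 q.1, fun i => trunc p i - trunc q i) => u.
rewrite (ext _ p (maxn p.1 q.1)) ?leq_maxl// (ext _ q (maxn p.1 q.1)) ?leq_maxr//.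
by rewrite -sumrB; apply: eq_bigr => i _; rewrite scalerBl.
Qed.

(* By Pythagoras a finite combination of the u i is not longer than the same
   combination of the e i. *)
Let contraction (u : nat -> H) : orthogonal u -> (forall i, `|u i| <= 1) ->
  exists2 f : H -> H, (forall p, f (lincomb e p) = lincomb u p) & continuous f.
Proof.
move=> uo u1.
have contr p : nrm (lincomb u p) <= nrm (lincomb e p).
  rewrite -lecR -!nrmE -(@ler_pXn2r _ 2) ?nnegrE// !lincomb_norm//.
  apply: ler_sum => i _; apply: ler_wpM2l; first exact: exprn_ge0.
  by rewrite e_norm exprn_ile1.
have [x r r0|p q|f [fE fl]] := @lipschitz_extension R (nat * (nat -> R[i])) H H
    (lincomb e) (lincomb u) 1 ler01.
- by have [n [c h]] := e_dense x r0; exists (n, c).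
- by have [r rE] := lincomb_sub p q; rewrite mul1r -!rE.
- by exists f => //; exact: lipschitz_continuous fl.
Qed.

Let dense_span : dense (range (lincomb e)).
Proof.
apply/denseP => x r r0; have [n [c h]] := e_dense x r0.
by exists (lincomb e (n, c)) => //; exists (n, c).
Qed.

Let e_eq (f h : H -> H) : linear f -> linear h -> continuous f -> continuous h ->
  (forall i, f (e i) = h (e i)) -> forall x, f x = h x.
Proof.
move=> fl hl fc hc E; apply: (dense_nrm_eq dense_span fc hc) => _ [p _ <-].
have lin k : linear k -> k (lincomb e p) = lincomb (k \o e) p.
  move=> kl; have k0 : k 0 = 0.
    by apply: (addrI (k 0)); have := kl 1 0 0; rewrite !scale1r !addr0 => <-.
  rewrite /lincomb; elim/big_rec2: _ => // i y z _ <-.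
  by rewrite kl.
by rewrite !lin//; apply: eq_bigr => i _ /=; rewrite E.
Qed.

(** S and its adjoint are prescribed on the basis and extended by continuity; their
    adjointness is an equality of matrix coefficients. *)
Lemma basis_isometry (s t : nat -> nat) (b : pred nat) :
  cancel s t -> (forall i, b (s i)) -> (forall i, b i -> s (t i) = i) ->
  exists S S' : H -> H, [/\ linear S /\ linear S', continuous S /\ continuous S',
    (forall x y, <<S x, y>> = <<x, S' y>>), (forall i, S (e i) = e (s i)) &
    (forall i, S' (e i) = if b i then e (t i) else 0)].
Proof.
move=> st bs ts.
pose u i := e (s i); pose v i := if b i then e (t i) else 0.
have ne i : `|e i| <= 1 by rewrite -(@ler_pXn2r _ 2) ?nnegrE// e_norm expr1n.
have [|i|S SE Sc] := @contraction u; first by move=> i j ij; rewrite /u e_ortho// (can_eq st).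
  exact: ne.
have [i j ij|i|S' SE' Sc'] := @contraction v.
- rewrite /v; case: ifP => bi; last by rewrite hinner0l.
  case: ifP => bj; last by rewrite hinner0r.
  by rewrite e_ortho//; apply: contra ij => /eqP/(congr1 s); rewrite !ts// => ->.
- by rewrite /v; case: ifP => // _; rewrite normr0.
have adj x y : <<S x, y>> = <<x, S' y>>.
  move: y; apply: (dense_nrm_eq (f := fun y => <<S x, y>> : R[i]^o)
    (h := fun y => <<x, S' y>> : R[i]^o) dense_span).
  - exact: hinnerr_continuous.
  - by move=> y; apply: (continuous_comp (Sc' y)); exact: hinnerr_continuous.
  move=> _ [q _ <-].
  move: x; apply: (dense_nrm_eq (f := fun x => <<S x, lincomb e q>> : R[i]^o)
    (h := fun x => <<x, S' (lincomb e q)>> : R[i]^o) dense_span).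
  - move=> x; apply: (@continuous_comp _ _ _ S
      (fun z => <<z, lincomb e q>> : R[i]^o) x (Sc x)).
    exact: hinnerl_continuous.
  - exact: hinnerl_continuous.
  move=> _ [p _ <-]; rewrite SE SE' !hinner_suml; apply: eq_bigr => i _.
  rewrite !hinner_sumr; apply: eq_bigr => j _.
  rewrite !hinner_scalel !hinner_scaler; congr (_ * (_ * _)).
  rewrite /u /v e_orth; case: ifP => bj.
    rewrite e_orth; congr (_ %:R); congr nat_of_bool.
    by apply/eqP/eqP => [<-|->]; rewrite ?st ?ts.
  by rewrite hinner0r; case: eqP => // E; rewrite -E bs in bj.
have one (w : nat -> H) i : lincomb w (i.+1, fun j => (j == i)%:R) = w i.
  rewrite /lincomb /= big_ord_recr /= eqxx scale1r big1 ?add0r// => j _.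
  by rewrite ltn_eqF// scale0r.
exists S, S'; split=> //.
- by split; [exact: adjoint_linear adj | exact: adjoint_linear (adjoint_sym adj)].
- by move=> i; rewrite -(one e i) SE one.
- by move=> i; rewrite -(one e i) SE' one.
Qed.

(** S1 maps e i to e (2 i), and S2 maps e i to e (2 i + 1). *)
Lemma hilbert_cuntz_basis : exists S1 S2 T1 T2 : H -> H,
  [/\ [/\ linear S1, linear S2, linear T1 & linear T2],
      [/\ continuous S1, continuous S2, continuous T1 & continuous T2],
      (forall x y, <<S1 x, y>> = <<x, T1 y>>) /\
      (forall x y, <<S2 x, y>> = <<x, T2 y>>),
      [/\ (forall x, T1 (S1 x) = x), (forall x, T2 (S2 x) = x) &
          forall x, T1 (S2 x) = 0] &
      forall x, S1 (T1 x) + S2 (T2 x) = x].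
Proof.
have half_even i : ~~ odd i -> i./2.*2 = i.
  by move=> oi; have := odd_double_half i; rewrite (negbTE oi).
have half_odd i : odd i -> i./2.*2.+1 = i.
  by move=> oi; have := odd_double_half i; rewrite oi.
have [S1 [T1 [[S1l T1l] [S1c T1c] adj1 S1e T1e]]] :=
  @basis_isometry double half (predC odd) doubleK
    (fun i => negbT (odd_double i)) half_even.
have uhK : cancel (fun i => i.*2.+1) half by move=> i; rewrite /= uphalf_double.
have [|S2 [T2 [[S2l T2l] [S2c T2c] adj2 S2e T2e]]] :=
  @basis_isometry (fun i => i.*2.+1) half odd uhK _ half_odd.
  by move=> i /=; rewrite odd_double.
have lc (f h : H -> H) : linear f -> linear h -> linear (f \o h).
  by move=> fl hl k x y; rewrite /= hl fl.
have cc (f h : H -> H) : continuous f -> continuous h -> continuous (f \o h).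
  by move=> fc hc x; apply: continuous_comp; [exact: hc | exact: fc].
have l0 (f : H -> H) : linear f -> f 0 = 0.
  by move=> fl; apply: (addrI (f 0)); have := fl 1 0 0; rewrite !scale1r !addr0 => <-.
exists S1, S2, T1, T2; split=> //.
  split.
  - apply: (e_eq (f := T1 \o S1) (h := id)) => //.
      exact: lc.
      exact: cc.
      by move=> ?; exact: cvg_id.
    by move=> i /=; rewrite S1e T1e /= odd_double /= doubleK.
  - apply: (e_eq (f := T2 \o S2) (h := id)) => //.
      exact: lc.
      exact: cc.
      by move=> ?; exact: cvg_id.
    by move=> i /=; rewrite S2e T2e /= odd_double /= uphalf_double.
  - apply: (e_eq (f := T1 \o S2) (h := fun=> 0)); [exact: lc | | exact: cc | |].
    + by move=> k x y; rewrite scaler0 addr0.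
    + by move=> x; exact: cvg_cst.
    + by move=> i /=; rewrite S2e T1e /= odd_double.
apply: (e_eq (f := fun x => S1 (T1 x) + S2 (T2 x)) (h := id)) => //.
- by apply: linear_add; exact: lc.
- by move=> x; apply: cvgD; [exact: cc | exact: cc].
- by move=> ?; exact: cvg_id.
move=> i; rewrite T1e T2e /=; case: ifP => oi.
  by rewrite S1e (negbTE oi) (l0 _ S2l) addr0 half_even.
by move/negbFE: oi => oi; rewrite oi S2e (l0 _ S1l) add0r half_odd.
Qed.

End CuntzIsometries.

(** * Invariant isometries in the multiplier algebra of a stable algebra *)

Lemma cont_comp (T U W : topologicalType) (f : T -> U) (h : U -> W) :
  continuous f -> continuous h -> continuous (h \o f).
Proof. by move=> fc hc x; apply: continuous_comp; [exact: fc | exact: hc]. Qed.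

Section MultiplierEvaluation.
Context (R : realType) (A : cstarAlgType R).
Implicit Types (m n : multiplier A) (x : A).

Lemma mulL_mmul m n x : mulL (m ** n) x = mulL m (mulL n x).
Proof. by []. Qed.

Lemma mulL_madd m n x : mulL (m + n) x = mulL m x + mulL n x.
Proof. by []. Qed.

Lemma mulL_mopp m x : mulL (- m) x = - mulL m x.
Proof. exact: scaleN1r. Qed.

Lemma innerB (a b : A) : inner (a - b) = inner a - inner b.
Proof. by apply: multP => x; rewrite mulL_madd mulL_mopp; exact: amulBl. Qed.

Lemma mulLB m x y : mulL m (x - y) = mulL m x - mulL m y.
Proof. by rewrite -scaleN1r mulLD mulLZ scaleN1r. Qed.

Lemma mulL_continuous m : continuous (mulL m).
Proof.
have [c hc] := mulL_bounded m; apply: (@lipschitz_continuous _ _ _ _ c) => x y.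
by rewrite -mulLB.
Qed.

End MultiplierEvaluation.

Section CStarContinuity.
Context (R : realType) (B : cstarAlgType R).

Lemma amull_continuous (a : B) : continuous (fun x => a ** x).
Proof.
apply: (@lipschitz_continuous _ _ _ _ (nrm a)) => x y.
by rewrite -amulBr nrm_amul.
Qed.

Lemma amulr_continuous (a : B) : continuous (fun x => x ** a).
Proof.
apply: (@lipschitz_continuous _ _ _ _ (nrm a)) => x y.
by rewrite -amulBl mulrC nrm_amul.
Qed.

Lemma star_continuous : continuous (@star R B).
Proof.
apply: (@lipschitz_continuous _ _ _ _ 1) => x y.
by rewrite -starB nrm_star mul1r.
Qed.

Lemma nrm_starM (x : B) : nrm (star x ** x) = nrm x ^+ 2.
Proof. by have := cstar_norm x; rewrite !nrmE -rmorphXn => -[]. Qed.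

Lemma nrm_eq_starM (x y : B) : star x ** x = star y ** y -> nrm x = nrm y.
Proof.
move=> E; have : nrm x ^+ 2 = nrm y ^+ 2 by rewrite -!nrm_starM E.
by move/eqP; rewrite eqrXn2 ?nrm_ge0// => /eqP.
Qed.

(** Pythagoras: p + q and p - q have the same norm, and p is their mean. *)
Lemma nrm_orthogonal (p q : B) : star p ** q = 0 -> nrm p <= nrm (p + q).
Proof.
move=> pq; have qp : star q ** p = 0 by rewrite -[LHS]starK starM starK pq star0.
have E : nrm (p - q) = nrm (p + q).
  apply: nrm_eq_starM; rewrite starB starD !amulBl !amulBr !amulDl !amulDr pq qp.
  by rewrite !(subr0, addr0, add0r, sub0r, opprK).
have D : p = (2^-1 : R[i]) *: ((p + q) + (p - q)).
  by rewrite addrACA subrr addr0 -mulr2n -(scaler_nat 2 p) scalerA mulVf ?scale1r ?pnatr_eq0.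
rewrite {1}D nrmZ; have -> : complex.Re `|2^-1 : R[i]| = 2^-1.
  by rewrite normfV normr_nat -[2]/(2%:R) -(rmorph_nat (@real_complex R)) -fmorphV.
by rewrite ler_pdivrMl// mulrDl !mul1r; apply: le_trans (nrmD _ _) _; rewrite E.
Qed.

End CStarContinuity.

Lemma act_cont (R : realType) (G : topGroupType) (A : gcstarAlgType R G) (g : G) :
  continuous (act g : A -> A).
Proof.
apply: (@lipschitz_continuous _ _ _ _ 1) => x y.
by rewrite -actB nrm_act mul1r.
Qed.

Section CompactOperators.
Context (R : realType) (H : hilbertSpace R) (K : cstarAlgType R) (rho : K -> H -> H).
Hypothesis rhoP : is_compact_operators rho.

Lemma rho_inj k l : (forall x, rho k x = rho l x) -> k = l.
Proof.
case: rhoP => rl _ _ rn _ E; apply/eqP; rewrite -subr_eq0; apply/eqP/nrm_eq0.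
have E0 x : rho (k - l) x = 0.
  by rewrite addrC -scaleN1r rl E scaleN1r addNr.
rewrite rn /opnorm (_ : [set _ | _ in _] = [set 0]) ?sup1//.
apply/seteqP; split=> [_ [x _ <-]|_ ->] /=; first by rewrite E0 nrm0.
by exists 0; rewrite ?E0 /= nrm0.
Qed.

Lemma compact_operator_comp (S : H -> H) k : linear S -> continuous S ->
  exists l, forall x, rho l x = S (rho k x).
Proof.
case: rhoP => _ _ _ _ rr Sl Sc.
have [kl kc] : [set T | @compact_operator R H T] (rho k) by rewrite -rr; exists k.
have : compact_operator (S \o rho k).
  split; first by move=> c x y; rewrite /= kl Sl.
  rewrite precompactE in kc.
  have cS : compact (S @` closure (rho k @` [set x | `|x| <= 1])).
    by apply: continuous_compact => //; exact: continuous_subspaceT.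
  exists (S @` closure (rho k @` [set x | `|x| <= 1])); last first.
    by split=> //; apply: compact_closed => //; exact: norm_hausdorff.
  move=> _ [x x1 <-]; exists (rho k x) => //.
  by apply: subset_closure; exists x.
rewrite -[compact_operator _]/([set T | compact_operator T] (S \o rho k)) -rr.
by move=> [l _ lE]; exists l => x; rewrite lE.
Qed.

(** Composition with a bounded operator preserves compactness, so that the Cuntz
    isometries of B(H) act on K by left multiplication; rho is faithful, which
    transports the relations between operators to K. *)
Lemma compact_cuntz : separable_space H -> infinite_dimensional H ->
  exists s1 s2 t1 t2 : K -> K,
  [/\ forall k l, star (s1 k) ** l = star k ** t1 l,
      forall k l, star (s2 k) ** l = star k ** t2 l,
      (forall k, t1 (s1 k) = k) /\ (forall k, t2 (s2 k) = k),
      forall k, t1 (s2 k) = 0 &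
      forall k, s1 (t1 k) + s2 (t2 k) = k].
Proof.
case: (rhoP) => rl rM ra rn rr Hs Hi.
have [e [eo ed]] := orthonormal_dense Hs Hi.
have [S1 [S2 [T1 [T2 [[l1 l2 m1 m2] [c1 c2 d1 d2] [a1 a2] [E1 E2 E0] E]]]]] :=
  hilbert_cuntz_basis eo ed.
have [s1 h1] := choice (fun k => compact_operator_comp k l1 c1).
have [s2 h2] := choice (fun k => compact_operator_comp k l2 c2).
have [t1 k1] := choice (fun k => compact_operator_comp k m1 d1).
have [t2 k2] := choice (fun k => compact_operator_comp k m2 d2).
have adj (S T : H -> H) (s t : K -> K) :
    (forall x y, hinner (S x) y = hinner x (T y)) ->
    (forall k x, rho (s k) x = S (rho k x)) ->
    (forall k x, rho (t k) x = T (rho k x)) ->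
    forall k l, star (s k) ** l = star k ** t l.
  move=> ST sS tT k l; apply: rho_inj => x; apply: hinner_inj => y.
  rewrite !rM [LHS]ra [RHS]ra !starK sS tT.
  by rewrite (adjoint_sym ST).
exists s1, s2, t1, t2; split.
- exact: adj a1 h1 k1.
- exact: adj a2 h2 k2.
- by split=> k; apply: rho_inj => x; rewrite ?k1 ?h1 ?E1// k2 h2 E2.
- move=> k; apply: rho_inj => x; rewrite k1 h2 E0.
  by have := rl (-1) 0 0 x; rewrite scaleN1r oppr0 addr0 scaleN1r addNr.
- move=> k; apply: rho_inj => x; have := rl 1 (s1 (t1 k)) (s2 (t2 k)) x.
  by rewrite !scale1r h1 h2 k1 k2 E.
Qed.

End CompactOperators.

(** The multipliers 1 (x) s1 and 1 (x) s2 of I = I (x) K. A map s of K with an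
    adjoint t acts on the finite sums of elementary tensors. By the C*-identity this
    action is isometric if t s = 1, hence well defined. The action of t1 and t2 is
    contractive, since a sum z is the orthogonal sum of s1 t1 z and s2 t2 z. *)
Section TensorMultipliers.
Context (R : realType) (G : topGroupType) (I : gcstarAlgType R G).
Context (K : cstarAlgType R) (tau : I -> K -> I).
Hypothesis tau_l : forall k, linear (tau^~ k).
Hypothesis tau_r : forall a, linear (tau a).
Hypothesis tauM : forall a b k l, tau a k ** tau b l = tau (a ** b) (k ** l).
Hypothesis tau_star : forall a k, star (tau a k) = tau (star a) (star k).
Hypothesis tau_act : forall (g : G) a k, act g (tau a k) = tau (act g a) k.
Hypothesis tau_dense : dense [set z | exists n (a : 'I_n -> I) (b : 'I_n -> K),
  z = \sum_(i < n) tau (a i) (b i)].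

Implicit Types p q : seq (I * K).

(* A formal sum of elementary tensors is the list of its terms. *)
Let ev p : I := \sum_(x <- p) tau x.1 x.2.
Let lmap (s : K -> K) p := [seq (x.1, s x.2) | x <- p].

Let ev_lmap s p : ev (lmap s p) = \sum_(x <- p) tau x.1 (s x.2).
Proof. by rewrite /ev /lmap big_map. Qed.

Let lmap_sub p q : exists r, forall s, ev (lmap s r) = ev (lmap s p) - ev (lmap s q).
Proof.
exists (p ++ [seq (- x.1, x.2) | x <- q]) => s.
rewrite !ev_lmap big_cat big_map /=; congr (_ + _).
rewrite (big_morph _ (@opprD I) (oppr0 I)); apply: eq_bigr => x _.
have tau0 : tau 0 (s x.2) = 0.
  by apply: (addrI (tau 0 (s x.2))); have := tau_l (s x.2) 1 0 0; rewrite !scale1r !addr0 => <-.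
by have := tau_l (s x.2) (-1) x.1 0; rewrite tau0 !addr0 !scaleN1r.
Qed.

Let lmap_id p : lmap id p = p.
Proof. by rewrite /lmap -[RHS]map_id; apply: eq_map; case. Qed.

Let ev_dense (x : I) (r : R) : 0 < r -> exists p, nrm (ev p - x) < r.
Proof.
move=> r0; have /denseP/(_ x r r0)[_ [n [a [b ->]]] h] := tau_dense.
exists [seq (a i, b i) | i <- enum 'I_n].
by rewrite /ev big_map big_enum.
Qed.

Let dense_ev : dense (range ev).
Proof. by apply/denseP => x r /(ev_dense x)[p h]; exists (ev p) => //; exists p. Qed.

Let amul_evl p b : ev p ** b = \sum_(x <- p) (tau x.1 x.2 ** b).
Proof. by apply: (big_morph (fun a => a ** b)) => [x y|]; rewrite ?amulDl ?amul0l. Qed.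

Let amul_evr p b : b ** ev p = \sum_(x <- p) (b ** tau x.1 x.2).
Proof. by apply: (big_morph (fun a => b ** a)) => [x y|]; rewrite ?amulDr ?amul0r. Qed.

Let star_ev p : star (ev p) = ev [seq (star x.1, star x.2) | x <- p].
Proof.
rewrite /ev big_map (big_morph _ (@starD R I) (star0 I)).
by apply: eq_bigr => x _; rewrite tau_star.
Qed.

Let ev_adjoint s t p q : (forall k l, star (s k) ** l = star k ** t l) ->
  star (ev (lmap s p)) ** ev q = star (ev p) ** ev (lmap t q).
Proof.
move=> adj; rewrite !star_ev !amul_evl /lmap !big_map; apply: eq_bigr => x _ /=.
rewrite !amul_evr big_map; apply: eq_bigr => y _ /=.
by rewrite !tauM adj.
Qed.

Let ev_comp s t p : ev (lmap s (lmap t p)) = ev (lmap (s \o t) p).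
Proof. by rewrite /lmap -map_comp. Qed.

Let ev_eq s t p : (forall k, s k = t k) -> ev (lmap s p) = ev (lmap t p).
Proof. by move=> E; rewrite !ev_lmap; apply: eq_bigr => x _; rewrite E. Qed.

Context (s1 s2 t1 t2 : K -> K).
Hypothesis adj1 : forall k l, star (s1 k) ** l = star k ** t1 l.
Hypothesis adj2 : forall k l, star (s2 k) ** l = star k ** t2 l.
Hypothesis iso1 : forall k, t1 (s1 k) = k.
Hypothesis iso2 : forall k, t2 (s2 k) = k.
Hypothesis orth : forall k, t1 (s2 k) = 0.
Hypothesis total : forall k, s1 (t1 k) + s2 (t2 k) = k.

Let ev_isometry s t p : (forall k l, star (s k) ** l = star k ** t l) ->
  (forall k, t (s k) = k) -> nrm (ev (lmap s p)) = nrm (ev p).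
Proof.
move=> adj ts; apply: nrm_eq_starM; rewrite (ev_adjoint _ _ adj) ev_comp.
by rewrite (ev_eq (t := id))// lmap_id.
Qed.

Let ev_total p : ev (lmap s1 (lmap t1 p)) + ev (lmap s2 (lmap t2 p)) = ev p.
Proof.
rewrite !ev_comp !ev_lmap -big_split /=; apply: eq_bigr => x _.
by rewrite -{3}[x.2]total; have := tau_r x.1 1 (s1 (t1 x.2)) (s2 (t2 x.2)); rewrite !scale1r.
Qed.

Let ev_orth p q : star (ev (lmap s1 p)) ** ev (lmap s2 q) = 0.
Proof.
rewrite (ev_adjoint _ _ adj1) ev_comp ev_lmap big1 ?amul0r// => x _ /=.
rewrite orth; apply: (addrI (tau x.1 0)).
by have := tau_r x.1 1 0 0; rewrite !scale1r !addr0 => <-.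
Qed.

Let ev_contr1 p : nrm (ev (lmap t1 p)) <= nrm (ev p).
Proof.
rewrite -(ev_isometry (lmap t1 p) adj1 iso1) -[in leRHS]ev_total.
exact/nrm_orthogonal/ev_orth.
Qed.

Let ev_contr2 p : nrm (ev (lmap t2 p)) <= nrm (ev p).
Proof.
rewrite -(ev_isometry (lmap t2 p) adj2 iso2) -[in leRHS]ev_total addrC.
apply/nrm_orthogonal; rewrite -[LHS]starK starM starK ev_orth; exact: star0.
Qed.

Let extend s : (forall p, nrm (ev (lmap s p)) <= nrm (ev p)) ->
  exists f : I -> I, (forall p, f (ev p) = ev (lmap s p)) /\
    forall x y, nrm (f x - f y) <= 1 * nrm (x - y).
Proof.
move=> contr; apply: (lipschitz_extension (e := ev) ler01 ev_dense) => p q.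
have [r rE] := lmap_sub p q; have := rE id; rewrite !lmap_id => rid.
by rewrite mul1r -rid -rE.
Qed.

Let mk_multiplier s t : (forall k l, star (s k) ** l = star k ** t l) ->
  (forall p, nrm (ev (lmap s p)) <= nrm (ev p)) ->
  (forall p, nrm (ev (lmap t p)) <= nrm (ev p)) ->
  exists m : multiplier I, [/\ forall p, mulL m (ev p) = ev (lmap s p),
    forall p, mulL (star m) (ev p) = ev (lmap t p) &
    forall g : G, act g m = m].
Proof.
move=> adj /extend[f [fE fl]] /extend[h [hE hl]].
have fc := lipschitz_continuous fl; have hc := lipschitz_continuous hl.
have fh x y : star (f x) ** y = star x ** h y.
  move: x; apply: (dense_nrm_eq dense_ev).
  - move=> x; apply: (@continuous_comp _ _ _ (fun x => star (f x)) (fun z => z ** y)).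
      by apply: continuous_comp; [exact: fc | exact: star_continuous].
    exact: amulr_continuous.
  - move=> x; apply: (@continuous_comp _ _ _ star (fun z => z ** h y)).
      exact: star_continuous.
    exact: amulr_continuous.
  move=> _ [p _ <-]; move: y; apply: (dense_nrm_eq dense_ev).
  - exact: amull_continuous.
  - move=> y; apply: (@continuous_comp _ _ _ h (fun z => star (ev p) ** z)) => //.
      exact: hc.
    exact: amull_continuous.
  by move=> _ [q _ <-]; rewrite fE hE (ev_adjoint _ _ adj).
have ev0 : ev [::] = 0 by rewrite /ev big_nil.
have bnd (k : I -> I) : k 0 = 0 ->
    (forall x y, nrm (k x - k y) <= 1 * nrm (x - y)) -> bounded_map k.
  by move=> k0 kl; exists 1 => x; have := kl x 0; rewrite k0 !subr0.
have fb : bounded_map f by apply: bnd => //; rewrite -{1}ev0 fE /lmap /= ev0.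
have hb : bounded_map h by apply: bnd => //; rewrite -{1}ev0 hE /lmap /= ev0.
have sb : bounded_map (@star R I) by exact: bounded_isom (@nrm_star R I).
have cmp a b : a ** f b = (star \o (h \o star)) a ** b.
  by rewrite -[LHS]starK starM fh starM !starK.
exists (Multiplier cmp fb (bounded_comp sb (bounded_comp hb sb))); split=> //.
  by move=> p /=; rewrite !starK hE.
move=> g; apply: multP; apply: (dense_nrm_eq dense_ev) => /=.
- exact: (cont_comp (cont_comp (act_cont (g:=g^-1%g)) fc) (act_cont (g:=g))).
- exact: fc.
move=> _ [p _ <-].
have act_ev g' q : act g' (ev q) = ev [seq (act g' x.1, x.2) | x <- q].
  rewrite /ev big_map (big_morph _ (@actD R G I g') (act0 I g')).
  by apply: eq_bigr => x _; rewrite tau_act.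
rewrite fE act_ev fE act_ev /lmap -!map_comp; congr ev; apply: eq_map => x /=.
by rewrite actKV.
Qed.

Lemma tensor_isometries : exists V1 V2 : multiplier I,
  [/\ star V1 ** V1 = mone, star V2 ** V2 = mone,
      V1 ** star V1 + V2 ** star V2 = mone &
      forall g : G, act g V1 = V1 /\ act g V2 = V2].
Proof.
have le p s t (adj : forall k l, star (s k) ** l = star k ** t l)
  (ts : forall k, t (s k) = k) : nrm (ev (lmap s p)) <= nrm (ev p).
  by rewrite (ev_isometry p adj ts).
have [V1 [E1 F1 A1]] := mk_multiplier adj1 (fun p => le p _ _ adj1 iso1) ev_contr1.
have [V2 [E2 F2 A2]] := mk_multiplier adj2 (fun p => le p _ _ adj2 iso2) ev_contr2.
have dense_mult (m n : multiplier I) : (forall p, mulL m (ev p) = mulL n (ev p)) -> m = n.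
  move=> E; apply: multP; apply: (dense_nrm_eq dense_ev).
  - exact: mulL_continuous.
  - exact: mulL_continuous.
  - by move=> _ [p _ <-]; exact: E.
exists V1, V2; split=> //; apply: dense_mult => p; rewrite ?mulL_madd !mulL_mmul.
- by rewrite E1 F1 ev_comp (ev_eq (t := id))// lmap_id.
- by rewrite E2 F2 ev_comp (ev_eq (t := id))// lmap_id.
- by rewrite F1 F2 E1 E2 ev_total.
Qed.

End TensorMultipliers.

(** These isometries are invariant because the group acts trivially on the second
    factor of I (x) K. *)
Lemma isometry_pair_exists (R : realType) (G : topGroupType) (I : cstableIdeal R G) :
  exists V : isometry_pair I, True.
Proof.
have [H [K [rho [T [t [f [[Hs Hi] rhoP tP ta fP]]]]]]] := ideal_stable I.
have [[tl tr] tM ts _ td] := tP; have [[fl fM fs fa] [finv fK fK'] fn] := fP.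
have [s1 [s2 [t1 [t2 [a1 a2 [i1 i2] o E]]]]] := compact_cuntz rhoP Hs Hi.
have [||||||V1 [V2 [h1 h2 h3 h4]]] := @tensor_isometries R G (amb I) K
   (fun a k => f (t a k)) _ _ _ _ _ _ s1 s2 t1 t2 a1 a2 i1 i2 o E.
- by move=> k c x y; rewrite tl fl.
- by move=> a c x y; rewrite tr fl.
- by move=> a b k l; rewrite -fM tM.
- by move=> a k; rewrite -fs ts.
- by move=> g a k; rewrite -fa ta.
- apply/denseP => x r r0; have /denseP/(_ (finv x) r r0)[_ [n [a [b ->]]] h] := td.
  exists (f (\sum_(i < n) t (a i) (b i))).
    exists n, a, b; apply: (big_morph f) => [y z|]; last exact: star_hom0 (And4 fl fM fs fa).
    by have := fl 1 y z; rewrite !scale1r.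
  have fB y z : f (y - z) = f y - f z.
    by rewrite addrC -scaleN1r fl scaleN1r addrC.
  by rewrite -fn fB fK' in h.
by exists (IsometryPair h1 h2 h3 (fun g => (h4 g).1) (fun g => (h4 g).2)).
Qed.

(** * Block matrices and the monoid of extensions *)

(** Block matrices over a star-algebra S with unit e which contains two
    isometries v, w with v v^* + w w^* = e: these identify M_2(S) with S. *)
Section BlockMatrices.
Context (R : realType) (S : starAlgType R).

Definition bmx (v w a b c d : S) : S :=
  v ** a ** star v + v ** b ** star w + (w ** c ** star v + w ** d ** star w).

Context (e v w : S).
Hypotheses (mule : forall x : S, x ** e = x) (emul : forall x : S, e ** x = x).
Hypotheses (vv : star v ** v = e) (ww : star w ** w = e).
Hypotheses (vw : star v ** w = 0) (sum_e : v ** star v + w ** star w = e).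

Let wv : star w ** v = 0.
Proof. by rewrite -[LHS]starK starM starK vw star0. Qed.

Let cvv x : x ** star v ** v = x. Proof. by rewrite -amulA vv mule. Qed.
Let cww x : x ** star w ** w = x. Proof. by rewrite -amulA ww mule. Qed.
Let cvw x : x ** star v ** w = 0. Proof. by rewrite -amulA vw amul0r. Qed.
Let cwv x : x ** star w ** v = 0. Proof. by rewrite -amulA wv amul0r. Qed.

Lemma bmxM a b c d a' b' c' d' :
  bmx v w a b c d ** bmx v w a' b' c' d' =
  bmx v w (a ** a' + b ** c') (a ** b' + b ** d')
          (c ** a' + d ** c') (c ** b' + d ** d').
Proof.
rewrite /bmx !(amulDl, amulDr) !amulA !(cvv, cww, cvw, cwv) !amul0l.
rewrite !(addr0, add0r) -!addrA; congr (_ + _).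
rewrite addrCA; congr (_ + (_ + (_ + (_ + _)))).
by rewrite addrCA.
Qed.

Lemma bmx_star a b c d :
  star (bmx v w a b c d) = bmx v w (star a) (star c) (star b) (star d).
Proof. by rewrite /bmx !starD !starM !starK !amulA addrACA. Qed.

Lemma bmx1 : bmx v w e 0 0 e = e.
Proof. by rewrite /bmx !amul0r !amul0l addr0 add0r !mule. Qed.

Lemma bmx_diag x y : v ** x ** star v + w ** y ** star w = bmx v w x 0 0 y.
Proof. by rewrite /bmx !amul0r !amul0l addr0 add0r. Qed.

Lemma bmx_conj_diag a b c d x y :
  bmx v w a b c d ** bmx v w x 0 0 y ** star (bmx v w a b c d) =
  bmx v w (a ** x ** star a + b ** y ** star b) (a ** x ** star c + b ** y ** star d)
          (c ** x ** star a + d ** y ** star b) (c ** x ** star c + d ** y ** star d).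
Proof. by rewrite bmx_star !bmxM !amul0r !addr0 !add0r. Qed.

(** Re-bracketing: this block matrix maps the orthogonal ranges of v v, v w and w
    onto those of v, w v and w w. *)
Lemma bmx_assoc x y z :
  bmx v w (star v) 0 (v ** star w) w ** bmx v w (bmx v w x 0 0 y) 0 0 z **
    star (bmx v w (star v) 0 (v ** star w) w) =
  bmx v w x 0 0 (bmx v w y 0 0 z).
Proof.
rewrite bmx_conj_diag !starM !starK; set m := bmx v w x 0 0 y.
have mE : m = v ** x ** star v + w ** y ** star w by rewrite bmx_diag.
have vm : star v ** m = x ** star v.
  by rewrite mE amulDr !amulA vv vw !amul0l addr0 emul.
have wm : star w ** m = y ** star w.
  by rewrite mE amulDr !amulA ww wv !amul0l add0r emul.
rewrite -[v ** star w ** m]amulA vm wm star0 !amul0l !amul0r !addr0.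
rewrite -[x ** star v ** v]amulA vv mule -[x ** star v ** _]amulA.
rewrite [star v ** (w ** _)]amulA vw amul0l amul0r.
rewrite -[v ** (y ** star w) ** v]amulA -[y ** star w ** v]amulA wv !amul0r.
rewrite -[v ** (y ** star w) ** _]amulA -[y ** star w ** _]amulA.
by rewrite [star w ** _]amulA ww emul amulA bmx_diag.
Qed.

End BlockMatrices.

Lemma conj_conj (R : realType) (S : starAlgType R) (u u' x : S) :
  u' ** (u ** x ** star u) ** star u' = u' ** u ** x ** star (u' ** u).
Proof. by rewrite starM !amulA. Qed.

(** The congruence of a commutative semigroup whose quotient kills the elements of a
    subsemigroup D. *)
Section StableEquivalence.
Context (T : Type) (op : T -> T -> T) (D : T -> Prop) (z : T).
Hypotheses (opA : associative op) (opC : commutative op).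
Hypotheses (Dop : forall x y, D x -> D y -> D (op x y)) (Dz : D z).

Definition stably x y := exists d d', [/\ D d, D d' & op x d = op y d'].

Lemma stably_refl x : stably x x.
Proof. by exists z, z. Qed.

Lemma stably_sym x y : stably x y -> stably y x.
Proof. by move=> [d [d' [dt dt' E]]]; exists d', d. Qed.

Lemma stably_trans x y t : stably x y -> stably y t -> stably x t.
Proof.
move=> [d [d' [dt dt' E]]] [c [c' [ct ct' E']]].
exists (op d c), (op c' d'); split; [exact: Dop.. |].
by rewrite !opA E -opA [op d' c]opC opA E'.
Qed.

Lemma stably_op x x' y y' : stably x x' -> stably y y' -> stably (op x y) (op x' y').
Proof.
move=> [d [d' [dt dt' E]]] [c [c' [ct ct' E']]].
exists (op d c), (op d' c'); split; [exact: Dop.. |].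
have swap a b a' b' : op (op a b) (op a' b') = op (op a a') (op b b').
  by rewrite -!opA [op b _]opA [op b a']opC !opA.
by rewrite swap E E' swap.
Qed.

End StableEquivalence.

Section BlockMatrixMorphism.
Context (R : realType) (G : topGroupType).

Lemma star_hom_bmx (S T : gstarAlgType R G) (f : S -> T) v w a b c d : star_hom f ->
  f (bmx v w a b c d) = bmx (f v) (f w) (f a) (f b) (f c) (f d).
Proof.
by move=> fh; have [_ fM fs _] := fh; rewrite /bmx !(star_homD _ _ fh) !fM !fs.
Qed.

Lemma act_bmx (S : gstarAlgType R G) (g : G) (v w a b c d : S) :
  act g (bmx v w a b c d) =
  bmx (act g v) (act g w) (act g a) (act g b) (act g c) (act g d).
Proof. by rewrite /bmx !actD !act_amul !act_star. Qed.

End BlockMatrixMorphism.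

Section MultiplierUnit.
Context (R : realType) (G : topGroupType) (I : cstableIdeal R G).
Implicit Types (u w m : malg I) (c : corona I).

Lemma amulm1 m : m ** mone = m. Proof. exact: multP. Qed.
Lemma amul1m m : mone ** m = m. Proof. exact: multP. Qed.

Lemma star_mone : star mone = mone :> malg I.
Proof. by apply: multP => x /=; rewrite starK. Qed.

Lemma act_mone (g : G) : act g mone = mone :> malg I.
Proof. by apply: multP => x /=; rewrite actKV. Qed.

Lemma qIM m n : qI (m ** n) = qI m ** qI n :> corona I. Proof. exact: qpiM. Qed.
Lemma qID m n : qI (m + n) = qI m + qI n :> corona I. Proof. exact: qpiD. Qed.
Lemma qI_star m : qI (star m) = star (qI m) :> corona I. Proof. exact: qpi_star. Qed.
Lemma qI_act (g : G) m : qI (act g m) = act g (qI m) :> corona I.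
Proof. exact: qpi_act. Qed.
Lemma qI0 : qI 0 = 0 :> corona I. Proof. exact: star_hom0 (qpi_hom _). Qed.
Lemma qIB m n : qI (m - n) = qI m - qI n :> corona I.
Proof. by rewrite -scaleN1r qID /qI qpiZ scaleN1r. Qed.

Lemma amulq1 c : c ** qI mone = c.
Proof. by have [m ->] := qpi_surj c; rewrite -[qpi _ m]/(qI m) -qIM amulm1. Qed.
Lemma amul1q c : qI mone ** c = c.
Proof. by have [m ->] := qpi_surj c; rewrite -[qpi _ m]/(qI m) -qIM amul1m. Qed.

Lemma star_qI1 : star (qI mone) = qI mone :> corona I.
Proof. by rewrite -qI_star star_mone. Qed.

Definition almost_invariant m := forall g : G, act g (qI m) = qI m.

Lemma invariant_almost m : (forall g : G, act g m = m) -> almost_invariant m.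
Proof. by move=> h g; rewrite -qI_act h. Qed.

Lemma almost_invariantM m n :
  almost_invariant m -> almost_invariant n -> almost_invariant (m ** n).
Proof. by move=> hm hn g; rewrite qIM act_amul hm hn. Qed.

Lemma almost_invariantD m n :
  almost_invariant m -> almost_invariant n -> almost_invariant (m + n).
Proof. by move=> hm hn g; rewrite qID actD hm hn. Qed.

Lemma almost_invariantB m n :
  almost_invariant m -> almost_invariant n -> almost_invariant (m - n).
Proof. by move=> hm hn g; rewrite qIB actB hm hn. Qed.

Lemma almost_invariant_star m : almost_invariant m -> almost_invariant (star m).
Proof. by move=> hm g; rewrite qI_star act_star hm. Qed.

Lemma almost_invariant1 : almost_invariant mone.
Proof. by move=> g; rewrite -qI_act act_mone. Qed.

Lemma almost_invariant0 : almost_invariant 0.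
Proof. by move=> g; rewrite -qI_act act0. Qed.

End MultiplierUnit.

Section Equivalence.
Context (T : Type) (r : T -> T -> Prop).
Hypotheses (r_refl : forall x, r x x) (r_sym : forall x y, r x y -> r y x).
Hypothesis r_trans : forall x y z, r x y -> r y z -> r x z.

Lemma cpiP x y : cpi r x = cpi r y <-> r x y.
Proof.
split=> [/(congr1 sval)/= E|xy].
  by apply: r_sym; rewrite -[r y x]/([set z | r y z] x) -E; exact: r_refl.
have E : [set z | r x z] = [set z | r y z].
  by apply/seteqP; split=> z /=; apply: r_trans => //; exact: r_sym.
rewrite /cpi; move: (ex_intro _ x _) (ex_intro _ y _); rewrite E => p q.
by congr exist; exact: Prop_irrelevance.
Qed.

Lemma cpi_ind (P : cquot r -> Prop) : (forall x, P (cpi r x)) -> forall c, P c.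
Proof. by move=> h c; rewrite -(creprK c). Qed.

Lemma creprP x : r (crepr (cpi r x)) x.
Proof. by apply/cpiP; exact: creprK. Qed.

End Equivalence.

Section ExtMonoid.
Context (R : realType) (G : topGroupType) (A : cobj R G) (I : cstableIdeal R G).
Implicit Types (b c d : busby A I) (u w m : malg I) (V : isometry_pair I).

Lemma busby_addE : exists V, forall b c, busby_add b c = busby_sum V b c.
Proof.
rewrite /busby_add; case: pselect => [ex|]; last by case; exact: isometry_pair_exists.
by exists (sval (cid ex)).
Qed.

Section IsometryPair.
Variable V : isometry_pair I.
Let v := iso1 V.
Let w := iso2 V.

Definition mbmx := bmx v w.
Definition qbmx := bmx (qI v) (qI w).

Lemma qI_bmx (a b c d : malg I) : qI (mbmx a b c d) = qbmx (qI a) (qI b) (qI c) (qI d).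
Proof. exact: (star_hom_bmx _ _ _ _ _ _ (qpi_hom _)). Qed.

Lemma mbmxM (a b c d a' b' c' d' : malg I) :
  mbmx a b c d ** mbmx a' b' c' d' =
  mbmx (a ** a' + b ** c') (a ** b' + b ** d') (c ** a' + d ** c') (c ** b' + d ** d').
Proof.
apply: (bmxM (e := mone)); [exact: amulm1 | exact: iso1_isometry |
  exact: iso2_isometry | exact: iso_orthogonal].
Qed.

Lemma mbmx_star (a b c d : malg I) :
  star (mbmx a b c d) = mbmx (star a) (star c) (star b) (star d).
Proof. exact: bmx_star. Qed.

Lemma mbmx1 : mbmx mone 0 0 mone = mone.
Proof. apply: bmx1; [exact: amulm1 | exact: iso_sum]. Qed.

Lemma qbmx_conj_diag (a b c d x y : corona I) :
  qbmx a b c d ** qbmx x 0 0 y ** star (qbmx a b c d) =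
  qbmx (a ** x ** star a + b ** y ** star b) (a ** x ** star c + b ** y ** star d)
       (c ** x ** star a + d ** y ** star b) (c ** x ** star c + d ** y ** star d).
Proof.
apply: (bmx_conj_diag (e := qI mone)); first exact: amulq1.
- by rewrite -qI_star -qIM iso1_isometry.
- by rewrite -qI_star -qIM iso2_isometry.
- by rewrite -qI_star -qIM iso_orthogonal qI0.
Qed.

Lemma busby_sum_bmx b c a : busby_sum V b c a = qbmx (b a) 0 0 (c a).
Proof. exact: bmx_diag. Qed.

Lemma mbmx_almost_invariant (a b c d : malg I) :
  almost_invariant a -> almost_invariant b -> almost_invariant c ->
  almost_invariant d -> almost_invariant (mbmx a b c d).
Proof.
move=> ha hb hc hd.
have hv : almost_invariant v by exact/invariant_almost/iso1_act.
have hw : almost_invariant w by exact/invariant_almost/iso2_act.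
by move=> g; rewrite qI_bmx /qbmx act_bmx (ha g) (hb g) (hc g) (hd g) (hv g) (hw g).
Qed.

End IsometryPair.

Lemma unitary_star u : unitary u -> unitary (star u).
Proof. by case=> h h'; split; rewrite starK. Qed.

Lemma strong_refl b : strong_equiv b b.
Proof.
exists mone => [|a]; last by rewrite star_qI1 amulq1 amul1q.
by split; [split; rewrite star_mone amulm1 | exact: almost_invariant1].
Qed.

Lemma strong_sym b c : strong_equiv b c -> strong_equiv c b.
Proof.
move=> [u [uu ui] E]; exists (star u).
  by split; [exact: unitary_star | exact: almost_invariant_star].
case: uu => uu _ a; rewrite E -!qI_star starK !amulA -qIM uu amul1q.
by rewrite -amulA -qIM uu amulq1.
Qed.

Lemma strong_trans b c d : strong_equiv b c -> strong_equiv c d -> strong_equiv b d.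
Proof.
move=> [u [[u1 u2] ui] E] [u' [[u1' u2'] ui'] E']; exists (u' ** u).
  split; last exact: almost_invariantM.
  split; rewrite starM; first by rewrite amulA -[star u ** _ ** _]amulA u1' amulm1.
  by rewrite amulA -[u' ** _ ** _]amulA u2 amulm1.
by move=> a; rewrite E' E qIM; exact: conj_conj.
Qed.

Lemma busby_sum_congr V b b' c c' : strong_equiv b b' -> strong_equiv c c' ->
  strong_equiv (busby_sum V b c) (busby_sum V b' c').
Proof.
move=> [u [[u1 u2] ui] E] [u' [[u1' u2'] ui'] E']; exists (mbmx V u 0 0 u').
  split; last by apply: mbmx_almost_invariant => //; exact: almost_invariant0.
  by split; rewrite mbmx_star mbmxM !star0 !(amul0l, amul0r) !(addr0, add0r);
    rewrite ?u1 ?u1' ?u2 ?u2' mbmx1.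
move=> a; rewrite !busby_sum_bmx qI_bmx qI0 qbmx_conj_diag E E' !star0.
by rewrite !(amul0l, amul0r) !(addr0, add0r).
Qed.

Lemma busby_sum_comm V b c : strong_equiv (busby_sum V b c) (busby_sum V c b).
Proof.
exists (mbmx V 0 mone mone 0).
  split; last by apply: mbmx_almost_invariant;
    (exact: almost_invariant0 || exact: almost_invariant1).
  by split; rewrite mbmx_star mbmxM !star0 star_mone !(amul0l, amul0r) !(addr0, add0r);
    rewrite amulm1 mbmx1.
move=> a; rewrite !busby_sum_bmx qI_bmx qI0 qbmx_conj_diag !star0 star_qI1.
by rewrite !(amul0l, amul0r) !(addr0, add0r) !amulq1 !amul1q.
Qed.

Lemma busby_sum_assoc V b c d :
  strong_equiv (busby_sum V (busby_sum V b c) d) (busby_sum V b (busby_sum V c d)).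
Proof.
set v := iso1 V; set w := iso2 V.
have vv : star v ** v = mone by exact: iso1_isometry.
have ww : star w ** w = mone by exact: iso2_isometry.
have vw : star v ** w = 0 by exact: iso_orthogonal.
have wv : star w ** v = 0 by rewrite -[LHS]starK starM starK vw star0.
have hv : almost_invariant v by exact/invariant_almost/iso1_act.
have hw : almost_invariant w by exact/invariant_almost/iso2_act.
exists (mbmx V (star v) 0 (v ** star w) w).
  split.
    split; rewrite mbmx_star mbmxM !starM !starK !star0 !(amul0l, amul0r) ?addr0 ?add0r.
      have -> : w ** star v ** (v ** star w) = w ** star w.
        by rewrite amulA -[w ** _ ** v]amulA vv amulm1.
      have -> : w ** star v ** w = 0 by rewrite -amulA vw amul0r.
      have -> : star w ** (v ** star w) = 0 by rewrite amulA wv amul0l.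
      by rewrite ww iso_sum mbmx1.
    have -> : v ** star w ** (w ** star v) = v ** star v.
      by rewrite amulA -[v ** _ ** w]amulA ww amulm1.
    have -> : v ** star w ** v = 0 by rewrite -amulA wv amul0r.
    have -> : star v ** (w ** star v) = 0 by rewrite amulA vw amul0l.
    by rewrite vv iso_sum mbmx1.
  exact: (mbmx_almost_invariant V (almost_invariant_star hv) (@almost_invariant0 _ _ I)
    (almost_invariantM hv (almost_invariant_star hw)) hw).
move=> a; rewrite !busby_sum_bmx qI_bmx qI0 qIM !qI_star.
apply/esym/(bmx_assoc (e := qI mone)); first exact: amulq1.
- exact: amul1q.
- by rewrite -qI_star -qIM iso1_isometry.
- by rewrite -qI_star -qIM iso2_isometry.
- by rewrite -qI_star -qIM iso_orthogonal qI0.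
Qed.

Lemma conj_bounded b w : cstar_bounded (@qnorm R G (amb I) (full_ideal I))
  (fun a => corona_map (qI w ** b a ** star (qI w))).
Proof.
have [h [[h1 [c hc]] hE]] := busby_bounded b.
exists (fun a => qpi (full_ideal I) w ** h a ** qpi (full_ideal I) (star w)); split; last first.
  move=> a; rewrite hE /corona_map.
  have [_ f2 f3 _] := quot_map_hom (@sub_full R G I).
  by rewrite !f2 !f3 /qI !quot_mapE ?qpi_star//; exact: sub_full.
split; first exact: conj_linear.
have e0 : 0 <= mnorm w * mnorm (star w) + 1 by rewrite addr_ge0// mulr_ge0 ?mnorm_ge0.
exists ((mnorm w * mnorm (star w) + 1) * c) => a.
by apply: le_trans (qnorm_conj _ _ _) _; rewrite -mulrA ler_wpM2l.
Qed.

(** A conjugate of a Busby map is always bounded, but it is multiplicative and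
    equivariant only for special w, whence the hypothesis. *)
Definition busby_conj b w
  (w_hom : star_hom (fun a : alg A => qI w ** b a ** star (qI w))) : busby A I :=
  Busby w_hom (conj_bounded b w).

Section Representations.
Context (p : alg A -> malg I) (pP : representation p).

Lemma rep_busby_hom : star_hom (fun a => qI (p a) : corona I).
Proof. exact: star_hom_comp (qpi_hom _) pP.1. Qed.

Lemma rep_busby_bounded : cstar_bounded (@qnorm R G (amb I) (full_ideal I))
  (fun a => corona_map (qI (p a))).
Proof.
have [_ [h [[h1 [c hc]] hE]]] := pP.
exists (fun a => qpi (full_ideal I) (h a)); split; last first.
  by move=> a; rewrite hE /corona_map /qI quot_mapE//; exact: sub_full.
split; first by move=> k x y; rewrite h1 qpiD qpiZ.
by exists c => a; apply: le_trans (qnorm_le _ _) (hc a).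
Qed.

Definition rep_busby : busby A I := Busby rep_busby_hom rep_busby_bounded.

Lemma rep_busby_trivial : trivial_busby rep_busby.
Proof. by exists p. Qed.

End Representations.

Lemma busby_sum_trivial V b c :
  trivial_busby b -> trivial_busby c -> trivial_busby (busby_sum V b c).
Proof.
move=> [p [ph [h [[h1 [r hr]] hE]]] pE] [p' [ph' [h' [[h1' [r' hr']] hE']]] pE'].
exists (fun a => iso1 V ** p a ** star (iso1 V) + iso2 V ** p' a ** star (iso2 V)).
  split.
    apply: (conj_sum_hom ph ph' (e := mone)).
    - exact: amulm1.
    - exact: iso1_isometry.
    - exact: iso2_isometry.
    - exact: iso_orthogonal.
    - exact: iso1_act.
    - exact: iso2_act.
  exists (fun a => iso1 V ** h a ** star (iso1 V) + iso2 V ** h' a ** star (iso2 V)).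
  split; last by move=> a; rewrite hE hE'.
  split; first by apply: linear_add; exact: conj_linear.
  have cj (v m : malg I) : mnorm (v ** m ** star v) <= mnorm v * mnorm (star v) * mnorm m.
    apply: le_trans (mnormM _ _) _; rewrite [leRHS]mulrAC ler_wpM2r ?mnorm_ge0//.
    exact: mnormM.
  have n0 (v : malg I) : 0 <= mnorm v * mnorm (star v) by rewrite mulr_ge0 ?mnorm_ge0.
  exists (mnorm (iso1 V) * mnorm (star (iso1 V)) * r +
          mnorm (iso2 V) * mnorm (star (iso2 V)) * r') => a.
  apply: le_trans (mnormD _ _) _; rewrite mulrDl -![_ * _ * nrm a]mulrA.
  by apply: lerD; apply: le_trans (cj _ _) _; rewrite ler_wpM2l.
move=> a; rewrite -[LHS]/(busby_sum_map V b c a) /busby_sum_map pE pE'.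
by rewrite -!qI_star -!qIM -qID.
Qed.

(** The block matrix with rows [w, 1 - w w^*] and [0, w^*] is a unitary, the dilation
    of the isometry w, and conjugates b + 0 to c + 0. *)
Lemma isometry_conj V b c w : star w ** w = mone -> almost_invariant w ->
  (forall a, c a = qI w ** b a ** star (qI w)) ->
  strong_equiv (busby_sum V b (busby0 A I)) (busby_sum V c (busby0 A I)).
Proof.
move=> ww wi E; exists (mbmx V w (mone - w ** star w) 0 (star w)).
  split.
    have k1 : star w ** (mone - w ** star w) = 0.
      by rewrite amulBr amulA ww amul1m amulm1 subrr.
    have k2 : (mone - w ** star w) ** w = 0.
      by rewrite amulBl -amulA ww amul1m amulm1 subrr.
    have ss : star (mone - w ** star w) = mone - w ** star w.
      by rewrite starB starM starK star_mone.
    have pp : (mone - w ** star w) ** (mone - w ** star w) = mone - w ** star w.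
      by rewrite amulBr amulm1 amulA k2 amul0l subr0.
    split; rewrite mbmx_star mbmxM !starK star0 ss ?ww ?k1 ?k2 ?pp ?(amul0l, amul0r).
      by rewrite !addr0 subrK mbmx1.
    by rewrite !add0r [w ** star w + _]addrC subrK mbmx1.
  apply: (mbmx_almost_invariant V wi _ (@almost_invariant0 _ _ I) (almost_invariant_star wi)).
  apply: (almost_invariantB (@almost_invariant1 _ _ I)).
  exact: almost_invariantM wi (almost_invariant_star wi).
move=> a; rewrite !busby_sum_bmx qI_bmx qI0 qbmx_conj_diag E !star0.
by rewrite !(amul0l, amul0r) !addr0.
Qed.

Local Notation cls := (cpi (@strong_equiv R G A I)).

Lemma strong_classP b c : (cls b) = (cls c) <-> strong_equiv b c.
Proof. exact: cpiP strong_refl strong_sym strong_trans _ _. Qed.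

Lemma strong_reprP b : strong_equiv (crepr (cls b)) b.
Proof. exact: creprP strong_refl strong_sym strong_trans _. Qed.

Lemma strong_addE b c : strong_add (cls b) (cls c) = (cls (busby_add b c)).
Proof.
have [V VE] := busby_addE; rewrite /strong_add !VE; apply/strong_classP.
by apply: busby_sum_congr; exact: strong_reprP.
Qed.

Implicit Types (e f h : strong_class A I).

Lemma strong_addC e f : strong_add e f = strong_add f e.
Proof.
move: e f; apply: cpi_ind => b; apply: cpi_ind => c; rewrite !strong_addE.
by have [V VE] := busby_addE; rewrite !VE; apply/strong_classP/busby_sum_comm.
Qed.

Lemma strong_addA e f h : strong_add e (strong_add f h) = strong_add (strong_add e f) h.
Proof.
move: e f h; apply: cpi_ind => b; apply: cpi_ind => c; apply: cpi_ind => d.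
have right := etrans (congr1 (strong_add (cls b)) (strong_addE c d))
  (strong_addE b (busby_add c d)).
have left := etrans (congr1 (fun x => strong_add x (cls d)) (strong_addE b c))
  (strong_addE (busby_add b c) d).
apply: etrans right (etrans _ (esym left)).
have [V VE] := busby_addE; rewrite !VE.
by apply/strong_classP/strong_sym/busby_sum_assoc.
Qed.

Lemma trivial_class_add e f :
  trivial_class e -> trivial_class f -> trivial_class (strong_add e f).
Proof.
move=> [b bt ->] [c ct ->]; rewrite strong_addE; have [V VE] := busby_addE.
by rewrite VE; exists (busby_sum V b c) => //; exact: busby_sum_trivial.
Qed.

Lemma trivial_class0 : trivial_class (cls (busby0 A I)).
Proof. by exists (busby0 A I) => //; exact: trivial_busby0. Qed.

Lemma stable_refl e : stable_equiv e e.
Proof. exact: stably_refl trivial_class0 e. Qed.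

Lemma stable_sym e f : stable_equiv e f -> stable_equiv f e.
Proof. exact: stably_sym. Qed.

Lemma stable_trans e f h : stable_equiv e f -> stable_equiv f h -> stable_equiv e h.
Proof. exact: (stably_trans strong_addA strong_addC trivial_class_add). Qed.

Lemma stable_add e e' f f' : stable_equiv e e' -> stable_equiv f f' ->
  stable_equiv (strong_add e f) (strong_add e' f').
Proof. exact: (stably_op strong_addA strong_addC trivial_class_add). Qed.

Lemma stable_classP e f :
  cpi (@stable_equiv R G A I) e = cpi _ f <-> stable_equiv e f.
Proof. exact: cpiP stable_refl stable_sym stable_trans _ _. Qed.

Lemma ext_class_surj (x : Ext A I) : exists b, x = ext_class b.
Proof.
by move: x; apply: cpi_ind; apply: cpi_ind => b; exists b.
Qed.

Lemma ext_classP b c : ext_class b = ext_class c <-> exists d d',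
  [/\ trivial_busby d, trivial_busby d' & strong_equiv (busby_add b d) (busby_add c d')].
Proof.
split=> [/stable_classP[_ [_ [[d dt ->] [d' dt' ->]]]]|[d [d' [dt dt' E]]]].
  by rewrite !strong_addE => /strong_classP E; exists d, d'.
apply/stable_classP; exists (cls d), (cls d'); split; [by exists d | by exists d' |].
by rewrite !strong_addE; exact/strong_classP.
Qed.

Lemma ext_addE b c : ext_add (ext_class b) (ext_class c) = ext_class (busby_add b c).
Proof.
rewrite /ext_add; apply/stable_classP; rewrite -strong_addE.
by apply: stable_add; exact: creprP stable_refl stable_sym stable_trans _.
Qed.

Lemma ext_class_trivial b : trivial_busby b -> ext_class b = ext_zero A I.
Proof.
move=> bt; apply/ext_classP; exists (busby0 A I), b; split=> //.
  exact: trivial_busby0.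
by have [V VE] := busby_addE; rewrite !VE; exact: busby_sum_comm.
Qed.

Lemma ext_class_isometry b c w : star w ** w = mone -> almost_invariant w ->
  (forall a, c a = qI w ** b a ** star (qI w)) -> ext_class b = ext_class c.
Proof.
move=> ww wi E; apply/ext_classP; exists (busby0 A I), (busby0 A I).
split; [exact: trivial_busby0.. |].
by have [V VE] := busby_addE; rewrite !VE; exact: isometry_conj E.
Qed.

End ExtMonoid.

(** * Toeplitz extensions are invertible *)

Section AmbientExtension.
Context (R : realType) (G : topGroupType) (X Y : cobj R G).
Context (f : alg X -> alg Y) (F : amb X -> amb Y).
Hypotheses (f_hom : star_hom f) (F_ext : ambient_extension f F).

Let add_continuous (V : normedModType R[i]) (y : V) : continuous (fun x => x + y).
Proof. by move=> x; apply: cvgD; [exact: cvg_id | exact: cvg_cst]. Qed.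

Lemma ambient_extensionD x y : F (x + y) = F x + F y.
Proof.
have [Fc Ff] := F_ext.
have e1 := @emb_hom _ _ X; have e2 := @emb_hom _ _ Y.
move: x; apply: (dense_nrm_eq (@emb_dense _ _ X)).
- exact: (cont_comp (@add_continuous _ y) Fc).
- exact: (cont_comp Fc (@add_continuous _ (F y))).
move=> _ [x _ <-]; move: y; apply: (dense_nrm_eq (@emb_dense _ _ X)).
- have addl_continuous : continuous (fun y => emb x + y).
    by move=> y; apply: cvgD; [exact: cvg_cst | exact: cvg_id].
  exact: (cont_comp addl_continuous Fc).
- by move=> y; apply: cvgD; [exact: cvg_cst | exact: Fc].
by move=> _ [y _ <-]; rewrite -(star_homD _ _ e1) !Ff (star_homD _ _ f_hom) (star_homD _ _ e2).
Qed.

Lemma ambient_extensionM x y : F (x ** y) = F x ** F y.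
Proof.
have [Fc Ff] := F_ext; have [_ fM _ _] := f_hom.
have [_ e1 _ _] := @emb_hom _ _ X; have [_ e2 _ _] := @emb_hom _ _ Y.
move: x; apply: (dense_nrm_eq (@emb_dense _ _ X)).
- exact: (cont_comp (@amulr_continuous _ _ y) Fc).
- exact: (cont_comp Fc (@amulr_continuous _ _ (F y))).
move=> _ [x _ <-]; move: y; apply: (dense_nrm_eq (@emb_dense _ _ X)).
- exact: (cont_comp (@amull_continuous _ _ (emb x)) Fc).
- exact: (cont_comp Fc (@amull_continuous _ _ (F (emb x)))).
by move=> _ [y _ <-]; rewrite -e1 !Ff fM e2.
Qed.

End AmbientExtension.

Section BusbyUniqueness.
Context (R : realType) (G : topGroupType) (A : cobj R G) (I : cstableIdeal R G).
Context (X : extension A I).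

(** Two lifts of an element of A differ by an element of the ideal, so that the
    multipliers by which they act have the same class. *)
Lemma acts_as_class (e e' : alg (ext_obj X)) (m m' : malg I) :
  ext_proj e = ext_proj e' -> acts_as e m -> acts_as e' m' -> qI m = qI m'.
Proof.
move=> pe em em'.
have [inj exact _] := ext_exact X.
have [injF _ _] := ext_exact_amb X.
have [inc_hom _] := ext_inc_mor X; have [proj_hom _] := ext_proj_mor X.
have Fext := ext_inc_ext X.
have [j jE] : exists j, ext_inc X j = e - e'.
  have : [set y | ext_proj y = 0] (e - e').
    rewrite /= addrC -scaleN1r; have [pl _ _ _] := proj_hom.
    by rewrite pl pe scaleN1r addNr.
  by rewrite -exact => -[j _ jE]; exists j.
apply/qpiP; exists j => //; apply: multP => x.
apply: injF; have [_ FE] := Fext.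
rewrite -[mulL (m - m') x]/(mulL m x + (-1) *: mulL m' x) scaleN1r.
rewrite (ambient_extensionM inc_hom Fext) FE jE.
have eh := @emb_hom _ _ (ext_obj X); have [el _ _ _] := eh.
have FN y : ext_inc_amb X (- y) = - ext_inc_amb X y.
  have F0 : ext_inc_amb X 0 = 0.
    apply: (addrI (ext_inc_amb X 0)).
    by rewrite -(ambient_extensionD inc_hom Fext) !addr0.
  by apply/eqP; rewrite -addr_eq0 -(ambient_extensionD inc_hom Fext) addNr F0.
rewrite (ambient_extensionD inc_hom Fext) FN (em x).1 (em' x).1.
by rewrite addrC -scaleN1r el scaleN1r amulDl amulNl addrC.
Qed.

End BusbyUniqueness.

Lemma compress_hom (R : realType) (G : topGroupType) (X S : gstarAlgType R G)
    (f : X -> S) (p : S) : star_hom f -> star p = p -> p ** p = p ->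
  (forall g : G, act g p = p) -> (forall x, p ** f x = f x ** p) ->
  star_hom (fun x => p ** f x ** star p).
Proof.
move=> [f1 f2 f3 f4] sp pp ip cp.
have E x : p ** f x ** star p = p ** f x by rewrite sp -amulA -cp amulA pp.
split=> [||x|g x].
- exact: conj_linear.
- move=> x y; rewrite !E f2 -[RHS]amulA [f x ** (_ ** _)]amulA -cp -!amulA.
  by rewrite [RHS]amulA pp.
- by rewrite f3 !starM !sp amulA.
- by rewrite f4 !act_amul act_star ip.
Qed.

(** The cross terms vanish since p and q commute with x and are orthogonal. *)
Lemma conj_split (R : realType) (S : starAlgType R) (v w p q x : S) :
  star p = p -> star q = q -> p ** q = 0 -> q ** p = 0 ->
  p ** x = x ** p -> q ** x = x ** q ->
  (v ** p + w ** q) ** x ** star (v ** p + w ** q) =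
  v ** (p ** x ** star p) ** star v + w ** (q ** x ** star q) ** star w.
Proof.
move=> sp sq pq qp px qx.
have zero a b y z : y ** b = 0 -> y ** x = x ** y -> a ** y ** x ** (b ** z) = 0.
  move=> yb yx; rewrite -[a ** y ** x]amulA yx -!amulA [y ** (b ** z)]amulA yb.
  by rewrite !(amul0l, amul0r).
rewrite starD !starM sp sq [LHS]amulDr ![(_ + _) ** _ in LHS]amulDl.
by rewrite (zero _ _ _ _ qp qx) (zero _ _ _ _ pq px) addr0 add0r !amulA.
Qed.

Section Compression.
Context (R : realType) (G : topGroupType) (A : cobj R G) (I : cstableIdeal R G).
Implicit Types (b c : busby A I) (P : malg I).

Definition almost_commutes b P := forall a, qI P ** b a = b a ** qI P.

Lemma compression_hom b P : star P = P -> P ** P = P -> almost_invariant P ->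
  almost_commutes b P -> star_hom (fun a : alg A => qI P ** b a ** star (qI P)).
Proof.
move=> sP PP iP cP; apply: compress_hom => //; first exact: busby_hom.
- by rewrite -qI_star sP.
- by rewrite -qIM PP.
Qed.

Definition compression b P (sP : star P = P) (PP : P ** P = P)
    (iP : almost_invariant P) (cP : almost_commutes b P) : busby A I :=
  busby_conj (compression_hom sP PP iP cP).

(** A Busby map compressed by an almost commuting projection and by the
    complementary one is, as a sum of classes, the Busby map itself: they are
    joined by the isometry v P + w (1 - P). *)
Lemma compression_split b P c c' : star P = P -> P ** P = P ->
  almost_invariant P -> almost_commutes b P ->
  (forall a, c a = qI P ** b a ** star (qI P)) ->
  (forall a, c' a = qI (mone - P) ** b a ** star (qI (mone - P))) ->
  ext_add (ext_class c) (ext_class c') = ext_class b.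
Proof.
move=> sP PP iP cP cE cE'; rewrite ext_addE.
have [V VE] := busby_addE A I; rewrite VE.
set v := iso1 V; set w := iso2 V; set Q := mone - P.
have vv : star v ** v = mone by exact: iso1_isometry.
have ww : star w ** w = mone by exact: iso2_isometry.
have vw : star v ** w = 0 by exact: iso_orthogonal.
have wv : star w ** v = 0 by rewrite -[LHS]starK starM starK vw star0.
have sQ : star Q = Q by rewrite starB star_mone sP.
have QQ : Q ** Q = Q.
  by rewrite amulBl !amulBr !amulm1 amul1m PP subrr subr0.
have PQ : P ** Q = 0 by rewrite amulBr amulm1 PP subrr.
have QP : Q ** P = 0 by rewrite amulBl amul1m PP subrr.
have iQ : almost_invariant Q := almost_invariantB (@almost_invariant1 _ _ I) iP.
have cQa a : qI Q ** b a = b a ** qI Q.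
  by rewrite qIB amulBl amulBr cP amulq1 amul1q.
have PQ1 : P + Q = mone by rewrite addrC subrK.
have {}cE' a : c' a = qI Q ** b a ** star (qI Q) := cE' a.
clearbody Q.
apply/esym; apply: (ext_class_isometry (w := v ** P + w ** Q)).
- rewrite starD !starM sP sQ amulDl !amulDr.
  have k (x y z t : malg I) : x ** star y ** (z ** t) = x ** (star y ** z) ** t.
    by rewrite !amulA.
  rewrite !k vv ww vw wv !amulm1 !amul0r !amul0l addr0 add0r PP QQ.
  exact: PQ1.
- apply: almost_invariantD; apply: almost_invariantM; [| exact: iP | | exact: iQ].
  + exact/invariant_almost/iso1_act.
  + exact/invariant_almost/iso2_act.
move=> a; rewrite -[LHS]/(busby_sum_map V c c' a) /busby_sum_map -/v -/w cE cE'.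
have z1 : qI P ** qI Q = 0 by rewrite -qIM PQ qI0.
have z2 : qI Q ** qI P = 0 by rewrite -qIM QP qI0.
have sqP : star (qI P) = qI P by rewrite -qI_star sP.
have sqQ : star (qI Q) = qI Q by rewrite -qI_star sQ.
rewrite qID [qI (v ** P)]qIM [qI (w ** Q)]qIM.
exact/esym/(conj_split _ _ sqP sqQ z1 z2 (cP a) (cQa a)).
Qed.

End Compression.

Section KasparovModule.
Context (R : realType) (G : topGroupType) (A : cobj R G) (I : cstableIdeal R G).
Context (k : kasparov_module A I).
Local Notation P := (kas_proj k).

Let half_add (x : malg I) : (2^-1 : R[i]) *: (x + x) = x.
Proof. by rewrite -mulr2n -(scaler_nat 2 x) scalerA mulVf ?scale1r ?pnatr_eq0. Qed.

Lemma kas_proj_sa : star P = P.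
Proof.
have half_real : (2^-1 : R[i])^* = 2^-1.
  by apply: conj_Creal; rewrite ger0_real// invr_ge0.
by rewrite /kas_proj starZ starD kas_sa star_mone half_real.
Qed.

Lemma kas_proj_idem : P ** P = P.
Proof.
rewrite /kas_proj amulZl amulZr; congr (_ *: _).
rewrite amulDl !amulDr kas_sq !amulm1 amul1m [mone + _]addrC.
exact: half_add.
Qed.

Lemma kas_proj_almost_invariant : almost_invariant P.
Proof.
have hF g : qI (act g (kas_sym k)) = qI (kas_sym k) by apply/qpiP; exact: kas_act.
move=> g; rewrite -qI_act /kas_proj actZ actD act_mone /qI !qpiZ; congr (_ *: _).
by rewrite -![qpi _ _]/(qI _) !qID hF.
Qed.

Lemma kas_proj_almost_commutes : almost_commutes (rep_busby (kas_repP k)) P.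
Proof.
move=> a; have hF : qI (kas_sym k ** kas_rep k a) = qI (kas_rep k a ** kas_sym k).
  by apply/qpiP; exact: kas_comm.
rewrite -[rep_busby _ a]/(qI (kas_rep k a)) -!qIM /kas_proj amulZl amulZr /qI !qpiZ.
congr (_ *: _); rewrite -![qpi _ _]/(qI _) amulDl amulDr !qID hF.
by rewrite amulm1 amul1m.
Qed.

(** A Toeplitz extension has the class of the compression complementary to its
    own as an inverse, since both add up to the class of a representation. *)
Lemma toeplitz_invertible (X : extension A I) (s : alg A -> alg (ext_obj X))
    (x : Ext A I) : linear_splitting s ->
  (forall a, acts_as (s a) (P ** kas_rep k a ** P)) -> class_of X x ->
  ext_invertible x.
Proof.
move=> [_ sP] sE [b [s' [_ s'P] bE] ->].
have bP a : b a = qI P ** qI (kas_rep k a) ** star (qI P).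
  have [m ms ->] := bE a.
  have -> : qI m = qI (P ** kas_rep k a ** P).
    by apply: (acts_as_class _ ms (sE a)); rewrite s'P sP.
  by rewrite !qIM -qI_star kas_proj_sa.
have sQ : star (mone - P) = mone - P by rewrite starB star_mone kas_proj_sa.
have QQ : (mone - P) ** (mone - P) = mone - P.
  by rewrite amulBl !amulBr !amulm1 amul1m kas_proj_idem subrr subr0.
have iQ := almost_invariantB (@almost_invariant1 _ _ I) kas_proj_almost_invariant.
have cQ : almost_commutes (rep_busby (kas_repP k)) (mone - P).
  by move=> a; rewrite qIB amulBl amulBr kas_proj_almost_commutes amulq1 amul1q.
exists (ext_class (compression sQ QQ iQ cQ)).
rewrite -(ext_class_trivial (rep_busby_trivial (kas_repP k))).
apply: (compression_split kas_proj_sa kas_proj_idem kas_proj_almost_invariant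
  kas_proj_almost_commutes) => //.
Qed.

End KasparovModule.

(** * The norm of the multiplier algebra *)

Section MultiplierNormTheory.
Context (R : realType) (A : cstarAlgType R).
Implicit Types (m n : multiplier A) (a : A).

Lemma mnorm_eq0 m : mnorm m = 0 -> m = 0.
Proof.
move=> m0; apply: multP => x; apply/nrm_small => e e0.
by apply: le_trans (mnorm_ub m x) _; rewrite m0 mul0r ltW.
Qed.

Lemma mnorm0 : mnorm (0 : multiplier A) = 0.
Proof.
apply/eqP; rewrite eq_le mnorm_ge0 andbT; apply: mnorm_le => // x.
by rewrite nrm0 mul0r.
Qed.

Lemma mnorm_inner a : mnorm (inner a) = nrm a.
Proof.
apply/eqP; rewrite eq_le; apply/andP; split.
  by apply: mnorm_le => [|x]; [exact: nrm_ge0 | exact: nrm_amul].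
have [->|a0] := eqVneq (nrm a) 0; first exact: mnorm_ge0.
have ap : 0 < nrm a by rewrite lt_def a0 nrm_ge0.
have := mnorm_ub (inner a) (star a).
have -> : mulL (inner a) (star a) = a ** star a by [].
rewrite nrm_star -{1}[a]starK nrm_starM nrm_star expr2.
by rewrite ler_pM2r.
Qed.

Lemma mnormN m : mnorm (- m) = mnorm m.
Proof.
have le n : mnorm (- n) <= mnorm n.
  apply: mnorm_le => [|x]; first exact: mnorm_ge0.
  by rewrite mulL_mopp nrmN mnorm_ub.
by apply/eqP; rewrite eq_le le -{1}[m]opprK le.
Qed.

Lemma mnormZ (k : R[i]) m : mnorm (k *: m) = complex.Re `|k| * mnorm m.
Proof.
have le (c : R[i]) n : mnorm (c *: n) <= complex.Re `|c| * mnorm n.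
  apply: mnorm_le => [|x]; first by rewrite mulr_ge0 ?Re_norm_ge0 ?mnorm_ge0.
  have -> : mulL (c *: n) x = c *: mulL n x by [].
  rewrite nrmZ -mulrA ler_wpM2l ?Re_norm_ge0//.
  exact: mnorm_ub.
have [->|k0] := eqVneq k 0; first by rewrite scale0r normr0 mul0r mnorm0.
apply/eqP; rewrite eq_le le /=.
have kk : complex.Re `|k| * complex.Re `|k^-1| = 1.
  have E (c : R[i]) : `|c| = (complex.Re `|c|)%:C by rewrite RRe_real ?normr_real.
  have : (complex.Re `|k| * complex.Re `|k^-1|)%:C = 1%:C.
    by rewrite rmorphM /= -!E -normrM mulfV// normr1.
  by case.
have := le k^-1 (k *: m); rewrite scalerA mulVf// scale1r.
by move=> /(ler_wpM2l (Re_norm_ge0 k)); rewrite mulrA kk mul1r.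
Qed.

Lemma mnormB m n : mnorm (m - n) = mnorm (n - m).
Proof. by rewrite -mnormN opprB. Qed.

Lemma mnorm_tri m n p : mnorm (m - p) <= mnorm (m - n) + mnorm (n - p).
Proof. by rewrite -[m - p](subrKA n); exact: mnormD. Qed.

Let sq_le n : mnorm n ^+ 2 <= mnorm (star n ** n).
Proof.
have s0 : 0 <= mnorm (star n ** n) by exact: mnorm_ge0.
rewrite -[leRHS]sqr_sqrtr// ler_pXn2r ?nnegrE ?mnorm_ge0 ?sqrtr_ge0//.
apply: mnorm_le => [|x]; first exact: sqrtr_ge0.
rewrite -(@ler_pXn2r _ 2) ?nnegrE ?nrm_ge0 ?mulr_ge0 ?sqrtr_ge0 ?nrm_ge0//.
rewrite -nrm_starM exprMn sqr_sqrtr//.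
have -> : star (mulL n x) ** mulL n x = star x ** mulL (star n ** n) x.
  rewrite mulL_mmul [RHS]mulLR.
  have -> : mulR (star n) (star x) = star (mulL n (star (star x))) by [].
  by rewrite starK.
apply: le_trans (nrm_amul _ _) _; rewrite nrm_star expr2 mulrC mulrA.
by rewrite ler_wpM2r ?nrm_ge0 ?mnorm_ub.
Qed.

Lemma mnorm_star m : mnorm (star m) = mnorm m.
Proof.
have le n : mnorm n <= mnorm (star n).
  have [->|n0] := eqVneq (mnorm n) 0; first exact: mnorm_ge0.
  have np : 0 < mnorm n by rewrite lt_def n0 mnorm_ge0.
  by rewrite -(ler_pM2r np) -expr2; apply: le_trans (sq_le n) (mnormM _ _).
by apply/eqP; rewrite eq_le le andbT -{2}[m]starK le.
Qed.

Lemma mnorm_star_sq m : mnorm (star m ** m) = mnorm m ^+ 2.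
Proof.
apply/eqP; rewrite eq_le sq_le andbT; apply: le_trans (mnormM _ _) _.
by rewrite mnorm_star expr2.
Qed.

Lemma inner_inj : injective (@inner R A).
Proof.
move=> a b E; apply/eqP; rewrite -subr_eq0; apply/eqP/nrm_eq0.
rewrite -mnorm_inner (_ : inner (a - b) = 0) ?mnorm0//; apply: multP => x /=.
by have := congr1 (fun m => mulL m x) E => /= xE; rewrite amulBl xE subrr.
Qed.

End MultiplierNormTheory.

Section MultiplierActionNorm.
Context (R : realType) (G : topGroupType) (A : gcstarAlgType R G).

Lemma mnorm_act (g : G) (m : multiplier A) : mnorm (act g m) = mnorm m.
Proof.
have le h (n : multiplier A) : mnorm (act h n) <= mnorm n.
  apply: mnorm_le => [|x]; first exact: mnorm_ge0.
  have -> : mulL (act h n) x = act h (mulL n (act h^-1%g x)) by [].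
  rewrite nrm_act.
  by apply: le_trans (mnorm_ub _ _) _; rewrite nrm_act.
by apply/eqP; rewrite eq_le le /= -{1}[m](actVK g) le.
Qed.

End MultiplierActionNorm.

Section NormContinuousMultipliers.
Context (R : realType) (A : cstarAlgType R) (T : topologicalType).

(** Norm continuity of a family of multipliers, whose algebra carries no
    topology of its own. *)
Definition mnorm_continuous (f : T -> multiplier A) :=
  forall x (e : R), 0 < e -> nbhs x (fun y => mnorm (f y - f x) < e).

Lemma mnorm_continuousM (f h : T -> multiplier A) :
  mnorm_continuous f -> mnorm_continuous h ->
  mnorm_continuous (fun x => f x ** h x).
Proof.
move=> fc hc x e e0.
set c := mnorm (f x) + mnorm (h x) + 1.
have c0 : 0 < c by rewrite ltr_wpDl// addr_ge0 ?mnorm_ge0.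
have d0 : 0 < Num.min 1 (e / c) by rewrite lt_min ltr01 divr_gt0.
apply: filterS (filterI (fc x _ d0) (hc x _ d0)) => y /= [].
rewrite !lt_min => /andP[_ fy] /andP[hy1 hy].
have -> : f y ** h y - f x ** h x = (f y - f x) ** h y + f x ** (h y - h x).
  by rewrite amulBl amulBr addrA subrK.
apply: le_lt_trans (mnormD _ _) _.
have hB : mnorm (h y) <= 1 + mnorm (h x).
  rewrite -[h y](subrK (h x)); apply: le_trans (mnormD _ _) _.
  by rewrite lerD2r ltW.
apply: le_lt_trans (lerD (mnormM _ _) (mnormM _ _)) _.
have -> : e = e / c * (1 + mnorm (h x)) + mnorm (f x) * (e / c).
  by rewrite [mnorm (f x) * _]mulrC -mulrDr [_ + mnorm (f x)]addrC [1 + _]addrC addrA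
    divfK// gt_eqF.
apply: ltr_leD.
  apply: le_lt_trans (ler_wpM2l (mnorm_ge0 _) hB) _.
  by rewrite ltr_pM2r// ltr_pwDl// mnorm_ge0.
by rewrite ler_wpM2l ?mnorm_ge0// ltW.
Qed.

Lemma mnorm_continuous_isom (i : multiplier A -> multiplier A) (f : T -> multiplier A) :
  (forall m n, mnorm (i m - i n) = mnorm (m - n)) -> mnorm_continuous f ->
  mnorm_continuous (i \o f).
Proof. by move=> ii fc x e e0; apply: filterS (fc x e e0) => y; rewrite /= ii. Qed.

Lemma mnorm_continuous_cst (m : multiplier A) : mnorm_continuous (fun _ : T => m).
Proof. by move=> x e e0; apply: filterS filterT => y _; rewrite subrr mnorm0. Qed.

Lemma mnorm_continuousB (f h : T -> multiplier A) :
  mnorm_continuous f -> mnorm_continuous h -> mnorm_continuous (fun x => f x - h x).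
Proof.
move=> fc hc x e e0; have e2 : 0 < e / 2 by rewrite divr_gt0.
apply: filterS (filterI (fc x _ e2) (hc x _ e2)) => y /= [fy hy].
rewrite opprB [h x - f x]addrC addrACA [- h y + h x]addrC [e]splitr.
apply: le_lt_trans (mnormD _ _) _; rewrite [mnorm (h x - h y)]mnormB; exact: ltrD.
Qed.

Lemma mnorm_dense_eq (f h : T -> multiplier A) (S : set T) : dense S ->
  mnorm_continuous f -> mnorm_continuous h -> (forall x, S x -> f x = h x) ->
  forall x, f x = h x.
Proof.
move=> Sd fc hc E x; apply/eqP; rewrite -subr_eq0; apply/eqP/mnorm_eq0/eqP.
rewrite eq_le mnorm_ge0 andbT; apply/ler_addgt0Pr => e e0; rewrite add0r.
have e2 : 0 < e / 2 by rewrite divr_gt0.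
have : nbhs x [set y | mnorm (f y - f x) < e / 2 /\ mnorm (h y - h x) < e / 2].
  exact: filterI (fc x _ e2) (hc x _ e2).
rewrite nbhsE => -[O [oO Ox] sub].
have [|y [/sub[fy hy] /E fh]] := Sd O _ oO; first by exists x.
apply: le_trans (mnorm_tri _ (f y) _) _; rewrite [e]splitr mnormB ltW// ltrD//.
by rewrite fh.
Qed.

End NormContinuousMultipliers.

Lemma mnorm_continuous_comp (R : realType) (A : cstarAlgType R)
    (U T : topologicalType) (f : U -> T) (h : T -> multiplier A) :
  continuous f -> mnorm_continuous h -> mnorm_continuous (h \o f).
Proof. by move=> fc hc x e e0; exact: (fc x _ (hc (f x) e e0)). Qed.

(** * The pullback of a map to a quotient algebra *)

Section Twist.
Context (R : realType) (G : topGroupType).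

(** The data defining the algebra of the pairs (x, y) of X x Y in which y and
    s x have the same class modulo an ideal, s being tw_split. The ideal is both a
    subset of Y and an algebra K of its own, embedded by tw_inc. *)
Record twist_data (X K Y : gstarAlgType R G) := TwistData {
  tw_ideal : gideal Y ;
  tw_inc : K -> Y ;
  tw_split : X -> Y ;
  tw_inc_hom : star_hom tw_inc ;
  tw_inc_inj : injective tw_inc ;
  tw_idealE : forall y, tw_ideal y -> range tw_inc y ;
  tw_incE : forall k, tw_ideal (tw_inc k) ;
  tw_linear : linear tw_split ;
  tw_hom : star_hom (fun x => qpi tw_ideal (tw_split x)) }.

Context (X K Y : gstarAlgType R G) (D : twist_data X K Y).
Local Notation J := (tw_ideal D).
Local Notation s := (tw_split D).
Local Notation i := (tw_inc D).

(** The pair (x, s x + i k) is given by the coordinates (x, k), in which the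
    linear structure is the one of X x K. *)
Definition twist (_ : twist_data X K Y) : Type := (X * K)%type.
Local Notation tw := (twist D).

HB.instance Definition _ := GRing.Lmodule.copy tw (X * K)%type.

Definition tw_val (z : tw) : Y := s z.1 + i z.2.

Lemma tw_val_linear : linear tw_val.
Proof.
move=> c z z'; have [il _ _ _] := tw_inc_hom D.
by rewrite /tw_val /= tw_linear il scalerDr addrACA.
Qed.

Lemma tw_inj (z z' : tw) : z.1 = z'.1 -> tw_val z = tw_val z' -> z = z'.
Proof.
case: z z' => [x k] [x' k'] /= <-; rewrite /tw_val /= => /addrI/tw_inc_inj.
by move=> ->.
Qed.

Lemma qpi_tw_val z : qpi J (tw_val z) = qpi J (s z.1).
Proof. by apply/qpiP; rewrite addrC addrA addNr add0r; exact: tw_incE. Qed.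

Lemma tw_lift x y : qpi J y = qpi J (s x) -> {k | s x + i k = y}.
Proof.
move=> /qpiP E; apply: cid; have [k _ kE] := tw_idealE E.
by exists k; rewrite kE addrC subrK.
Qed.

Lemma tw_mulP z z' : qpi J (tw_val z ** tw_val z') = qpi J (s (z.1 ** z'.1)).
Proof. by have [_ hM _ _] := tw_hom D; rewrite qpiM !qpi_tw_val hM. Qed.

Lemma tw_starP z : qpi J (star (tw_val z)) = qpi J (s (star z.1)).
Proof. by have [_ _ hs _] := tw_hom D; rewrite qpi_star qpi_tw_val hs. Qed.

Lemma tw_actP (g : G) z : qpi J (act g (tw_val z)) = qpi J (s (act g z.1)).
Proof. by have [_ _ _ ha] := tw_hom D; rewrite qpi_act qpi_tw_val ha. Qed.

Definition tw_mul (z z' : tw) : tw := (z.1 ** z'.1, sval (tw_lift (tw_mulP z z'))).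
Definition tw_star (z : tw) : tw := (star z.1, sval (tw_lift (tw_starP z))).
Definition tw_act (g : G) (z : tw) : tw :=
  (act g z.1, sval (tw_lift (tw_actP g z))).

Lemma tw_val_mul z z' : tw_val (tw_mul z z') = tw_val z ** tw_val z'.
Proof. exact: svalP (tw_lift (tw_mulP z z')). Qed.
Lemma tw_val_star z : tw_val (tw_star z) = star (tw_val z).
Proof. exact: svalP (tw_lift (tw_starP z)). Qed.
Lemma tw_val_act g z : tw_val (tw_act g z) = act g (tw_val z).
Proof. exact: svalP (tw_lift (tw_actP g z)). Qed.
Lemma tw_valD z z' : tw_val (z + z') = tw_val z + tw_val z'.
Proof. by have := tw_val_linear 1 z z'; rewrite !scale1r. Qed.
Lemma tw_val0 : tw_val 0 = 0.
Proof. by apply: (addrI (tw_val 0)); rewrite -tw_valD !addr0. Qed.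
Lemma tw_valZ (c : R[i]) z : tw_val (c *: z) = c *: tw_val z.
Proof. by have := tw_val_linear c z 0; rewrite tw_val0 !addr0. Qed.

Let tw_mulA : associative tw_mul.
Proof. by move=> z z' z''; apply: tw_inj; rewrite ?tw_val_mul /= amulA. Qed.
Let tw_mulDl : left_distributive tw_mul +%R.
Proof. by move=> z z' z''; apply: tw_inj; rewrite ?(tw_val_mul, tw_valD) /= amulDl. Qed.
Let tw_mulDr : right_distributive tw_mul +%R.
Proof. by move=> z z' z''; apply: tw_inj; rewrite ?(tw_val_mul, tw_valD) /= amulDr. Qed.
Let tw_mulZl (c : R[i]) z z' : tw_mul (c *: z) z' = c *: tw_mul z z'.
Proof. by apply: tw_inj; rewrite ?(tw_val_mul, tw_valZ) /= amulZl. Qed.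
Let tw_mulZr (c : R[i]) z z' : tw_mul z (c *: z') = c *: tw_mul z z'.
Proof. by apply: tw_inj; rewrite ?(tw_val_mul, tw_valZ) /= amulZr. Qed.
Let tw_starK : involutive tw_star.
Proof. by move=> z; apply: tw_inj; rewrite ?tw_val_star /= starK. Qed.
Let tw_starD : {morph tw_star : z z' / z + z'}.
Proof. by move=> z z'; apply: tw_inj; rewrite ?(tw_val_star, tw_valD) /= starD. Qed.
Let tw_starZ (c : R[i]) z : tw_star (c *: z) = c^* *: tw_star z.
Proof. by apply: tw_inj; rewrite ?(tw_val_star, tw_valZ) /= starZ. Qed.
Let tw_starM z z' : tw_star (tw_mul z z') = tw_mul (tw_star z') (tw_star z).
Proof. by apply: tw_inj; rewrite ?(tw_val_star, tw_val_mul) /= starM. Qed.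

HB.instance Definition _ := Lmodule_isStarAlgebra.Build R tw
  tw_mulA tw_mulDl tw_mulDr tw_mulZl tw_mulZr tw_starK tw_starD tw_starZ tw_starM.

Let tw_act1 z : tw_act 1%g z = z.
Proof. by apply: tw_inj; rewrite ?tw_val_act /= act1. Qed.
Let tw_actM (g h : G) z : tw_act (g * h)%g z = tw_act g (tw_act h z).
Proof. by apply: tw_inj; rewrite ?tw_val_act /= actM. Qed.
Let tw_actD (g : G) : {morph tw_act g : z z' / z + z'}.
Proof. by move=> z z'; apply: tw_inj; rewrite ?(tw_val_act, tw_valD) /= actD. Qed.
Let tw_actZ (g : G) (c : R[i]) z : tw_act g (c *: z) = c *: tw_act g z.
Proof. by apply: tw_inj; rewrite ?(tw_val_act, tw_valZ) /= actZ. Qed.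
Let tw_act_mul (g : G) : {morph tw_act g : z z' / z ** z'}.
Proof. by move=> z z'; apply: tw_inj; rewrite ?(tw_val_act, tw_val_mul) /= act_amul. Qed.
Let tw_act_star (g : G) : {morph tw_act g : z / star z}.
Proof. by move=> z; apply: tw_inj; rewrite ?(tw_val_act, tw_val_star) /= act_star. Qed.

HB.instance Definition _ := StarAlgebra_hasAction.Build R G tw
  tw_act1 tw_actM tw_actD tw_actZ tw_act_mul tw_act_star.

Lemma tw_fst_hom : star_hom (fun z : tw => z.1).
Proof. by []. Qed.

Lemma tw_snd_hom : star_hom (fun k : K => (0, k) : tw).
Proof.
have s0 : s 0 = 0.
  by apply: (addrI (s 0)); have := tw_linear D 1 0 0; rewrite !scale1r !addr0 => <-.
have v k : tw_val (0, k) = i k by rewrite /tw_val /= s0 add0r.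
have [il iM istar ia] := tw_inc_hom D.
split=> [c k l|k l|k|g k].
- apply: tw_inj; first by rewrite /= scaler0 addr0.
  by rewrite tw_val_linear !v il.
- by apply: tw_inj; rewrite ?tw_val_mul ?v ?iM//= amul0l.
- by apply: tw_inj; rewrite ?tw_val_star ?v ?istar//= star0.
- by apply: tw_inj; rewrite ?tw_val_act ?v ?ia//= act0.
Qed.

End Twist.

(** * The C*-norm of the pullback *)

(** A Cauchy filter contains balls of radius 1 / n.+1, whose centres form a fast
    Cauchy sequence with the same limit. *)
Lemma fast_cauchy_complete (R : realType) (V : normedModType R[i]) :
  (forall u : nat -> V, (forall n m, (n <= m)%N -> nrm (u n - u m) <= 2 / n.+1%:R) ->
     exists (l : V) (c : R), forall n, nrm (u n - l) <= c / n.+1%:R) ->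
  forall F : set_system V, ProperFilter F -> cauchy F -> cvg F.
Proof.
move=> lim F FF /cauchyP Fc.
have /choice[u uF] (n : nat) : exists x, F [set y : V | nrm (y - x) < n.+1%:R^-1].
  have [|x Fx] := Fc (n.+1%:R^-1)%:C; first by rewrite ltcR harmonic_gt0.
  by exists x; apply: filterS Fx => y; rewrite -ball_normE /= nrm_ltE nrmB.
have [n m nm|l [c ul]] := lim u.
  have [y [yn ym]] := filter_ex (filterI (uF n) (uF m)).
  apply: le_trans (nrm_tri _ y _) _; rewrite mulrDl mul1r lerD//.
    by rewrite nrmB ltW.
  by apply: le_trans (ltW ym) (harmonic_le _ nm).
apply/cvg_ex; exists l => P /nbhs_nrmP[e e0 eP].
have c1 : 0 < `|c| + 1 by rewrite ltr_wpDl.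
have [n] := harmonic_lt (divr_gt0 e0 c1); rewrite ltr_pdivlMr// => hn.
apply: filterS (uF n) => y /= yn; apply: eP.
apply: le_lt_trans (nrm_tri _ (u n) _) _; apply: le_lt_trans hn.
rewrite mulrDr mulr1 [leRHS]addrC; apply: lerD; first exact/ltW.
apply: le_trans (ul n) _; rewrite mulrC; apply: ler_wpM2l; last exact: ler_norm.
exact/ltW/harmonic_gt0.
Qed.

Section AmbientTwist.
Context (R : realType) (G : topGroupType).

(** The last condition asks for norm continuity, whereas the action of the group on
    multipliers is a priori only strictly continuous. *)
Record ambient_data (X K : gcstarAlgType R G) := AmbientData {
  ad_twist :> twist_data X K (multiplier K) ;
  ad_inner : forall k, tw_inc ad_twist k = inner k ;
  ad_bounded : exists2 c : R, 0 <= c &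
    forall x, mnorm (tw_split ad_twist x) <= c * nrm x ;
  ad_continuous : forall x,
    mnorm_continuous (fun g : G => act g (tw_split ad_twist x)) }.

Context (X K : gcstarAlgType R G) (D : ambient_data X K).

(** The norm is the one of the algebra of the pairs (x, s x + k) in the product of X
    and M(K), that is, the maximum of the norms of the two components. *)
Definition ctwist : Type := twist D.

HB.instance Definition _ := GStarAlgebra.copy ctwist (twist D).

Implicit Types z : ctwist.

Definition ctval z : multiplier K := tw_val (D := D) z.

Lemma ctvalD z z' : ctval (z + z') = ctval z + ctval z'.
Proof. exact: tw_valD. Qed.
Lemma ctvalZ (c : R[i]) z : ctval (c *: z) = c *: ctval z.
Proof. exact: tw_valZ. Qed.
Lemma ctvalM z z' : ctval (z ** z') = ctval z ** ctval z'.
Proof. exact: tw_val_mul. Qed.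
Lemma ctval_star z : ctval (star z) = star (ctval z).
Proof. exact: tw_val_star. Qed.
Lemma ctval_act (g : G) z : ctval (act g z) = act g (ctval z).
Proof. exact: tw_val_act. Qed.
Lemma ctval0 : ctval 0 = 0.
Proof. exact: tw_val0. Qed.
Lemma ctval_inj z z' : z.1 = z'.1 -> ctval z = ctval z' -> z = z'.
Proof. exact: tw_inj. Qed.
Lemma ctvalE z : ctval z = tw_split D z.1 + inner z.2.
Proof. by rewrite /ctval /tw_val ad_inner. Qed.

Definition ct_nrm z : R := Num.max (nrm z.1) (mnorm (ctval z)).

Lemma ct_fst z : nrm z.1 <= ct_nrm z.
Proof. by rewrite le_max lexx. Qed.

Lemma ct_val z : mnorm (ctval z) <= ct_nrm z.
Proof. by rewrite le_max lexx orbT. Qed.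

Let ct_normD z z' : (ct_nrm (z + z'))%:C <= (ct_nrm z)%:C + (ct_nrm z')%:C.
Proof.
rewrite -rmorphD lecR ge_max; apply/andP; split.
  by apply: le_trans (nrmD _ _) _; rewrite lerD ?ct_fst.
by rewrite ctvalD; apply: le_trans (mnormD _ _) _; rewrite lerD ?ct_val.
Qed.

Let ct_normZ (c : R[i]) z : (ct_nrm (c *: z))%:C = `|c| * (ct_nrm z)%:C.
Proof.
rewrite -[`|c|]RRe_real ?normr_real// -rmorphM; congr _%:C.
by rewrite /ct_nrm ctvalZ mnormZ nrmZ maxr_pMr ?Re_norm_ge0.
Qed.

Let ct_norm0 z : (ct_nrm z)%:C = 0 -> z = 0.
Proof.
move=> [z0]; apply: ctval_inj.
  by apply: nrm_eq0; apply/eqP; rewrite eq_le nrm_ge0 andbT -z0 ct_fst.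
rewrite ctval0; apply: mnorm_eq0; apply/eqP.
by rewrite eq_le mnorm_ge0 andbT -z0 ct_val.
Qed.

HB.instance Definition _ := Lmodule_isNormed.Build R[i] ctwist ct_normD ct_normZ ct_norm0.

Lemma ct_nrmE z : nrm z = ct_nrm z. Proof. by []. Qed.

(** As the splitting is bounded, the coordinates (x, k) form a linear homeomorphism,
    which carries completeness and separability over from X and K. *)
Lemma ct_nrm_equiv : exists2 c : R, 0 <= c & forall z,
  nrm z <= c * nrm z.1 + nrm z.2 /\ nrm z.2 <= c * nrm z.
Proof.
have [c c0 hc] := ad_bounded D; exists (1 + c); first by rewrite addr_ge0.
move=> z; rewrite ct_nrmE; split.
  rewrite ge_max; apply/andP; split.
    by rewrite mulrDl mul1r -addrA lerDl addr_ge0 ?nrm_ge0// mulr_ge0 ?nrm_ge0.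
  rewrite ctvalE; apply: le_trans (mnormD _ _) _; rewrite mnorm_inner lerD2r.
  by apply: le_trans (hc _) _; rewrite mulrDl mul1r lerDr nrm_ge0.
rewrite -mnorm_inner.
have -> : inner z.2 = ctval z - tw_split D z.1 by rewrite ctvalE addrC addKr.
apply: le_trans (mnormD _ _) _; rewrite mnormN mulrDl mul1r lerD ?ct_val//.
by apply: le_trans (hc _) _; rewrite ler_wpM2l// ct_fst.
Qed.

Let ct_complete (F : set_system ctwist) : ProperFilter F -> cauchy F -> cvg F.
Proof.
move: F; apply: fast_cauchy_complete => u uc.
have [c c0 hc] := ct_nrm_equiv.
have [x hx] : exists x, forall n, nrm ((u n).1 - x) <= 2 / n.+1%:R.
  apply: (cauchy_limit (u := fun n => (u n).1)) => n m nm; apply: le_trans (uc n m nm).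
  exact: (ct_fst (u n - u m)).
have [k hk] : exists k, forall n, nrm ((u n).2 - k) <= (c * 2) / n.+1%:R.
  apply: (cauchy_limit (u := fun n => (u n).2)) => n m nm.
  apply: le_trans (hc (u n - u m)).2 _; rewrite -mulrA ler_wpM2l//.
  exact: uc.
exists ((x, k) : ctwist), (c * 2 + c * 2) => n.
apply: le_trans (hc _).1 _; rewrite mulrDl -{1}mulrA.
by apply: lerD; [apply: ler_wpM2l => //; exact: hx | exact: hk].
Qed.

HB.instance Definition _ := Uniform_isComplete.Build ctwist ct_complete.

Let ct_norm_amul z z' : `|z ** z'| <= `|z| * `|z'|.
Proof.
rewrite !nrmE -rmorphM lecR !ct_nrmE ge_max; apply/andP; split.
  by apply: le_trans (nrm_amul _ _) _; rewrite ler_pM ?nrm_ge0 ?ct_fst.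
rewrite ctvalM; apply: le_trans (mnormM _ _) _.
by rewrite ler_pM ?mnorm_ge0 ?ct_val.
Qed.

Let ct_cstar z : `|star z ** z| = `|z| ^+ 2.
Proof.
rewrite !nrmE -rmorphXn; congr _%:C; rewrite !ct_nrmE /ct_nrm ctvalM ctval_star.
rewrite mnorm_star_sq [nrm _]nrm_starM !expr2.
have [le|lt] := leP (nrm z.1) (mnorm (ctval z)).
  by apply/max_idPr; rewrite ler_pM ?nrm_ge0.
by apply/max_idPl; rewrite ler_pM ?mnorm_ge0 ?ltW.
Qed.

HB.instance Definition _ := StarAlgebra_isCStarAlgebra.Build R ctwist
  ct_norm_amul ct_cstar.

Let ct_norm_act (g : G) z : `|act g z| = `|z|.
Proof.
by rewrite !nrmE; congr _%:C; rewrite !ct_nrmE /ct_nrm ctval_act mnorm_act nrm_act.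
Qed.

Let ct_act_continuous z : continuous (fun g : G => act g z).
Proof.
apply/continuous_nrmP => g e e0.
have /continuous_nrmP h1 := act_continuous z.1.
have /continuous_nrmP h2 := act_continuous z.2.
have e2 : 0 < e / 2 by rewrite divr_gt0.
apply: filterS (filterI (h1 g _ e0)
  (filterI (h2 g _ e2) (ad_continuous D z.1 g e2))) => h /= [H1 [H2 H3]].
rewrite ct_nrmE gt_max H1 /=.
have -> : ctval (act h z - act g z) = (act h (tw_split D z.1) - act g (tw_split D z.1)) +
    inner (act h z.2 - act g z.2).
  have vB (x y : ctwist) : ctval (x - y) = ctval x - ctval y.
    by rewrite ctvalD -scaleN1r ctvalZ scaleN1r.
  have iB (x y : K) : inner (x - y) = inner x - inner y.
    by have [il _ _ _] := inner_hom K; rewrite addrC -scaleN1r il scaleN1r addrC.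
  rewrite vB !ctval_act !ctvalE !actD iB.
  have [_ _ _ ia] := inner_hom K.
  by rewrite !ia opprD addrACA.
apply: le_lt_trans (mnormD _ _) _; rewrite mnorm_inner [e]splitr.
exact: ltrD.
Qed.

HB.instance Definition _ := GStarAlgebra_isContinuous.Build R G ctwist
  ct_norm_act ct_act_continuous.

Lemma ct_fst_continuous : continuous (fun z : ctwist => z.1).
Proof.
by apply: (@lipschitz_continuous _ _ _ _ 1) => z z'; rewrite mul1r; exact: (ct_fst (z - z')).
Qed.

Lemma ct_snd_continuous : continuous (fun k : K => (0, k) : ctwist).
Proof.
have [c c0 hc] := ct_nrm_equiv.
apply: (@lipschitz_continuous _ _ _ _ 1) => k l.
have -> : ((0, k) : ctwist) - (0, l) = (0 - 0, k - l) :> ctwist by [].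
rewrite subrr.
by apply: le_trans (hc _).1 _; rewrite /= nrm0 mulr0 add0r mul1r.
Qed.

Lemma ct_dense (S : set X) (T : set K) : dense S -> dense T ->
  dense [set z : ctwist | S z.1 /\ T z.2].
Proof.
move=> /denseP Sd /denseP Td; apply/denseP => z e e0.
have [c c0 hc] := ct_nrm_equiv.
have c1 : 0 < c + 1 by rewrite ltr_wpDl.
have e1 : 0 < e / (c + 1) by rewrite divr_gt0.
have [x Sx xz] := Sd z.1 _ e1; have [k Tk kz] := Td z.2 _ e1.
exists ((x, k) : ctwist) => //; apply: le_lt_trans (hc _).1 _.
have -> : e = c * (e / (c + 1)) + e / (c + 1).
  by rewrite -{2}[e / _]mul1r -mulrDl mulrCA divff ?mulr1// gt_eqF.
by apply: ler_ltD => //; apply: ler_wpM2l => //; exact: ltW.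
Qed.

Lemma ct_separable : separable_space X -> separable_space K -> separable_space ctwist.
Proof.
move=> [S Sc Sd] [T Tc Td]; exists [set z : ctwist | S z.1 /\ T z.2].
  exact: countableX Sc Tc.
exact: ct_dense.
Qed.

End AmbientTwist.

(** * The Toeplitz extension of a Kasparov module *)

(** A is complete and embedded isometrically in M(A), hence closed. *)
Lemma inner_closed (R : realType) (A : cstarAlgType R) (m : multiplier A) :
  (forall e : R, 0 < e -> exists a, mnorm (m - inner a) < e) -> exists a, inner a = m.
Proof.
move=> h.
have /choice[u hu] (n : nat) : exists a, mnorm (m - inner a) < n.+1%:R^-1.
  by apply: h; exact: harmonic_gt0.
have [n k nk|a ha] := @cauchy_limit R A u 2.
  rewrite -mnorm_inner innerB; apply: le_trans (mnorm_tri _ m _) _.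
  rewrite mulrDl mul1r mnormB; apply: lerD; first exact/ltW/hu.
  exact: le_trans (ltW (hu k)) (harmonic_le _ nk).
exists a; apply/eqP; rewrite -subr_eq0; apply/eqP/mnorm_eq0/eqP.
rewrite eq_le mnorm_ge0 andbT; apply/ler_addgt0Pr => e e0; rewrite add0r.
have e3 : 0 < e / 3 by rewrite divr_gt0.
have [n hn] := harmonic_lt e3; apply: le_trans (mnorm_tri _ (inner (u n)) _) _.
rewrite -innerB mnorm_inner nrmB mnormB.
apply: le_trans (lerD (ha n) (ltW (hu n))) _.
rewrite -[X in _ + X]mul1r -mulrDl natr1 mulrC -ler_pdivlMr//.
exact: ltW.
Qed.

Section ToeplitzExtension.
Context (R : realType) (G : topGroupType).
Hypotheses (G_hausdorff : hausdorff_space G) (G_lc : locally_compact [set: G]).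
Context (A : cobj R G) (I : cstableIdeal R G).

Lemma amb_act_continuous (B : gcstarAlgType R G) (u : G -> B) :
  continuous u -> continuous (fun g => act g (u g)).
Proof.
move=> /continuous_nrmP uc; apply/continuous_nrmP => g e e0.
have e2 : 0 < e / 2 by rewrite divr_gt0.
have /continuous_nrmP ac := act_continuous (u g).
apply: filterS (filterI (uc g _ e2) (ac g _ e2)) => h /= [h1 h2].
apply: le_lt_trans (nrm_tri _ (act h (u g)) _) _.
by rewrite -actB nrm_act [e]splitr ltrD.
Qed.

(** The action on multipliers is only strictly continuous, but g P - P is a cocycle
    with values in the ideal, and such a cocycle is norm continuous. *)
Lemma almost_invariant_continuous (P : malg I) :
  almost_invariant P -> mnorm_continuous (fun g : G => act g P).
Proof.
move=> iP.
have /choice[f fP] (g : G) : exists a : amb I, inner a = act g P - P.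
  have /qpiP[j _ jE] : qI (act g P) = qI P by rewrite qI_act iP.
  by exists (emb j).
have [il _ _ ia] := inner_hom (amb I).
have fc : continuous f.
  apply: (cocycle_continuous G_hausdorff G_lc (amb_separable I)).
    move=> g h; apply: inner_inj; have := il 1 (act g (f h)) (f g).
    rewrite !scale1r => ->; rewrite ia !fP actM actB.
    by rewrite addrA subrK.
  move=> b.
  have -> : (fun g => f g ** b) = (fun g => act g (mulL P (act g^-1%g b)) - mulL P b).
    apply/funext => g; have := congr1 (fun m => mulL m b) (fP g) => /= ->.
    by rewrite scaleN1r.
  move=> g; apply: cvgB; last exact: cvg_cst.
  apply: (amb_act_continuous (u := fun g => mulL P (act g^-1%g b))).
  apply: (cont_comp (f := fun g : G => act g^-1%g b) (h := mulL P)); last exact: mulL_continuous.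
  apply: (cont_comp (f := fun g : G => (g^-1)%g) (h := fun g : G => act g b)).
    exact: invg_continuous.
  exact: act_continuous.
move/continuous_nrmP in fc => g e e0; apply: filterS (fc g e e0) => h /=.
by rewrite -mnorm_inner innerB !fP opprB addrA subrK.
Qed.

Context (k : kasparov_module A I).
Local Notation P := (kas_proj k).
Let pi := kas_rep k.

Let sP : star P = P := kas_proj_sa k.
Let PP : P ** P = P := kas_proj_idem k.
Let iP : almost_invariant P := kas_proj_almost_invariant k.

(* The continuous extension of the representation to the ambient algebra. *)
Let hex := cid (kas_repP k).2.
Let h : amb A -> malg I := sval hex.
Let hl : linear h := (svalP hex).1.1.
Let hE a : h (emb a) = pi a := (svalP hex).2 a.
Let hb : exists2 c : R, 0 <= c & forall a, mnorm (h a) <= c * nrm a.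
Proof.
have [c hc] := (svalP hex).1.2; exists `|c|; first exact: normr_ge0.
by move=> a; apply: le_trans (hc a) _; rewrite ler_wpM2r ?nrm_ge0// ler_norm.
Qed.

Let hc : mnorm_continuous h.
Proof.
have [c c0 hc] := hb; move=> x e e0; apply/nbhs_nrmP.
have c1 : 0 < c + 1 by rewrite ltr_wpDl.
exists (e / (c + 1)); first by rewrite divr_gt0.
move=> y; rewrite ltr_pdivlMr// mulrC; apply: le_lt_trans.
have -> : h y - h x = h (y - x).
  by rewrite addrC -scaleN1r -hl scaleN1r addrC.
by apply: le_trans (hc _) _; rewrite ler_wpM2r ?nrm_ge0// lerDl.
Qed.

Let h_hom : star_hom h.
Proof.
have [p1 p2 p3 p4] := (kas_repP k).1; have [e1 e2 e3 e4] := @emb_hom _ _ A.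
have dA := @emb_dense _ _ A.
split=> [||x|g x]; first exact: hl.
- move=> x y; move: x; apply: (mnorm_dense_eq dA).
  + by apply: (mnorm_continuous_comp (f := fun x => x ** y)) hc; exact: amulr_continuous.
  + by apply: mnorm_continuousM => //; exact: mnorm_continuous_cst.
  move=> _ [x _ <-]; move: y; apply: (mnorm_dense_eq dA).
  + by apply: (mnorm_continuous_comp (f := fun y => emb x ** y)) hc; exact: amull_continuous.
  + by apply: mnorm_continuousM => //; exact: mnorm_continuous_cst.
  by move=> _ [y _ <-]; rewrite -e2 !hE; exact: p2.
- move: x; apply: (mnorm_dense_eq dA).
  + by apply: (mnorm_continuous_comp (f := @star R (amb A))) hc; exact: star_continuous.
  + by apply: (mnorm_continuous_isom (i := star)) hc => m n; rewrite -starB mnorm_star.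
  by move=> _ [x _ <-]; rewrite -e3 !hE; exact: p3.
- move: x; apply: (mnorm_dense_eq dA).
  + by apply: (mnorm_continuous_comp (f := act g : amb A -> amb A)) hc; exact: act_cont.
  + by apply: (mnorm_continuous_isom (i := act g)) hc => m n; rewrite -actB mnorm_act.
  by move=> _ [x _ <-]; rewrite -e4 !hE; exact: p4.
Qed.

Local Notation qF := (qpi (full_ideal I)).

(* The commutators with elements of the dense subalgebra lie in the ideal, which is
   closed. *)
Let P_comm x : full_ideal I (P ** h x - h x ** P).
Proof.
have [a aE] : exists a, inner a = P ** h x - h x ** P; last by exists a.
apply: inner_closed => e e0.
have cc : mnorm_continuous (fun x => P ** h x - h x ** P).
  by apply: mnorm_continuousB; apply: mnorm_continuousM => //; exact: mnorm_continuous_cst.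
have := cc x e e0; rewrite nbhsE => -[O [oO Ox] sub].
have [|y [/sub xy [a _ aE]]] := @emb_dense _ _ A O _ oO; first by exists x.
rewrite -aE in xy.
have /qpiP[j _ jE] : qI (P ** pi a) = qI (pi a ** P).
  by rewrite !qIM; exact: kas_proj_almost_commutes.
by exists (emb j); rewrite jE mnormB -!hE.
Qed.

Let P_full g : qF (act g P) = qF P.
Proof. by apply/qpiP/sub_full/qpiP; rewrite -/(qI _) qI_act iP. Qed.

Let alg_split_hom : star_hom (fun a : alg A => qpi (sub_ideal I) (P ** pi a ** P)).
Proof.
have -> : (fun a => qpi (sub_ideal I) (P ** pi a ** P)) =
    (fun a => qI P ** qI (pi a) ** star (qI P)).
  by apply/funext => a; rewrite -qI_star sP -!qIM.
apply: (compress_hom (f := fun a => qI (pi a))).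
- exact: star_hom_comp (qpi_hom _) (kas_repP k).1.
- by rewrite -qI_star sP.
- by rewrite -qIM PP.
- exact: iP.
- exact: kas_proj_almost_commutes.
Qed.

Let amb_split_hom : star_hom (fun x : amb A => qF (P ** h x ** P)).
Proof.
have -> : (fun x => qF (P ** h x ** P)) = (fun x => qF P ** qF (h x) ** star (qF P)).
  by apply/funext => x; rewrite -qpi_star sP -!qpiM.
apply: (compress_hom (f := fun x => qF (h x))).
- exact: star_hom_comp (qpi_hom _) h_hom.
- by rewrite -qpi_star sP.
- by rewrite -qpiM PP.
- by move=> g; rewrite -qpi_act P_full.
- by move=> x; rewrite -!qpiM; apply/qpiP/P_comm.
Qed.

Let alg_inc_hom : star_hom (fun j : alg I => inner (emb j) : malg I).
Proof. exact: star_hom_comp (@inner_hom _ _ _) (@emb_hom _ _ _). Qed.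

Let alg_inc_inj : injective (fun j : alg I => inner (emb j) : malg I).
Proof. by move=> i j /inner_inj/emb_inj. Qed.

Let alg_split_linear : linear (fun a : alg A => P ** pi a ** P).
Proof. by apply: conj_linear; case: (kas_repP k).1. Qed.

Let amb_split_linear : linear (fun x : amb A => P ** h x ** P).
Proof. exact: conj_linear hl. Qed.

(** The pullback of the Busby map a |-> q (P pi a P), split by a |-> P pi a P; the
    ambient C*-algebra is the pullback of the same map for the closures. *)
Definition toeplitz_data : twist_data (alg A) (alg I) (malg I) :=
  @TwistData R G _ _ _ (sub_ideal I) _ _ alg_inc_hom alg_inc_inj (fun y => id)
    (fun j => ex_intro2 _ _ j Logic.I erefl) alg_split_linear alg_split_hom.

Let amb_twist : twist_data (amb A) (amb I) (malg I) :=
  @TwistData R G _ _ _ (full_ideal I) _ _ (@inner_hom _ _ (amb I)) (@inner_inj _ (amb I))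
    (fun y => id) (fun j => ex_intro2 _ _ j Logic.I erefl) amb_split_linear amb_split_hom.

Let amb_split_bounded : exists2 c : R, 0 <= c &
  forall x, mnorm (tw_split amb_twist x) <= c * nrm x.
Proof.
have [c c0 hcb] := hb.
exists (mnorm P * c * mnorm P); first by rewrite !mulr_ge0 ?mnorm_ge0.
move=> x; apply: le_trans (mnormM _ _) _; rewrite [leRHS]mulrAC.
rewrite ler_wpM2r ?mnorm_ge0//; apply: le_trans (mnormM _ _) _.
by rewrite -mulrA ler_wpM2l ?mnorm_ge0.
Qed.

Let amb_split_continuous x :
  mnorm_continuous (fun g : G => act g (tw_split amb_twist x)).
Proof.
have [_ _ _ ha] := h_hom.
have -> : (fun g : G => act g (tw_split amb_twist x)) =
    (fun g => act g P ** h (act g x) ** act g P).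
  by apply/funext => g; rewrite /= !act_amul ha.
have Pc := almost_invariant_continuous iP.
apply: mnorm_continuousM; last exact: Pc.
apply: mnorm_continuousM; first exact: Pc.
apply: (mnorm_continuous_comp (f := fun g : G => act g x)) hc.
exact: act_continuous.
Qed.

Definition toeplitz_ambient : ambient_data (amb A) (amb I) :=
  @AmbientData R G _ _ amb_twist (fun=> erefl) amb_split_bounded amb_split_continuous.

Let Ealg : gstarAlgType R G := twist toeplitz_data.
Let Eamb : gcstarAlgType R G := ctwist toeplitz_ambient.

Let Eemb (z : Ealg) : Eamb := (emb z.1, emb z.2).

Let Eemb_val z : ctval (Eemb z) = tw_val z.
Proof. by rewrite ctvalE /= hE. Qed.

Let Eemb_hom : star_hom Eemb.
Proof.
have [e1 e2 e3 e4] := @emb_hom _ _ A.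
split=> [c x y|x y|x|g x]; apply: ctval_inj.
- exact: e1.
- by rewrite ctvalD ctvalZ !Eemb_val tw_val_linear.
- exact: e2.
- by rewrite ctvalM !Eemb_val tw_val_mul.
- exact: e3.
- by rewrite ctval_star !Eemb_val tw_val_star.
- exact: e4.
- by rewrite ctval_act !Eemb_val tw_val_act.
Qed.

Let Eemb_inj : injective Eemb.
Proof. by move=> [x j] [x' j'] [/emb_inj-> /emb_inj->]. Qed.

Let Eemb_dense : dense (range Eemb).
Proof.
have := @ct_dense _ _ _ _ toeplitz_ambient _ _ (@emb_dense _ _ A) (@emb_dense _ _ I).
move=> d O O0 oO; have [[x y] [Oz [[a _ aE] [j _ jE]]]] := d O O0 oO.
exists (x, y); split=> //; exists (a, j) => //.
by rewrite /Eemb /= aE jE.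
Qed.

Definition toeplitz_obj : cobj R G := CObj Eemb_hom Eemb_inj Eemb_dense
  (@ct_separable _ _ _ _ toeplitz_ambient (amb_separable A) (amb_separable I)).

Let inc (j : alg I) : alg toeplitz_obj := ((0, j) : Ealg).
Let proj (z : alg toeplitz_obj) : alg A := (z : Ealg).1.
Let inc_amb (j : amb I) : amb toeplitz_obj := ((0, j) : Eamb).
Let proj_amb (z : amb toeplitz_obj) : amb A := (z : Eamb).1.

Let emb0 : emb (0 : alg A) = 0.
Proof. exact: star_hom0 (@emb_hom _ _ A). Qed.

Let inc_mor : cmorphism (X := I) (Y := toeplitz_obj) inc.
Proof.
split; first exact: tw_snd_hom.
have [c c0 hcb] := ct_nrm_equiv toeplitz_ambient; exists 1 => j; rewrite mul1r.
by apply: le_trans (hcb _).1 _; rewrite /= emb0 nrm0 mulr0 add0r.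
Qed.

Let proj_mor : cmorphism (X := toeplitz_obj) (Y := A) proj.
Proof.
split; first exact: tw_fst_hom.
by exists 1 => z; rewrite mul1r; exact: (ct_fst (Eemb z)).
Qed.

Let inc_ext : ambient_extension inc inc_amb.
Proof.
split; first exact: ct_snd_continuous.
by move=> j; rewrite /inc_amb -emb0.
Qed.

Let proj_ext : ambient_extension proj proj_amb.
Proof. by split; first exact: ct_fst_continuous. Qed.

Let exact_alg : short_exact inc proj.
Proof.
split=> [i j []//||].
- apply/seteqP; split=> [_ [j _ <-]//|[a j] /= a0].
  by exists j => //; rewrite /inc -a0.
- by apply/seteqP; split=> // a _; exists ((a, 0) : Ealg).
Qed.

Let exact_amb : short_exact inc_amb proj_amb.
Proof.
split=> [i j []//||].
- apply/seteqP; split=> [_ [j _ <-]//|[a j] /= a0].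
  by exists j => //; rewrite /inc_amb -a0.
- by apply/seteqP; split=> // a _; exists ((a, 0) : Eamb).
Qed.

Definition toeplitz_extension : extension A I :=
  @Extension R G A I toeplitz_obj inc proj inc_amb proj_amb inc_mor proj_mor
    inc_ext proj_ext exact_alg exact_amb.

Let split (a : alg A) : alg (ext_obj toeplitz_extension) := ((a, 0) : Ealg).

Let split_linear : linear_splitting (X := toeplitz_extension) split.
Proof.
split=> // c a b.
have -> : c *: split a + split b = ((c *: a + b, c *: 0 + 0) : Ealg) by [].
by rewrite scaler0 addr0.
Qed.

Let split_acts a : acts_as (X := toeplitz_extension) (split a) (P ** pi a ** P).
Proof.
have v0 (x : amb I) : ctval (inc_amb x : Eamb) = inner x.
  rewrite ctvalE /= -[RHS]add0r; congr (_ + _).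
  have := amb_split_linear 1 0 0; rewrite !scale1r !addr0 => h0.
  by apply: (addrI (P ** h 0 ** P)); rewrite addr0 -h0.
have va : ctval (Eemb (split a)) = P ** pi a ** P.
  by rewrite Eemb_val /tw_val /= (star_hom0 alg_inc_hom) addr0.
move=> x; split; apply: ctval_inj.
- by rewrite /= amul0r.
- by rewrite ctvalM v0 va v0 mul_inner.
- by rewrite /= amul0l.
- by rewrite ctvalM v0 va v0 inner_mul.
Qed.

Lemma toeplitz_extension_toeplitz : toeplitz toeplitz_extension.
Proof. by exists k, split; split; [exact: split_linear | exact: split_acts]. Qed.

Lemma toeplitz_extension_class (b : busby A I) :
  (forall a, b a = qI P ** qI (pi a) ** star (qI P)) ->
  class_of toeplitz_extension (ext_class b).
Proof.
move=> bE; exists b => //; exists split; first exact: split_linear.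
move=> a; exists (P ** pi a ** P); first exact: split_acts.
by rewrite bE -qI_star sP -!qIM.
Qed.

End ToeplitzExtension.

(** * Invertible classes are compressions *)

Section Dilation.
Context (R : realType) (G : topGroupType) (A : cobj R G) (I : cstableIdeal R G).
Context (b : busby A I) (p : alg A -> malg I) (w : malg I).
Hypotheses (pP : representation p) (ww : star w ** w = mone).
Hypothesis wi : almost_invariant w.
Hypothesis wp : forall a, qI (p a) ** qI w = qI w ** b a.

Let P := w ** star w.

Let sP : star P = P. Proof. by rewrite starM starK. Qed.

Let PP : P ** P = P.
Proof. by rewrite /P amulA -[w ** _ ** w]amulA ww amulm1. Qed.

Let iP : almost_invariant P.
Proof. exact: almost_invariantM wi (almost_invariant_star wi). Qed.

Let pw a : star (qI w) ** qI (p a) = b a ** star (qI w).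
Proof.
have [_ _ ps _] := pP.1; have [_ _ bs _] := busby_hom b.
rewrite -[LHS]starK starM starK -qI_star -ps wp starM bs !starK.
by [].
Qed.

Let qPE a : qI P ** qI (p a) = qI w ** b a ** star (qI w).
Proof. by rewrite /P qIM qI_star -amulA pw amulA. Qed.

Let Pcomm a : qI P ** qI (p a) = qI (p a) ** qI P.
Proof. by rewrite qPE /P qIM qI_star amulA wp. Qed.

Let F := P + P - mone.

Let sF : star F = F. Proof. by rewrite starB starD sP star_mone. Qed.

Let FF : F ** F = mone.
Proof.
have FP : F ** P = P by rewrite amulBl amulDl PP amul1m addrK.
by rewrite {2}/F amulBr amulDr FP amulm1 opprB addrCA subrr addr0.
Qed.

Let Fact (g : G) : sub_ideal I (act g F - F).
Proof.
apply/qpiP; rewrite -![qpi _ _]/(qI _) qI_act.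
apply: almost_invariantB; last exact: almost_invariant1.
exact: almost_invariantD.
Qed.

Let Fcomm a : sub_ideal I (F ** p a - p a ** F).
Proof.
apply/qpiP; rewrite -![qpi _ _]/(qI _) !qIM qIB qID.
by rewrite amulBl amulBr amulDl amulDr Pcomm amul1q amulq1.
Qed.

(** The Kasparov module of a dilation: its projection is the range projection
    of w, and it compresses p to the conjugate of b by w. *)
Definition dilation_module : kasparov_module A I :=
  KasparovModule pP sF FF Fact Fcomm.

Lemma dilation_proj : kas_proj dilation_module = w ** star w.
Proof.
rewrite /kas_proj /= subrK -mulr2n -(scaler_nat 2 P) scalerA mulVf ?scale1r//.
by rewrite pnatr_eq0.
Qed.

Lemma dilation_compression a :
  qI (kas_proj dilation_module) ** qI (kas_rep dilation_module a) **
    star (qI (kas_proj dilation_module)) = qI w ** b a ** star (qI w).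
Proof.
rewrite dilation_proj -/P -[star (qI P)]qI_star sP -amulA -Pcomm amulA -qIM PP.
exact: qPE.
Qed.

End Dilation.

(** If u conjugates b + (b' + d) to a trivial Busby map, then b is the corner of this
    trivial map cut out by the isometry u v, where v is the first isometry of the
    pair defining the sum. *)
Lemma invertible_dilation (R : realType) (G : topGroupType) (A : cobj R G)
    (I : cstableIdeal R G) (b : busby A I) : ext_invertible (ext_class b) ->
  exists (p : alg A -> malg I) (w : malg I), [/\ representation p,
    star w ** w = mone, almost_invariant w &
    forall a, qI (p a) ** qI w = qI w ** b a].
Proof.
move=> [y]; have [b' ->] := ext_class_surj y; rewrite ext_addE.
move=> /ext_classP[d [d' [dt dt' E]]].
have [V VE] := busby_addE A I; rewrite !VE in E.
have {}E := strong_trans (strong_sym (busby_sum_assoc V b b' d)) E.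
have [p pP pE] := busby_sum_trivial V (trivial_busby0 A I) dt'.
have [u [[u1 u2] ui] uE] := E; set v := iso1 V.
have vv : star v ** v = mone by exact: iso1_isometry.
have vi : almost_invariant v by exact/invariant_almost/iso1_act.
exists p, (u ** v); split=> //.
- by rewrite starM amulA -[star v ** _ ** u]amulA u1 amulm1.
- exact: almost_invariantM.
move=> a; rewrite -pE uE qIM !amulA.
have -> : qI u ** busby_sum V b (busby_sum V b' d) a ** star (qI u) ** qI u =
    qI u ** busby_sum V b (busby_sum V b' d) a.
  by rewrite -amulA -qI_star -qIM u1 amulq1.
rewrite -!amulA; congr (_ ** _).
rewrite -[busby_sum _ _ _ a]/(busby_sum_map V b (busby_sum V b' d) a) /busby_sum_map -/v.
rewrite amulDl -!amulA -!qI_star -!qIM vv.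
have -> : star (iso2 V) ** v = 0.
  by rewrite -[LHS]starK starM starK iso_orthogonal star0.
by rewrite qI0 !amul0r addr0 amulq1.
Qed.

Theorem theorem3p2 (R : realType) (G : topGroupType)
    (G_hausdorff : hausdorff_space G)
    (G_locally_compact : locally_compact [set: G])
    (G_second_countable : @second_countable G)
    (A : cobj R G) (I : cstableIdeal R G) (x : Ext A I) :
  ext_invertible x <->
  exists X : extension A I, toeplitz X /\ class_of X x.
Proof.
split=> [|[X [[k [s [sl sE]]] Xx]]]; last exact: toeplitz_invertible sl sE Xx.
have [b ->] := ext_class_surj x.
move=> /invertible_dilation[p [w [pP ww wi wp]]].
pose k := dilation_module pP ww wi wp.
have kE a := dilation_compression pP ww wi wp a.
exists (toeplitz_extension G_hausdorff G_locally_compact k); split.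
  exact: toeplitz_extension_toeplitz.
pose c := compression (kas_proj_sa k) (kas_proj_idem k)
  (kas_proj_almost_invariant k) (@kas_proj_almost_commutes _ _ _ _ k).
rewrite (ext_class_isometry (c := c) ww wi kE).
exact: toeplitz_extension_class.
Qed.
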